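(* The algorithm $\langle 1,2\rangle$-polar Recognition, displayed in full in the context, is an $\mathcal{O}(n+m)$-time certifying algorithm to recognize $\langle 1,2\rangle$-polar chordal graphs, where $n$ and $m$ are the numbers of vertices and edges of the input graph.
   Context: All graphs are finite and simple. A $\langle 1,2\rangle$-polar partition of a graph $G$ is a partition $(A,B)$ of $V(G)$ (parts may be empty) such that $A$ is a clique and every connected component of $G[B]$ is isomorphic to $K_1$ or $K_2$; $G$ is $\langle 1,2\rangle$-polar if it admits such a partition. $G+H$ denotes disjoint union and $2G$ the disjoint union of two copies of $G$. The graphs $2P_3$, $P_3+K_3$, $2K_3$ are not $\langle 1,2\rangle$-polar, so a vertex set inducing one of them is a no-certificate, and a $\langle 1,2\rangle$-polar partition is a yes-certificate. Algorithm $\langle 1,2\rangle$-polar Recognition. Input: a chordal graph $G$ with vertex set and adjacency lists ordered by degree non-increasingly. Output: a $\langle 1,2\rangle$-polar partition $(A,B)$ of $G$, or a set of vertices inducing $2P_3$, $P_3+K_3$ or $2K_3$. The steps are executed in order, and execution stops at the first ''return''. (1) Let $K$ be a maximal clique constructed by iteratively choosing a candidate vertex of maximum degree. Let $C_1,\dots,C_k$ be the connected components of $G-K$. (2) If $|V(C_i)|\le 2$ for each $i\in\{1,\dots,k\}$, return $(K,\bigcup_{i=1}^k V(C_i))$. (3) If $|V(C_i)|,|V(C_j)|\ge 3$ for (distinct) $i,j\in\{1,\dots,k\}$: let $S$ be a 3-vertex subset of $V(C_i)$ and $T$ a 3-vertex subset of $V(C_j)$, each inducing a $P_3$ or a $K_3$;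 return $S\cup T$. (4) Let $C$ be the vertex set of the only component of $G-K$ with more than two vertices. (5) If there is a vertex $u\in C$ with $|K|-1$ neighbours in $K$: let $x$ be the only non-neighbour of $u$ in $K$, and let $S$ be a 3-vertex subset of $C$ inducing a $P_3$ or a $K_3$. (5a) If $x$ is adjacent to at least two components of $G-K$: let $T$ consist of $x$ and two neighbours of $x$ in different components of $G-K$; return $S\cup T$. (5b) If $x$ is adjacent to a component $C_i$ of order at least 2: let $T$ consist of $x$ and 2 vertices in $V(C_i)$ such that $T$ induces a $P_3$ or a $K_3$; return $S\cup T$. (5c) If there is a component $D$ of $G[C]-u$ with more than two vertices: redefine $S$ as a 3-vertex subset of $V(D)$ inducing a $P_3$ or a $K_3$; let $y$ be a non-neighbour in $K$, different from $x$, of every vertex in $S$; let $w$ be a neighbour of $x$ not in $K$; return $S\cup\{w,x,y\}$. (5d) Replace $K$ by $(K\setminus\{x\})\cup\{u\}$ and return $(K,V(G)\setminus K)$. (6) If there is a vertex $u\in C$ with $|K|-2$ neighbours in $K$: let $x,y$ be the two non-neighbours of $u$ in $K$. (6a) If $x$ or $y$ has a neighbour $z$ outside $K$: let $S$ be a 3-vertex subset of $C$ inducing a $P_3$ or a $K_3$; return $S\cup\{x,y,z\}$. (6b) If there is a component $D$ of $G[C]-u$ with more than two vertices: let $S$ be a 3-vertex subset of $V(D)\setminus\{u\}$ inducing a $P_3$ or a $K_3$; let $z$ be a non-neighbour in $K$, different from $x$ and $y$, of every vertex in $S$; return $S\cup\{x,y,z\}$. (6c) Replace $K$ by $(K\setminus\{x,y\})\cup\{u\}$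 and return $(K,V(G)\setminus K)$. (7) Let $S$ be a 3-vertex subset of $C$ inducing a $P_3$ or a $K_3$, and let $T$ be three vertices in $K$ non-adjacent to every vertex in $C$; return $S\cup T$. *)

(* Defs.v *)
From mathcomp Require Import all_boot.

Set Implicit Arguments.
Unset Strict Implicit.
Unset Printing Implicit Defensive.

(* A finite simple graph is a symmetric irreflexive [e : rel T], [T : finType]. *)

Section Graphs.
Variables (T : finType) (e : rel T).
Implicit Types (A B C S : {set T}) (v x y : T).

Definition nbh v : {set T} := [set w | e v w].
Definition deg v : nat := #|nbh v|.
Definition edges : {set {set T}} :=
  [set [set p.1; p.2] | p : T * T & e p.1 p.2].

(* [ucycle e c]: [c] lists the pairwise distinct vertices of a cycle in cyclic
   order; a chord joins two of them that are not consecutive on [c]. *)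
Definition chordal : Prop :=
  forall c : seq T, ucycle e c -> 3 < size c ->
  exists x y, [/\ x \in c, y \in c, e x y, y != next c x & x != next c y].

Definition is_clique A : bool :=
  [forall x in A, forall y in A, (x != y) ==> e x y].

(* Vertex sets of the connected components of the subgraph induced by [B]. *)
Definition components B : {set {set T}} :=
  equivalence_partition
    (connect [rel x y | [&& x \in B, y \in B & e x y]]) B.

(* [S] induces a copy of the graph [h]. *)
Definition induces S (U : finType) (h : rel U) : bool :=
  [exists f : {ffun U -> T},
    [&& injectiveb f, [set f i | i : U] == S
      & [forall i, forall j, e (f i) (f j) == h i j]]].

End Graphs.

Definition complete (k : nat) : rel 'I_k := fun i j => i != j.
Definition pathg (k : nat) : rel 'I_k :=
  fun i j => (i.+1 == j :> nat) || (j.+1 == i :> nat).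
Arguments complete k _ _ : clear implicits.
Arguments pathg k _ _ : clear implicits.

Definition disjoint_union (U V : finType) (g : rel U) (h : rel V) :
    rel (U + V)%type :=
  fun a b => match a, b with
             | inl i, inl j => g i j
             | inr i, inr j => h i j
             | _, _ => false
             end.

Section Polarity.
Variables (T : finType) (e : rel T).
Implicit Types (A B S : {set T}).

Definition polar_partition A B : bool :=
  [&& A :|: B == [set: T], [disjoint A & B], is_clique e A
    & [forall C in components e B,
         induces e C (complete 1) || induces e C (complete 2)]].

Definition polar : Prop := exists A B, polar_partition A B.

Definition P3_or_K3 S : bool :=
  induces e S (pathg 3) || induces e S (complete 3).

Definition obstruction S : bool :=
  [|| induces e S (disjoint_union (pathg 3) (pathg 3)),
      induces e S (disjoint_union (pathg 3) (complete 3))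
    | induces e S (disjoint_union (complete 3) (complete 3))].

End Polarity.

(* Nondeterministic programs over the vertices of a graph: "let v be a vertex
   (let S be a set of vertices) such that ..." may pick any witness. *)

Section Nondeterminism.
Variable T : finType.

Inductive outcome := Accept of {set T} & {set T} | Reject of {set T}.

Inductive algo :=
| Return of outcome
| ChooseV of pred T & (T -> algo)
| ChooseS of pred {set T} & ({set T} -> algo).

(* [runs p h o]: some execution of [p] returns [o], the successive picks being
   those listed in [h] (a vertex [v] is recorded as [set v]). *)
Inductive runs : algo -> seq {set T} -> outcome -> Prop :=
| RunReturn o : runs (Return o) [::] o
| RunV (P : pred T) k v h o :
    P v -> runs (k v) h o -> runs (ChooseV P k) ([set v] :: h) o
| RunS (P : pred {set T}) k S h o :
    P S -> runs (k S) h o -> runs (ChooseS P k) (S :: h) o.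

(* Whatever was picked before, every pick that is reached is possible. *)
Fixpoint never_stuck (p : algo) : Prop :=
  match p with
  | Return _ => True
  | ChooseV P k => (exists v, P v) /\ forall v, P v -> never_stuck (k v)
  | ChooseS P k => (exists S, P S) /\ forall S, P S -> never_stuck (k S)
  end.

Definition accepting (o : outcome) : bool :=
  if o is Accept _ _ then true else false.

Definition outcome_sets (o : outcome) : seq {set T} :=
  match o with Accept A B => [:: A; B] | Reject X => [:: X] end.

End Nondeterminism.

Definition certified (T : finType) (e : rel T) (o : outcome T) : bool :=
  match o with
  | Accept A B => polar_partition e A B
  | Reject X => obstruction e X
  end.

Notation "'LETV' v | P ;; k" := (ChooseV (fun v => P) (fun v => k))
  (at level 200, v name, P at level 200, k at level 200,
   format "'LETV'  v  |  P  ;; '//' k").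
Notation "'LETS' S | P ;; k" := (ChooseS (fun S => P) (fun S => k))
  (at level 200, S name, P at level 200, k at level 200,
   format "'LETS'  S  |  P  ;; '//' k").

Section Recognition.
Variables (T : finType) (e : rel T).

Definition candidate (K : {set T}) (v : T) : bool :=
  (v \notin K) && (K \subset nbh e v).

(* Each round adds a vertex to [K], so with [fuel = #|T|] the loop only stops
   when no candidate is left. *)
Fixpoint grow_clique (fuel : nat) (K : {set T}) (k : {set T} -> algo T) :=
  if fuel is fuel'.+1 then
    if [exists v, candidate K v] then
      LETV v | candidate K v
               && [forall w, candidate K w ==> (deg e w <= deg e v)] ;;
      grow_clique fuel' (v |: K) k
    else k K
  else k K.

Definition touches (x : T) (D : {set T}) : bool := [exists v in D, e x v].

Definition recognition : algo T :=
  (* 1 *)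
  grow_clique #|T| set0 (fun K =>
  let CC := components e (~: K) in
  (* 2 *)
  if [forall D in CC, #|D| <= 2] then Return (Accept K (cover CC)) else
  (* 3 *)
  if [exists Ci in CC, exists Cj in CC,
        [&& Ci != Cj, 3 <= #|Ci| & 3 <= #|Cj|]] then
    LETS Ci | (Ci \in CC) && (3 <= #|Ci|) ;;
    LETS Cj | [&& Cj \in CC, Cj != Ci & 3 <= #|Cj|] ;;
    LETS S | (S \subset Ci) && P3_or_K3 e S ;;
    LETS U | (U \subset Cj) && P3_or_K3 e U ;;
    Return (Reject (S :|: U))
  else
  (* 4 *)
  LETS C | (C \in CC) && (2 < #|C|) ;;
  (* 5 *)
  if [exists u in C, #|nbh e u :&: K|.+1 == #|K|] then
    LETV u | (u \in C) && (#|nbh e u :&: K|.+1 == #|K|) ;;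
    LETV x | (x \in K) && ~~ e u x ;;
    LETS S | (S \subset C) && P3_or_K3 e S ;;
    (* 5a *)
    if 2 <= #|[set D in CC | touches x D]| then
      LETV v | (v \notin K) && e x v ;;
      LETV w | [&& w \notin K, e x w & pblock CC w != pblock CC v] ;;
      Return (Reject (S :|: [set x; v; w]))
    else
    (* 5b *)
    if [exists D in CC, (2 <= #|D|) && touches x D] then
      LETS D | [&& D \in CC, 2 <= #|D| & touches x D] ;;
      LETS R | [&& R \subset D, #|R| == 2 & P3_or_K3 e (x |: R)] ;;
      Return (Reject (S :|: (x |: R)))
    else
    (* 5c *)
    if [exists D in components e (C :\ u), 2 < #|D|] then
      LETS D | (D \in components e (C :\ u)) && (2 < #|D|) ;;
      LETS S' | (S' \subset D) && P3_or_K3 e S' ;;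
      LETV y | [&& y \in K, y != x & [forall s in S', ~~ e y s]] ;;
      LETV w | (w \notin K) && e x w ;;
      Return (Reject (S' :|: [set w; x; y]))
    else
    (* 5d *)
    let K' := u |: (K :\ x) in Return (Accept K' (~: K'))
  else
  (* 6 *)
  if [exists u in C, #|nbh e u :&: K|.+2 == #|K|] then
    LETV u | (u \in C) && (#|nbh e u :&: K|.+2 == #|K|) ;;
    LETV x | (x \in K) && ~~ e u x ;;
    LETV y | [&& y \in K, y != x & ~~ e u y] ;;
    (* 6a *)
    if [exists z, (z \notin K) && (e x z || e y z)] then
      LETV z | (z \notin K) && (e x z || e y z) ;;
      LETS S | (S \subset C) && P3_or_K3 e S ;;
      Return (Reject (S :|: [set x; y; z]))
    else
    (* 6b *)
    if [exists D in components e (C :\ u), 2 < #|D|] then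
      LETS D | (D \in components e (C :\ u)) && (2 < #|D|) ;;
      LETS S | (S \subset D :\ u) && P3_or_K3 e S ;;
      LETV z | [&& z \in K, z != x, z != y & [forall s in S, ~~ e z s]] ;;
      Return (Reject (S :|: [set x; y; z]))
    else
    (* 6c *)
    let K' := u |: (K :\: [set x; y]) in Return (Accept K' (~: K'))
  else
  (* 7 *)
  LETS S | (S \subset C) && P3_or_K3 e S ;;
  LETS U | [&& U \subset K, #|U| == 3
             & [forall t in U, forall v in C, ~~ e t v]] ;;
  Return (Reject (S :|: U))).

End Recognition.

(* A unit-cost random access machine: finitely many numeric variables and
   arrays per program, all initially zero apart from the input.  The only
   arithmetic is successor and predecessor, so stored numbers exceed those of
   the input by at most the elapsed time: no computing power is gained from
   charging unit cost for operations on long numbers. *)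

Inductive exp :=
| Lit of nat
| Var of nat
| Get of nat & exp            (* [Get a i] reads cell [i] of array [a] *)
| Inc of exp
| Dec of exp.

Inductive test :=
| IsEq of exp & exp
| IsLt of exp & exp
| Not of test
| And of test & test.

Inductive stmt :=
| Skip
| Assign of nat & exp
| Put of nat & exp & exp      (* [Put a i v] stores [v] in cell [i] of [a] *)
| Seq of stmt & stmt
| If of test & stmt & stmt
| While of test & stmt.

Record state := State { vars : nat -> nat; arrays : nat -> nat -> nat }.

Definition update (X : Type) (f : nat -> X) (i : nat) (x : X) : nat -> X :=
  fun j => if j == i then x else f j.

Fixpoint eval (s : state) (a : exp) : nat :=
  match a with
  | Lit k => k
  | Var x => vars s x
  | Get b i => arrays s b (eval s i)
  | Inc a1 => (eval s a1).+1
  | Dec a1 => (eval s a1).-1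
  end.

Fixpoint holds (s : state) (b : test) : bool :=
  match b with
  | IsEq a1 a2 => eval s a1 == eval s a2
  | IsLt a1 a2 => eval s a1 < eval s a2
  | Not b1 => ~~ holds s b1
  | And b1 b2 => holds s b1 && holds s b2
  end.

Fixpoint exp_cost (a : exp) : nat :=
  match a with
  | Lit _ | Var _ => 1
  | Get _ a1 | Inc a1 | Dec a1 => (exp_cost a1).+1
  end.

Fixpoint test_cost (b : test) : nat :=
  match b with
  | IsEq a1 a2 | IsLt a1 a2 => (exp_cost a1 + exp_cost a2).+1
  | Not b1 => (test_cost b1).+1
  | And b1 b2 => (test_cost b1 + test_cost b2).+1
  end.

(* [exec p s t s']: from [s], program [p] halts in state [s'] after [t] steps. *)
Inductive exec : stmt -> state -> nat -> state -> Prop :=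
| ExecSkip s : exec Skip s 1 s
| ExecAssign s x a :
    exec (Assign x a) s (exp_cost a).+1
      (State (update (vars s) x (eval s a)) (arrays s))
| ExecPut s b i a :
    exec (Put b i a) s (exp_cost i + exp_cost a).+1
      (State (vars s)
         (update (arrays s) b (update (arrays s b) (eval s i) (eval s a))))
| ExecSeq p q s1 s2 s3 t1 t2 :
    exec p s1 t1 s2 -> exec q s2 t2 s3 -> exec (Seq p q) s1 (t1 + t2) s3
| ExecIf b p q s s' t :
    exec (if holds s b then p else q) s t s' ->
    exec (If b p q) s (test_cost b + t).+1 s'
| ExecWhileStop b p s :
    ~~ holds s b -> exec (While b p) s (test_cost b).+1 s
| ExecWhileStep b p s1 s2 s3 t1 t2 :
    holds s1 b -> exec p s1 t1 s2 -> exec (While b p) s2 t2 s3 ->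
    exec (While b p) s1 (test_cost b + t1 + t2).+1 s3.

(* A list of lists is stored in two arrays: one holds the concatenation of the
   lists, the other the position where each list starts, followed by the total
   length. *)
Definition offsets (L : seq (seq nat)) : seq nat := 0 :: scanl addn 0 (shape L).

Section Representation.
Variables (n : nat) (e : rel 'I_n).

Definition degree_ordered (s : seq 'I_n) : bool :=
  sorted [rel v w | deg e w <= deg e v] s.

Definition vertex_list (vs : seq 'I_n) : Prop :=
  [/\ uniq vs, forall v, v \in vs & degree_ordered vs].

Definition adjacency_lists (adj : 'I_n -> seq 'I_n) : Prop :=
  forall v, [/\ uniq (adj v), adj v =i nbh e v & degree_ordered (adj v)].

(* Variable 0: number of vertices; array 0: vertex list; arrays 1 and 2:
   offsets and contents of the adjacency lists of vertices 0, ..., n - 1. *)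
Definition input_state (vs : seq 'I_n) (adj : 'I_n -> seq 'I_n) : state :=
  let L := [seq [seq val w | w <- adj v] | v <- enum 'I_n] in
  State (update (fun=> 0) 0 n)
    (fun a => match a with
              | 0 => nth 0 [seq val v | v <- vs]
              | 1 => nth 0 (offsets L)
              | 2 => nth 0 (flatten L)
              | _ => fun=> 0
              end).

(* Arrays [a] and [b] hold, as offsets and contents, duplicate-free listings of
   the vertex sets [F]. *)
Definition stores_sets (s : state) (a b : nat) (F : seq {set 'I_n}) : Prop :=
  exists L : seq (seq 'I_n),
    let N := [seq [seq val v | v <- l] | l <- L] in
    [/\ all uniq L, [seq [set v in l] | l <- L] = F,
        forall i, i <= size N -> arrays s a i = nth 0 (offsets N) i
      & forall i, i < size (flatten N) -> arrays s b i = nth 0 (flatten N) i].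

(* Variable 0: verdict; arrays 3 and 4: certificate; variable 1 and arrays 5
   and 6: number of picks made, and the picks. *)
Definition output_state (s : state) (h : seq {set 'I_n}) (o : outcome 'I_n) :
    Prop :=
  [/\ vars s 0 = accepting o, stores_sets s 3 4 (outcome_sets o),
      vars s 1 = size h & stores_sets s 5 6 h].

End Representation.

(* Main.v *)
Require Import Defs.
From mathcomp Require Import all_boot.
From mathcomp Require Import zify.

(* If a connected set [C] of a chordal graph avoids a clique [K], some vertex of
   [C] is adjacent to every vertex of [K] that has a neighbour in [C]: walk from a
   vertex of [C] with the most neighbours in [K] to the first vertex adjacent to a
   missed [x]; for each old neighbour [y], a chordless cycle through [x] and [y]
   is excluded only if the end of the walk is adjacent to [y] as well.  Hence the
   non-neighbours in [K] of a vertex [u] of [C] with the most neighbours in [K]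
   have no neighbour in [C], which separates the two halves of every obstruction
   that the algorithm returns.

   The degree order gives an exchange property of the greedy clique: for nonempty
   [X] included in [K] and [z] outside [K] adjacent to all of [K \ X], some [x] in
   [X] has degree at least that of [z].  With [X] the non-neighbours of [u], this
   yields the vertex [w] of step 5c, and also [y] in 5c and [z] in 6b: otherwise a
   second vertex [d] of [C] is adjacent to [u] and to all of [K \ X], the bound on
   the degrees in [X] leaves [u] and [d] no other neighbour outside [K], and
   [C = {u, d}] has only two vertices.

   For the running time, a vertex is a candidate for [K] iff its count of
   neighbours in [K] equals [#|K|], so one scan by non-increasing degree with
   updates of the counts builds [K].  Large components are recognized by a vertex
   with two neighbours in them; thereafter a bounded number of passes over the
   adjacency lists, each a count of neighbours satisfying a test or a
   breadth-first search, decides every branch and finds every pick. *)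

Set Implicit Arguments.
Unset Strict Implicit.
Unset Printing Implicit Defensive.

(** The algorithm leaves its picks open, while a machine computes one definite result, so the
    running-time half has to show that the machine's result, together with the sets it records, is
    one of the possible runs. The predicate [reach] marks the point of the algorithm at which the
    program has arrived: each branch of the program is matched with a branch of the algorithm, and
    each recorded set is shown to be an admissible pick there. The two halves of the theorem meet in
    the predicate [always]. It yields correctness, and it also tells the program that an admissible
    pick exists at the current point, so several searches are known to succeed without repeating the
    graph theory.

    Machine details are confined to a compiler: the program is written in a small language whose
    instructions are whole passes over the graph, and only these passes are verified against the
    machine. A triple inducing a path or a triangle always appears as a vertex with two of its
    neighbours, which is why a pass that records two neighbours per vertex is enough to produce
    every certificate. *)

Ltac nat_lia :=
  repeat match goal with
  | H : ?P |- _ =>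
    lazymatch P with
    | is_true (leq _ _) => fail
    | is_true (~~ leq _ _) => fail
    | is_true (~~ (_ && _)) => fail
    | is_true (~~ @eq_op ?U _ _) =>
        tryif unify (Equality.sort U) nat then fail else clear H
    | @eq ?U _ _ => tryif unify U nat then fail else clear H
    | _ => clear H
    end
  end; lia.

(** * Components, chordality and obstructions *)

Section Graph.
Variables (T : finType) (e : rel T).
Hypotheses (sym : symmetric e) (irr : irreflexive e).
Implicit Types (A B C D K S U X : {set T}) (u v w x y z p q : T).

Lemma edge_neq v w : e v w -> v != w.
Proof. by apply: contraTneq => ->; rewrite irr. Qed.

Definition induced_rel B : rel T := [rel x y | [&& x \in B, y \in B & e x y]].

Definition connected_set B :=
  forall x y, x \in B -> y \in B -> connect (induced_rel B) x y.

(** Induction along a path inside [C]. This is the tool for bounding a component: guess a small set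
    that no edge of [C] leaves. *)
Lemma connected_closed C A x :
  connected_set C -> x \in C -> x \in A ->
  (forall y z, y \in A -> y \in C -> z \in C -> e y z -> z \in A) ->
  C \subset A.
Proof.
move=> conC xC xA cl; apply/subsetP => y yC.
have /connectP[s] := conC x y xC yC.
elim: s x xC xA => [|z s IH] x xC xA /=; first by move=> _ ->.
case/andP=> /and3P[_ zC xz]; exact: (IH z zC (cl x z xA xC zC xz)).
Qed.

Section Components.
Variable B : {set T}.
Let CC := components e B.

Lemma induced_equivalence :
  {in B & &, equivalence_rel (connect (induced_rel B))}.
Proof.
have cs : connect_sym (induced_rel B).
  by apply: sym_connect_sym => x y; rewrite /induced_rel /= sym andbCA.
by move=> x y z _ _ _; split=> // xy; apply: same_connect.
Qed.

Lemma partition_components : partition CC B.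
Proof. exact: equivalence_partitionP induced_equivalence. Qed.

Lemma cover_components : cover CC = B.
Proof. exact: cover_partition partition_components. Qed.

Lemma trivIset_components : trivIset CC.
Proof. by case/and3P: partition_components. Qed.

Lemma mem_component x y : x \in B -> y \in B ->
  (y \in pblock CC x) = connect (induced_rel B) x y.
Proof. exact: (pblock_equivalence_partition induced_equivalence). Qed.

Lemma pblock_component x : x \in B -> (pblock CC x \in CC) * (x \in pblock CC x).
Proof.
by move=> xB; rewrite mem_component // connect0 pblock_mem ?cover_components.
Qed.

Lemma component_pblock D x : D \in CC -> x \in D -> pblock CC x = D.
Proof. exact: def_pblock trivIset_components. Qed.

Lemma component_sub D : D \in CC -> D \subset B.
Proof. by move=> DC; rewrite -cover_components; apply: bigcup_sup. Qed.

Lemma component_nonempty D : D \in CC -> exists x, x \in D.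
Proof.
case/and3P: partition_components => _ _ n0 DC; apply/set0Pn.
by apply: contra n0 => /eqP <-.
Qed.

Lemma component_edge D x y : D \in CC -> x \in D -> y \in B -> e x y -> y \in D.
Proof.
move=> DC xD yB xy; have xB := subsetP (component_sub DC) _ xD.
rewrite -(component_pblock DC xD) mem_component //.
by apply: connect1; apply/and3P.
Qed.

Lemma component_connected D : D \in CC -> connected_set D.
Proof.
move=> DC x y xD yD; have sDB := subsetP (component_sub DC).
have: connect (induced_rel B) x y.
  by rewrite -mem_component ?sDB // (component_pblock DC xD).
case/connectP=> s pa ->; apply/connectP; exists s => //.
elim: s x xD pa {y yD} => //= z s IH x xD /andP[/and3P[_ zB xz] pa].
have zD := component_edge DC xD zB xz.
by apply/andP; split; [apply/and3P | exact: IH].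
Qed.

Lemma components_nonadjacent D D' x y :
  D \in CC -> D' \in CC -> D' != D -> x \in D -> y \in D' ->
  (x != y) && ~~ e x y.
Proof.
move=> DC DC' /eqP neq xD yD'; have yB := subsetP (component_sub DC') _ yD'.
have yD : y \notin D.
  apply/negP => yD; apply: neq.
  by rewrite -(component_pblock DC yD) (component_pblock DC' yD').
apply/andP; split; first by apply: contraNneq yD => <-.
by apply: contra yD => xy; apply: component_edge xy.
Qed.

End Components.

(* A set of three vertices inducing a connected graph is a vertex with two
   distinct neighbours. *)
Definition cherry v p q := [&& p != q, e v p & e v q].

(** If no vertex had two neighbours in [C], then a vertex [x] with its at most one neighbour would
    be closed under the edges of [C], leaving room for two vertices only. *)
Lemma connected_cherry C :
  connected_set C -> 2 < #|C| ->
  exists v p q, [/\ v \in C, p \in C, q \in C & cherry v p q].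
Proof.
move=> conC C3.
have [/existsP[v /existsP[p /existsP[q /and4P[]]]]|nc] := boolP
  [exists v, exists p, exists q,
    [&& v \in C, p \in C, q \in C & cherry v p q]].
  by move=> *; exists v, p, q.
have uniq_nbr v p q :
    v \in C -> p \in C -> q \in C -> e v p -> e v q -> p = q.
  move=> vC pC qC vp vq; apply/eqP/negPn/negP => pq; case/negP: nc.
  by apply/existsP; exists v; apply/existsP; exists p; apply/existsP; exists q;
    rewrite vC pC qC /cherry pq vp vq.
have /card_gt0P[x xC] : 0 < #|C| by nat_lia.
have: C \subset x |: (nbh e x :&: C).
  apply: (connected_closed conC xC); first exact: setU11.
  move=> y z; rewrite !inE => /orP[/eqP->|/andP[xy yC]] _ zC yz.
    by rewrite yz zC orbT.
  by rewrite (uniq_nbr y z x) ?eqxx // sym.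
move/subset_leq_card; rewrite cardsU1 !inE irr /= => le.
have: #|nbh e x :&: C| <= 1.
  apply/card_le1P => p; rewrite !inE => /andP[xp pC] q; rewrite !inE.
  apply/andP/eqP => [[xq qC]|->]; last by rewrite xp pC.
  exact: (uniq_nbr x).
by nat_lia.
Qed.

Lemma cherry_connected_card C v p q :
  v \in C -> p \in C -> q \in C -> cherry v p q -> 2 < #|C|.
Proof.
move=> vC pC qC /and3P[pq vp vq].
apply: leq_trans (subset_leq_card (_ : [set v; p; q] \subset C)).
  by rewrite -setUA cardsU1 !inE cards2 pq !(negPf (edge_neq _)).
by apply/subsetP => z; rewrite !inE => /orP[/orP[]|] /eqP->.
Qed.


(** * Chordless paths and the vertex of a component that dominates the clique *)

Section Chordal.
Hypothesis chord : chordal e.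

Lemma last_take y i (s : seq T) :
  i <= size s -> last y (take i s) = nth y (y :: s) i.
Proof.
by case: i => [|i] lt; rewrite ?take0 // (take_nth y) // last_rcons.
Qed.

Lemma next_nth_index y s i : uniq (y :: s) -> i <= size s ->
  next (y :: s) (nth y (y :: s) i) = nth y s i.
Proof. by move=> us le; rewrite next_nth mem_nth ?index_uniq. Qed.

(* A chord of the cycle [y :: s] shortcuts the path from [y] to [x]. *)
Lemma chordal_path x y s : e x y -> path e y s -> uniq (y :: s) ->
  last y s = x -> 1 < size s -> exists2 z, z \in s & e x z && e y z.
Proof.
move=> xy; elim: {s}(size s).+1 {-2}s (ltnSn (size s)) => // m IH s.
(* On a path with two edges the middle vertex is the common neighbour. *)
rewrite ltnS => sm pa us la s2; have [s3|s3] := ltnP 2 (size s); last first.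
  case: s s2 s3 {us sm} pa la => [|p [|q []]] //= _ _ /and3P[yp px _] eq.
  by exists p; rewrite ?mem_head // sym -eq px.
have uc : ucycle e (y :: s).
  by rewrite /ucycle us andbT /= rcons_path pa la.
have [a [b [aC bC ab nb na]]] := chord uc s3.
wlog: a b aC bC ab nb na / index a (y :: s) <= index b (y :: s).
  move=> W; have [|/ltnW] := leqP (index a (y :: s)) (index b (y :: s)).
    exact: W.
  by apply: W => //; rewrite sym.
set i := index a _; set j := index b _ => le_ij.
have ai : nth y (y :: s) i = a by rewrite nth_index.
have bj : nth y (y :: s) j = b by rewrite nth_index.
have js : j <= size s by move: bC; rewrite -index_mem.
clearbody i j.
have is_ : i <= size s by apply: leq_trans js.
have ltij : i < j.
  rewrite ltn_neqAle le_ij andbT; apply/negP => /eqP ij.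
  by move: ab; rewrite -ai -bj ij irr.
have ij1 : j != i.+1.
  apply: contraNneq nb => eq; rewrite -{1}bj -{1}ai next_nth_index //.
  by rewrite eq.
have ends : ~~ ((i == 0) && (j == size s)).
  apply/negP => /andP[/eqP i0 /eqP jl]; case/negP: na.
  by rewrite -{1}ai i0 -bj next_nth_index // jl [nth y s _]nth_default.
have j1s : j.-1 < size s by nat_lia.
have dj : drop j.-1 s = b :: drop j s.
  rewrite (drop_nth y) // prednK; last by nat_lia.
  by rewrite -bj; clear -ltij; case: j ltij.
(* The shortcut omits the positions strictly between [i] and [j] of [y :: s]; position [j] there is
   position [j.-1] of [s]. It is shorter because the chord does not join consecutive vertices, and
   it still has two edges because the chord is not the closing edge between [y] and [x]. *)
have sub : subseq (take i s ++ drop j.-1 s) s.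
  rewrite -{3}(cat_take_drop i s) cat_subseq //.
  have -> : j.-1 = (j.-1 - i) + i by nat_lia.
  by rewrite -drop_drop drop_subseq.
have [|||||z zs ez] := IH (take i s ++ drop j.-1 s).
- rewrite size_cat size_takel // size_drop; nat_lia.
- rewrite cat_path take_path //= dj /= last_take // ai ab.
  by move: pa; rewrite -{1}(cat_take_drop j s) cat_path last_take // bj => /andP[].
- by apply: subseq_uniq us; rewrite /= eqxx.
- by rewrite last_cat -la -{3}(cat_take_drop j.-1 s) last_cat dj.
- rewrite size_cat size_takel // size_drop; nat_lia.
by exists z; rewrite ?(mem_subseq sub).
Qed.

Lemma dominating_vertex C K :
  connected_set C -> C != set0 -> is_clique e K -> [disjoint C & K] ->
  exists2 c, c \in C & forall x d, x \in K -> d \in C -> e x d -> e c x.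
Proof.
move=> conC /set0Pn[c0 c0C] /forall_inP clK dis.
case: (arg_maxnP (fun c => #|nbh e c :&: K|) c0C) => c cC cmax.
exists c => // x d xK dC xd; apply/negPn/negP => ncx.
have CK z : z \in C -> z \notin K by move=> zC; rewrite (disjointFr dis zC).
have /connectP[s0 pa0 la0] := conC c d cC dC.
case/shortenP: pa0 la0 => s pa us _ {s0} la.
have hs : has (e x) s.
  case: s la {pa us} => [/= dc|z s la]; first by rewrite sym -dc xd in ncx.
  by apply/hasP; exists d => //; rewrite la /= mem_last.
case/split_find: hs pa us {la} => w s1 s2 xw nx pa us.
have {}us : uniq (c :: rcons s1 w) by move: us; rewrite -cat_cons cat_uniq => /andP[].
have {}pa : path (induced_rel C) c (rcons s1 w) by move: pa;
  rewrite cat_path => /andP[].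
have sC : {subset c :: rcons s1 w <= C}.
  elim: (rcons s1 w) c cC pa {cmax ncx us} => [|z t IH] c cC /=.
    by move=> _ z; rewrite inE => /eqP->.
  case/andP=> /and3P[_ zC _] /(IH z zC) tC y.
  by rewrite inE => /orP[/eqP->|/tC].
have {}pa : path e c (rcons s1 w) by apply: sub_path pa => a b /and3P[].
have wC : w \in C by apply: sC; rewrite inE mem_rcons mem_head orbT.
(* If [w] sees [x] and every old neighbour of [c] in [K], it beats the maximum attained by [c]. *)
have: #|x |: (nbh e c :&: K)| <= #|nbh e w :&: K|.
  apply/subset_leq_card/subsetP => y; rewrite !inE.
  case/predU1P => [->|/andP[cy yK]]; first by rewrite sym xw.
  rewrite yK andbT; have yx : y != x by apply: contraNneq ncx => <-.
  have /forall_inP/(_ y yK) := clK x xK; rewrite eq_sym yx /= => xy.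
  have xs : x \notin c :: rcons s1 w by apply: contraL xK => /sC/CK.
  have ys : y \notin c :: rcons s1 w by apply: contraL yK => /sC/CK.
  (* The path runs from [y] through [c], [s1] and [w] to [x]. A common neighbour of [x] and [y] on
     it can be neither [x], nor [c], which misses [x], nor in [s1], since [w] is the first neighbour
     of [x]; so it is [w]. *)
  have [||||z] := @chordal_path x y (rcons (c :: rcons s1 w) x) xy.
  - by rewrite rcons_path /= pa sym cy last_rcons sym xw.
  - by rewrite cons_uniq mem_rcons inE negb_or yx ys rcons_uniq xs us.
  - by rewrite last_rcons.
  - by rewrite size_rcons.
  rewrite mem_rcons !inE mem_rcons inE => /or4P[] => [/eqP->|/eqP->|/eqP->|zs].
  - by rewrite irr.
  - by rewrite sym (negPf ncx).
  - by rewrite (sym w) => /andP[].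
  by case/andP=> xz; case/hasP: nx; exists z.
by rewrite cardsU1 !inE (negPf ncx) ltnNge => /negP[]; apply: cmax.
Qed.

End Chordal.

(** * Connected triples, obstructions and polar partitions *)

Lemma P3_or_K3_cherry v p q : cherry v p q -> P3_or_K3 e [set v; p; q].
Proof.
case/and3P=> pq vp vq; pose f := [ffun i : 'I_3 => nth v [:: p; v; q] i].
have injf : injectiveb f.
  apply/injectiveP => -[[|[|[|//]]] ?] [[|[|[|//]]] ?]; rewrite !ffunE /= => E;
    apply: val_inj => //=; exfalso; move: E;
    by apply/eqP; rewrite ?pq // 1?eq_sym ?pq ?edge_neq // sym.
have imf : [set f i | i : 'I_3] == [set v; p; q].
  apply/eqP/setP => z; rewrite !inE; apply/imsetP/idP => [[i _ ->]|].
    by case: i => [[|[|[|//]]] ?]; rewrite ffunE /= eqxx ?orbT.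
  by case/orP=> [/orP[]|] /eqP->; [exists (inord 1) | exists (inord 0)
    | exists (inord 2)]; rewrite // ffunE inordK.
apply/orP; case pq_e: (e p q); [right|left]; apply/existsP; exists f;
  rewrite injf imf; apply/forallP => -[[|[|[|//]]] ?];
    apply/forallP => -[[|[|[|//]]] ?];
  by rewrite !ffunE /= ?irr ?vp ?vq ?pq_e // sym ?vp ?vq ?pq_e.
Qed.

(** Index 1 is the centre of [pathg 3], and in a triangle every vertex can serve as centre, so the
    same index works in both cases. *)
Lemma P3_or_K3_center S : P3_or_K3 e S ->
  exists v p q, S = [set v; p; q] /\ cherry v p q.
Proof.
have im (f : {ffun 'I_3 -> T}) : [set f i | i : 'I_3] =
    [set f (inord 1); f (inord 0); f (inord 2)].
  apply/setP => z; rewrite !inE; apply/imsetP/idP => [[i _ ->]|].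
    by case: i => [[|[|[|//]]] lt]; rewrite -[Ordinal lt]inord_val eqxx ?orbT.
  by case/orP=> [/orP[]|] /eqP->; eexists.
by case/orP=> /existsP[f /and3P[/injectiveP injf /eqP <- /forallP ef]];
  exists (f (inord 1)), (f (inord 0)), (f (inord 2)); (split; first exact: im);
  rewrite /cherry; do 2!rewrite (eqP (forallP (ef _) _));
  rewrite (inj_eq injf) /pathg /complete -?val_eqE /= !inordK.
Qed.

Lemma induces_disjoint_union (V W : finType) (g : rel V) (h : rel W) S U :
  induces e S g -> induces e U h ->
  (forall s t, s \in S -> t \in U -> (s != t) && ~~ e s t) ->
  induces e (S :|: U) (disjoint_union g h).
Proof.
case/existsP=> f1 /and3P[/injectiveP i1 /eqP <- /forallP e1].
case/existsP=> f2 /and3P[/injectiveP i2 /eqP <- /forallP e2] sep.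
have {}sep a b : (f1 a != f2 b) && ~~ e (f1 a) (f2 b).
  by apply: sep; apply: imset_f.
apply/existsP; exists [ffun c => match c with inl a => f1 a | inr b => f2 b end].
apply/and3P; split.
- apply/injectiveP => -[a|b] [c|d]; rewrite !ffunE => E.
  + by rewrite (i1 _ _ E).
  + by have := sep a d; rewrite E eqxx.
  + by have := sep c b; rewrite E eqxx.
  + by rewrite (i2 _ _ E).
- apply/eqP/setP => z; rewrite inE; apply/imsetP/orP => [[[a|b] _ ->]|].
  + by rewrite ffunE; left; apply: imset_f.
  + by rewrite ffunE; right; apply: imset_f.
  by case=> /imsetP[a _ ->]; [exists (inl a) | exists (inr a)]; rewrite // ffunE.
apply/forallP => -[a|b]; apply/forallP => -[c|d]; rewrite !ffunE /=.
- exact: (forallP (e1 a)).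
- by have /andP[_ /negPf->] := sep a d.
- by have /andP[_] := sep c b; rewrite sym => /negPf->.
- exact: (forallP (e2 b)).
Qed.

(** Of the four combinations, a triangle followed by a path is reduced to the listed order by
    exchanging the two halves. *)
Lemma obstruction_separated S U : P3_or_K3 e S -> P3_or_K3 e U ->
  (forall s t, s \in S -> t \in U -> (s != t) && ~~ e s t) ->
  obstruction e (S :|: U).
Proof.
move=> iS iU sep; have sep' t s : t \in U -> s \in S -> (t != s) && ~~ e t s.
  by move=> tU sS; rewrite eq_sym sym; apply: sep.
rewrite /obstruction; case/orP: iS => iS; case/orP: iU => iU.
- by rewrite induces_disjoint_union.
- by rewrite (induces_disjoint_union iS iU) // orbT.
- by rewrite setUC (induces_disjoint_union iU iS) // orbT.
- by rewrite (induces_disjoint_union iS iU) // !orbT.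
Qed.

Lemma disjoint_union_separated (V W : finType) (g : rel V) (h : rel W) X :
  induces e X (disjoint_union g h) ->
  exists S U, [/\ induces e S g, induces e U h
    & forall s t, s \in S -> t \in U -> (s != t) && ~~ e s t].
Proof.
case/existsP=> f /and3P[/injectiveP injf _ /forallP ef].
exists [set f (inl a) | a : V], [set f (inr b) | b : W]; split.
- apply/existsP; exists [ffun a => f (inl a)]; apply/and3P; split.
  + by apply/injectiveP => a c; rewrite !ffunE => /injf [].
  + by apply/eqP/eq_imset => a; rewrite ffunE.
  + apply/forallP => a; apply/forallP => c; rewrite !ffunE.
    exact: (forallP (ef (inl a)) (inl c)).
- apply/existsP; exists [ffun b => f (inr b)]; apply/and3P; split.
  + by apply/injectiveP => b d; rewrite !ffunE => /injf [].
  + by apply/eqP/eq_imset => b; rewrite ffunE.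
  + apply/forallP => b; apply/forallP => d; rewrite !ffunE.
    exact: (forallP (ef (inr b)) (inr d)).
move=> s t /imsetP[a _ ->] /imsetP[b _ ->].
have /eqP -> := forallP (ef (inl a)) (inr b).
by rewrite (inj_eq injf).
Qed.

Lemma induces_card (V : finType) (h : rel V) S : induces e S h -> #|S| = #|V|.
Proof.
case/existsP=> f /and3P[/injectiveP injf /eqP <- _].
exact: card_imset.
Qed.

(** A local form of the condition that every component has at most two vertices. It mentions no
    component, so it can be checked vertex by vertex and needs no recomputation of components when
    [B] changes. *)
Definition small B := forall v p q,
  v \in B -> p \in B -> q \in B -> e v p -> e v q -> p = q.

Lemma smallP B :
  small B <-> forall D, D \in components e B -> #|D| <= 2.
Proof.
split=> [sB D DC|cB v p q vB pB qB vp vq].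
  rewrite leqNgt; apply/negP.
  case/(connected_cherry (component_connected DC))=> v [p [q [vD pD qD]]].
  have sD := subsetP (component_sub DC).
  by case/and3P=> pq vp vq; rewrite (sB v p q) ?eqxx ?sD // in pq.
apply/eqP/negPn/negP => pq; have [DC vD] := pblock_component vB.
have := cB _ DC; rewrite leqNgt => /negP; apply.
by apply: (@cherry_connected_card _ v p q) => //;
  [exact: component_edge DC vD pB vp | exact: component_edge DC vD qB vq | exact/and3P].
Qed.

Lemma small_polar_partition A :
  is_clique e A -> small (~: A) -> polar_partition e A (~: A).
Proof.
move=> clA /smallP smA; rewrite /polar_partition setUCr eqxx clA.
rewrite disjoints_subset setCK subxx; apply/forall_inP => D DC.
have [x xD] := component_nonempty DC; have conD := component_connected DC.
have [/eqP/cards1P[y eqD]|D2] := eqVneq #|D| 1.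
  apply/orP; left; apply/existsP; exists [ffun=> y]; apply/and3P; split.
  - by apply/injectiveP => i j _; rewrite !ord1.
  - apply/eqP/setP => z; rewrite eqD inE; apply/imsetP/eqP => [[i _ ->]|->].
      by rewrite ffunE.
    by exists ord0; rewrite ?ffunE.
  - by apply/forallP => i; apply/forallP => j; rewrite !ffunE irr !ord1.
have /cards2P[a [b [ab eqD]]] : #|D| == 2.
  by rewrite eqn_leq smA // ltn_neqAle eq_sym D2; apply/card_gt0P; exists x.
have eab : e a b.
  apply/negPn/negP => nab; have: D \subset [set a].
    apply: (connected_closed conD (x := a)); rewrite ?eqD ?inE ?eqxx // => y z.
    by rewrite !inE => /eqP-> _ /orP[]/eqP-> //; rewrite (negPf nab).
  by move/subset_leq_card; rewrite eqD cards1 cards2 ab.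
apply/orP; right; apply/existsP; exists [ffun i : 'I_2 => nth a [:: a; b] i].
apply/and3P; split.
- apply/injectiveP => -[[|[|//]] ?] [[|[|//]] ?]; rewrite !ffunE /= => E;
    apply: val_inj => //=; by rewrite E eqxx in ab.
- apply/eqP/setP => z; rewrite eqD !inE; apply/imsetP/idP => [[i _ ->]|].
    by case: i => [[|[|//]] ?]; rewrite ffunE /= eqxx ?orbT.
  by case/orP=> /eqP->; [exists ord0 | exists ord_max]; rewrite // ffunE.
- by apply/forallP => -[[|[|//]] ?]; apply/forallP => -[[|[|//]] ?];
    rewrite !ffunE /= ?irr // ?eab // sym eab.
Qed.

Lemma polar_partition_small A B : polar_partition e A B -> small B.
Proof.
case/and4P=> _ _ _ /forall_inP cB; apply/smallP => D /cB.
by case/orP=> /induces_card ->; rewrite card_ord.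
Qed.

(** Each half contains a vertex with two neighbours, which cannot all lie in [B], so each half meets
    the clique [A]. Two vertices of [A] in different halves would be distinct and non-adjacent. *)
Lemma obstruction_not_polar X : obstruction e X -> ~ polar e.
Proof.
move=> obs [A [B pAB]]; have smB := polar_partition_small pAB.
have [S [U [iS iU sep]]] : exists S U, [/\ P3_or_K3 e S, P3_or_K3 e U
    & forall s t, s \in S -> t \in U -> (s != t) && ~~ e s t].
  by case/or3P: obs => /disjoint_union_separated[S [U [iS iU sep]]];
    exists S, U; rewrite /P3_or_K3 iS iU ?orbT.
case/and4P: pAB => /eqP AB _ /forall_inP clA _.
have touch S' : P3_or_K3 e S' -> exists2 s, s \in S' & s \in A.
  case/P3_or_K3_center=> v [p [q [-> /and3P[pq vp vq]]]].
  have inB z : z \notin A -> z \in B.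
    by move/negPf=> zA; have := in_setT z; rewrite -AB inE zA.
  have [vA|/inB vB] := boolP (v \in A); first by exists v; rewrite ?inE ?eqxx.
  have [pA|/inB pB] := boolP (p \in A).
    by exists p; rewrite ?inE ?eqxx ?orbT.
  have [qA|/inB qB] := boolP (q \in A).
    by exists q; rewrite ?inE ?eqxx ?orbT.
  by rewrite (smB v p q) ?eqxx in pq.
have [s sS sA] := touch S iS; have [t tU tA] := touch U iU.
have /andP[st /negP[]] := sep s t sS tU.
exact: implyP (forall_inP (clA s sA) t tA) st.
Qed.

(** * The exchange property of the greedy clique and weakest preconditions of the algorithm *)

Definition greedy K := forall X z, X \subset K -> X != set0 -> z \notin K ->
  K :\: X \subset nbh e z -> exists2 x, x \in X & deg e z <= deg e x.

Lemma is_clique0 : is_clique e set0.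
Proof. by apply/forall_inP => x; rewrite inE. Qed.

Lemma is_cliqueU1 K v : is_clique e K -> K \subset nbh e v -> is_clique e (v |: K).
Proof.
move=> /forall_inP clK /subsetP sK; apply/forall_inP => x /setU1P xK.
apply/forall_inP => y /setU1P yK; apply/implyP => xy.
case: xK yK xy => [->|xK] [->|yK]; first by rewrite eqxx.
- by move/sK: yK; rewrite inE.
- by move/sK: xK; rewrite inE sym.
by move=> xy; have /forall_inP/(_ y yK)/implyP := clK x xK; apply.
Qed.

Lemma is_cliqueS K K' : K' \subset K -> is_clique e K -> is_clique e K'.
Proof.
move=> /subsetP sK /forall_inP clK; apply/forall_inP => x /sK xK.
by apply/forall_inP => y /sK yK; apply: (forall_inP (clK x xK)).
Qed.

Lemma greedy0 : greedy set0.
Proof. by move=> X z; rewrite subset0 => ->. Qed.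

(** If [X] meets the old clique, its old part already contains the required vertex. Otherwise [X]
    consists of [v], and [z], adjacent to all of [K], was a candidate when [v] was preferred. The
    property thus records the order of choices without mentioning it. *)
Lemma greedyU1 K v : greedy K -> v \notin K ->
  (forall w, candidate e K w -> deg e w <= deg e v) -> greedy (v |: K).
Proof.
move=> gr vK best X z sX X0 zK sz.
have zK' : z \notin K by apply: contra zK; apply: setU1r.
have sK : K :\: X \subset nbh e z.
  by apply: subset_trans sz; apply/setSD/subsetUr.
have [XK0|XK0] := eqVneq (X :&: K) set0; last first.
  have [|x] := gr (X :&: K) z (subsetIr _ _) XK0 zK'.
    by rewrite setDIr setDv setU0.
  by rewrite inE => /andP[xX _] le; exists x.
have vX : v \in X.
  have [x xX] := set0Pn _ X0; have /setU1P[<- //|xK] := subsetP sX _ xX.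
  by have: x \in X :&: K by [rewrite inE xX]; rewrite XK0 inE.
exists v => //; apply: best; rewrite /candidate zK'.
apply: subset_trans sK; apply/subsetP => x xK; rewrite inE xK andbT.
by apply/negP => xX; have: x \in X :&: K by [rewrite inE xX]; rewrite XK0 inE.
Qed.

(** The weakest precondition under all picks. It combines the absence of stuck states with the
    postcondition, so that one walk through the algorithm proves both. *)
Fixpoint always (p : algo T) (Q : outcome T -> Prop) : Prop :=
  match p with
  | Return o => Q o
  | ChooseV P k => (exists v, P v) /\ forall v, P v -> always (k v) Q
  | ChooseS P k => (exists S, P S) /\ forall S, P S -> always (k S) Q
  end.

Lemma always_never_stuck (prog : algo T) Q : always prog Q -> never_stuck prog.
Proof.
by elim: prog => //= P k IH [ex al]; split=> // v /al; apply: IH.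
Qed.

Lemma always_runs (prog : algo T) Q h o : always prog Q -> runs prog h o -> Q o.
Proof.
by move=> al ru; elim: ru al => //= P k w {}h {}o Pw _ IH [_ /(_ w Pw)/IH].
Qed.

(** The bound on the fuel guarantees that, when it is used up, [K] is the whole vertex set; so the
    loop ends only for want of candidates. *)
Lemma always_grow fuel K k Q : is_clique e K -> greedy K -> #|T| <= #|K| + fuel ->
  (forall K', is_clique e K' -> greedy K' -> (forall v, ~~ candidate e K' v) ->
     always (k K') Q) ->
  always (grow_clique e fuel K k) Q.
Proof.
move=> clK grK fu kQ; elim: fuel K clK grK fu => [|fuel IH] K clK grK fu /=.
  apply: kQ => // v; rewrite /candidate.
  have -> : K = setT by apply/eqP; rewrite eqEcard subsetT cardsT -(addn0 #|K|).
  by rewrite inE.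
case: existsP => [[v0 v0c]|nc]; last first.
  by apply: kQ => // v; apply/negP => vc; apply: nc; exists v.
split=> [|v /andP[vc /forallP best]].
  have [v vc best] := arg_maxnP (deg e) v0c.
  by exists v; rewrite vc; apply/forallP => w; apply/implyP => /best.
case/andP: (vc) => vK sv; apply: IH.
- exact: is_cliqueU1.
- by apply: greedyU1 => // w wc; apply: (implyP (best w)).
- by rewrite cardsU1 vK; nat_lia.
Qed.

Lemma deg_split K v : deg e v = #|nbh e v :&: K| + #|nbh e v :\: K|.
Proof. by rewrite cardsID. Qed.

(** * The greedy maximal clique and the components outside it *)

Section GreedyClique.
Variable K : {set T}.
Hypotheses (clK : is_clique e K) (grK : greedy K).
Hypothesis maxK : forall v, ~~ candidate e K v.
Let CC := components e (~: K).

Lemma notin_clique C v : C \in CC -> v \in C -> v \notin K.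
Proof. by move=> CCC /(subsetP (component_sub CCC)); rewrite inE. Qed.

Lemma nbr_count v : v \notin K -> #|nbh e v :&: K| < #|K|.
Proof.
move=> vK; have := maxK v; rewrite /candidate vK /= => nK.
by apply: proper_card; rewrite properEneq subsetIr andbT; apply: contra nK => /eqP <-;
  apply: subsetIl.
Qed.

Lemma card_nonnbrs u : #|K :\: nbh e u| = #|K| - #|nbh e u :&: K|.
Proof. by rewrite cardsD setIC. Qed.

(** The dominating vertex of [C] has at least the neighbours of [u] in [K], hence by maximality
    exactly these. It is adjacent to [x] as soon as some vertex of [C] is, and then so is [u]. *)
Lemma no_nbr_in_component C u x c : chordal e -> C \in CC -> u \in C ->
  (forall v, v \in C -> #|nbh e v :&: K| <= #|nbh e u :&: K|) ->
  x \in K -> ~~ e u x -> c \in C -> ~~ e x c.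
Proof.
move=> ch CCC uC umax xK nux cC; apply: contra nux => xc.
have CK : [disjoint C & K] by rewrite disjoints_subset component_sub.
have C0 : C != set0 by apply/set0Pn; exists u.
have [d dC dadj] := dominating_vertex ch (component_connected CCC) C0 clK CK.
have sub : nbh e u :&: K \subset nbh e d :&: K.
  apply/subsetP => y; rewrite !inE => /andP[uy yK]; rewrite yK andbT.
  by apply: dadj uC _; rewrite // sym.
have: x \in nbh e d :&: K by rewrite !inE (dadj x c).
have /eqP <- : nbh e u :&: K == nbh e d :&: K by rewrite eqEcard sub umax.
by rewrite !inE => /andP[].
Qed.

Lemma nbr_in_component C u : C \in CC -> 2 < #|C| -> u \in C ->
  exists2 v, v \in C & e u v.
Proof.
move=> CCC C3 uC; have [/exists_inP //|/exists_inPn nv] :=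
  boolP [exists v in C, e u v].
have: C \subset [set u].
  apply: (connected_closed (component_connected CCC) uC); rewrite ?inE // => y z.
  by rewrite !inE => /eqP-> _ /nv/negPf->.
by move/subset_leq_card; rewrite cards1; nat_lia.
Qed.

Lemma card_nbh_clique x : x \in K -> #|nbh e x :&: K| < #|K|.
Proof.
move=> xK; rewrite (cardsD1 x K) xK ltnS; apply/subset_leq_card/subsetP => y.
by rewrite !inE => /andP[xy ->]; rewrite andbT eq_sym edge_neq.
Qed.

Lemma nonnbrs_greedy u z : u \notin K -> z \notin K ->
  nbh e u :&: K \subset nbh e z ->
  exists x, [/\ x \in K, ~~ e u x & deg e z <= deg e x].
Proof.
move=> uK zK sub; have [|||x] := grK (X := K :\: nbh e u) (z := z) _ _ zK.
- exact: subsetDl.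
- by rewrite -card_gt0 card_nonnbrs subn_gt0 nbr_count.
- by rewrite setDDr setDv set0U setIC.
by rewrite !inE => /andP[nux xK]; exists x.
Qed.

(** With [#|K| - 1] neighbours in [K] and one more in [C], the degree of [u] is at least [#|K|]. By
    the exchange property so is that of [x], while at most [#|K| - 1] of its neighbours lie in
    [K]. *)
Lemma outer_nbr C u x : C \in CC -> 2 < #|C| -> u \in C ->
  #|nbh e u :&: K|.+1 = #|K| -> (forall y, y \in K -> ~~ e u y -> y = x) ->
  exists2 w, w \notin K & e x w.
Proof.
move=> CCC C3 uC cu ux; have uK := notin_clique CCC uC.
have [y [yK uy le]] := nonnbrs_greedy uK uK (subsetIl _ _).
have [v vC uv] := nbr_in_component CCC C3 uC.
have: 0 < #|nbh e u :\: K|.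
  by apply/card_gt0P; exists v; rewrite !inE uv (notin_clique CCC).
rewrite -(ux y yK uy); have := card_nbh_clique yK.
move: le; rewrite !(deg_split K) => le lt gt.
have /card_gt0P[w] : 0 < #|nbh e y :\: K| by nat_lia.
by rewrite !inE => /andP[wK yw]; exists w.
Qed.

(** One degree bound serves steps 5c and 6b: a vertex of [K] has at most [#|K| - 1] neighbours in
    [K]; in 5c [u] misses one vertex, which has at most one outer neighbour, and in 6b [u] misses
    two, which have none. *)
Lemma free_vertex C u D S : chordal e -> C \in CC -> 2 < #|C| -> u \in C ->
  (forall x, x \in K -> ~~ e u x -> deg e x <= #|nbh e u :&: K|.+1) ->
  D \in components e (C :\ u) -> S \subset D ->
  exists y, [/\ y \in K, e u y & forall s, s \in S -> ~~ e y s].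
Proof.
move=> ch CCC C3 uC degX DC /subsetP sSD.
have [/exists_inP[y yK /andP[uy /forall_inP yS]]|/exists_inPn ny] := boolP
    [exists y in K, e u y && [forall s in S, ~~ e y s]]; first by exists y.
exfalso; have uK := notin_clique CCC uC.
have sDC : D \subset C by apply: subset_trans (component_sub DC) (subsetDl _ _).
have uD : u \notin D.
  by apply/negP => /(subsetP (component_sub DC)); rewrite !inE eqxx.
have [d0 d0D] := component_nonempty DC.
have conD := component_connected DC.
have [d' d'D ud'] : exists2 d', d' \in D & e u d'.
  have [/exists_inP //|/exists_inPn nv] := boolP [exists v in D, e u v].
  case/negP: uD; apply: subsetP uC.
  apply: (connected_closed (component_connected CCC) (subsetP sDC _ d0D) d0D).
  move=> y z yD _ zC yz; apply: (component_edge DC yD) => //.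
  rewrite !inE zC andbT; apply: contraTneq yz => ->.
  by rewrite sym nv.
(* The clique to be dominated from within [D]. Each of its vertices has a neighbour in [D]: [u]
   because [C] is connected, the others because none of them qualifies as the required [y]. *)
have clK' : is_clique e (u |: (nbh e u :&: K)).
  by apply: is_cliqueU1 (subsetIl _ _); apply: is_cliqueS clK; apply: subsetIr.
have dis : [disjoint D & u |: (nbh e u :&: K)].
  rewrite disjoints_subset; apply/subsetP => y yD.
  rewrite !inE negb_or negb_and (notin_clique CCC (subsetP sDC _ yD)) orbT.
  by rewrite andbT; apply: contraNneq uD => <-.
have D0 : D != set0 by apply/set0Pn; exists d0.
have [d dD dadj] := dominating_vertex ch conD D0 clK' dis.
have du : e d u by apply: dadj d'D ud'; apply: setU11.
have dC := subsetP sDC _ dD; have dK := notin_clique CCC dC.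
have sd : nbh e u :&: K \subset nbh e d.
  apply/subsetP => y; rewrite !inE => /andP[uy yK].
  have := ny y yK; rewrite uy /= negb_forall => /existsP[s].
  rewrite negb_imply negbK => /andP[/sSD sD ys].
  by apply: dadj sD ys; rewrite !inE uy yK orbT.
(* By the exchange property and the degree bound such a [z] has degree at most
   [#|nbh e u :&: K|.+1], and all but one of these neighbours are already spent in [K]. This is
   applied to [u] and to [d]. *)
have lone z : z \notin K -> nbh e u :&: K \subset nbh e z ->
    #|nbh e z :\: K| <= 1.
  move=> zK sz; have [x [xK ux le]] := nonnbrs_greedy uK zK sz.
  have := leq_trans le (degX x xK ux); rewrite (deg_split K).
  have: #|nbh e u :&: K| <= #|nbh e z :&: K|.
    by rewrite subset_leq_card // subsetI sz subsetIr.
  nat_lia.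
have nu y : y \in C -> e u y -> y = d.
  move=> yC uy; apply: (card_le1_eqP (lone u uK (subsetIl _ _))).
    by rewrite !inE sym du dK.
  by rewrite !inE uy (notin_clique CCC).
have nd y : y \in C -> e d y -> y = u.
  move=> yC dy; apply: (card_le1_eqP (lone d dK sd)).
    by rewrite !inE du uK.
  by rewrite !inE dy (notin_clique CCC).
have: C \subset [set u; d].
  apply: (connected_closed (component_connected CCC) uC); rewrite ?inE ?eqxx //.
  move=> y z; rewrite !inE => /orP[]/eqP-> _ zC.
    by move/(nu _ zC)->; rewrite eqxx orbT.
  by move/(nd _ zC)->; rewrite eqxx.
move/subset_leq_card; rewrite cards2; case: eqP; nat_lia.
Qed.

(** A vertex outside [K] with two neighbours outside [K] lies in a large component, hence in [C];
    there the small components of [C :\ u] exclude it. *)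
Lemma small_rest C u : C \in CC ->
  (forall D, D \in CC -> 2 < #|D| -> D = C) ->
  (forall D, D \in components e (C :\ u) -> #|D| <= 2) -> small (~: K :\ u).
Proof.
move=> CCC uniqC /smallP smC v p q; rewrite !inE.
move=> /andP[vu vK] /andP[pu pK] /andP[qu qK] vp vq.
apply/eqP/negPn/negP => pq.
have vB : v \in ~: K by rewrite inE.
have [DC vD] := pblock_component vB.
have pD : p \in pblock CC v by apply: component_edge DC vD _ vp; rewrite inE.
have qD : q \in pblock CC v by apply: component_edge DC vD _ vq; rewrite inE.
have eqC : pblock CC v = C.
  apply: uniqC => //; apply: (@cherry_connected_card _ v p q) => //.
  exact/and3P.
rewrite eqC in vD pD qD.
by rewrite (smC v p q) ?eqxx ?inE ?vu ?pu ?qu in pq.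
Qed.

End GreedyClique.

Lemma pick_P3_or_K3 B D : D \in components e B -> 2 < #|D| ->
  exists S, (S \subset D) && P3_or_K3 e S.
Proof.
move=> DC /(connected_cherry (component_connected DC))[v [p [q [vD pD qD vpq]]]].
exists [set v; p; q]; rewrite P3_or_K3_cherry // andbT.
by apply/subsetP => z; rewrite !inE => /orP[/orP[]|] /eqP->.
Qed.

Lemma P3_or_K3_nbr x y D :
  connected_set D -> x \notin D -> y \in D -> e x y -> 2 <= #|D| ->
  exists2 z, z \in D & cherry y x z.
Proof.
move=> conD xD yD xy D2.
have [/exists_inP[z zD yz]|/exists_inPn nz] := boolP [exists z in D, e y z].
  exists z => //; rewrite /cherry yz sym xy !andbT.
  by apply: contraNneq xD => ->.
have: D \subset [set y].
  apply: (connected_closed conD yD); rewrite ?inE // => a b.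
  by rewrite !inE => /eqP-> _ /nz/negPf->.
by move/subset_leq_card; rewrite cards1; nat_lia.
Qed.

Lemma nonnbrs1 K u x : #|nbh e u :&: K|.+1 = #|K| -> x \in K -> ~~ e u x ->
  forall y, y \in K -> ~~ e u y -> y = x.
Proof.
move=> cu xK ux y yK uy; apply: (@card_le1_eqP _ (K :\: nbh e u)).
- by rewrite card_nonnbrs; nat_lia.
- by rewrite !inE ux.
- by rewrite !inE uy.
Qed.

Lemma nonnbrs2 K u x y : #|nbh e u :&: K|.+2 = #|K| -> x \in K -> ~~ e u x ->
  y \in K -> y != x -> ~~ e u y ->
  forall z, z \in K -> ~~ e u z -> (z == x) || (z == y).
Proof.
move=> cu xK ux yK yx uy z zK uz.
have: [set x; y] \subset K :\: nbh e u.
  by apply/subsetP => t; rewrite !inE => /orP[]/eqP->; rewrite ?ux ?uy.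
move/subset_leqif_cards => [_]; rewrite cards2 (eq_sym x) yx card_nonnbrs.
rewrite (_ : (_ == _) = true); last by nat_lia.
move=> /esym/eqP/setP/(_ z); rewrite !inE uz zK; by case/orP=> ->; rewrite ?orbT.
Qed.

(** * Separation and exchange at the only large component *)

Section LargeComponent.
Variables (K C : {set T}) (u : T).
Hypotheses (ch : chordal e) (clK : is_clique e K).
Hypotheses (grK : greedy K) (maxK : forall v, ~~ candidate e K v).
Let CC := components e (~: K).
Hypotheses (CCC : C \in CC) (C3 : 2 < #|C|) (uC : u \in C).

(** Since [K] is maximal, [#|K| - 1] is the largest conceivable count, so [u] attains the maximum
    over [C]. In [no_nbr2] the failure of test 5 lowers this bound by one. *)
Lemma no_nbr1 x c : #|nbh e u :&: K|.+1 = #|K| -> x \in K -> ~~ e u x ->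
  c \in C -> ~~ e x c.
Proof.
move=> cu; apply: no_nbr_in_component ch CCC uC _ => // v vC.
by rewrite -ltnS cu; apply: nbr_count (notin_clique CCC vC).
Qed.

Lemma no_nbr2 x c : (forall v, v \in C -> #|nbh e v :&: K|.+1 != #|K|) ->
  #|nbh e u :&: K|.+2 = #|K| -> x \in K -> ~~ e u x ->
  c \in C -> ~~ e x c.
Proof.
move=> no1 cu; apply: no_nbr_in_component ch CCC uC _ => // v vC.
have := nbr_count maxK (notin_clique CCC vC); have := no1 v vC.
by nat_lia.
Qed.

(* What tests 5a and 5b leave: besides its neighbours in [K], the vertex [x]
   has at most one neighbour, and that one is isolated in [G - K]. *)
Lemma single_outer_nbr x : ~~ (2 <= #|[set D in CC | touches e x D]|) ->
  ~~ [exists D in CC, (2 <= #|D|) && touches e x D] ->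
  (forall v w, v \notin K -> w \notin K -> e x v -> e x w -> v = w) /\
  (forall v w, v \notin K -> w \notin K -> e x v -> ~~ e v w).
Proof.
move=> no_a /exists_inPn no_b.
have inB v : v \notin K -> v \in ~: K by rewrite inE.
have small_block v : v \notin K -> e x v -> #|pblock CC v| <= 1.
  move=> /inB vB xv; have [DC vD] := pblock_component vB.
  rewrite leqNgt; apply/negP => D2; have /negP := no_b _ DC; apply.
  by rewrite D2; apply/exists_inP; exists v.
have touch v : v \notin K -> e x v -> pblock CC v \in [set D in CC | touches e x D].
  move=> /inB vB xv; have [DC vD] := pblock_component vB.
  by rewrite inE DC; apply/exists_inP; exists v.
split=> v w vK wK xv.
  move=> xw; have eqb : pblock CC v = pblock CC w.
    rewrite -leqNgt in no_a; apply: (card_le1_eqP no_a); exact: touch.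
  apply: (card_le1_eqP (small_block v vK xv)).
    by rewrite eqb; have [_] := pblock_component (inB w wK).
  by have [_] := pblock_component (inB v vK).
apply/negP => vw; have [DC vD] := pblock_component (inB v vK).
have wD := component_edge DC vD (inB w wK) vw.
have vw1 := card_le1_eqP (small_block v vK xv) v w vD wD.
by rewrite vw1 irr in vw.
Qed.

Lemma swap_clique (X : {set T}) :
  (forall y, y \in K -> ~~ e u y -> y \in X) -> is_clique e (u |: (K :\: X)).
Proof.
move=> sX; apply: is_cliqueU1; first by apply: is_cliqueS clK; apply: subsetDl.
apply/subsetP => y; rewrite !inE => /andP[yX yK].
by apply: contraNT yX => /(sX y yK).
Qed.

Hypothesis uniqC : forall D, D \in CC -> 2 < #|D| -> D = C.
Hypothesis smallC : forall D, D \in components e (C :\ u) -> #|D| <= 2.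

(** The vertex [x] released from the clique joins at most one vertex, which has no other neighbour
    outside the new clique; everything else lies in [~: K :\ u]. *)
Lemma swap1_small x : x \in K -> ~~ e u x ->
  (forall v w, v \notin K -> w \notin K -> e x v -> e x w -> v = w) ->
  (forall v w, v \notin K -> w \notin K -> e x v -> ~~ e v w) ->
  small (~: (u |: (K :\ x))).
Proof.
move=> xK ux one iso v p q.
have sm := small_rest CCC uniqC smallC.
have out y : y \in ~: (u |: (K :\ x)) -> y != x -> y \in ~: K :\ u.
  by rewrite !inE negb_or => /andP[-> nK] yx; move: nK; rewrite yx.
have outK y : y \in ~: K :\ u -> y \notin K by rewrite !inE => /andP[].
move=> vB pB qB vp vq.
have [ev|vx] := eqVneq v x.
  rewrite ev in vp vq; apply: one => //; apply/outK/out => //;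
    by rewrite eq_sym edge_neq.
have [ep|px] := eqVneq p x.
  have [->|qx] := eqVneq q x; first by [].
  have xv : e x v by rewrite -ep sym.
  by have := iso v q (outK _ (out _ vB vx)) (outK _ (out _ qB qx)) xv; rewrite vq.
have [eq|qx] := eqVneq q x; last by apply: (sm v); rewrite ?out.
have xv : e x v by rewrite -eq sym.
by have := iso v p (outK _ (out _ vB vx)) (outK _ (out _ pB px)) xv; rewrite vp.
Qed.

(** The released vertices have no neighbours outside [K], so [x] and [y] can only be joined to each
    other in the new remainder. *)
Lemma swap2_small x y : x \in K -> y \in K ->
  (forall z, z \notin K -> ~~ e x z) -> (forall z, z \notin K -> ~~ e y z) ->
  small (~: (u |: (K :\: [set x; y]))).
Proof.
move=> xK yK nx ny v p q.
have sm := small_rest CCC uniqC smallC.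
pose X := [set x; y].
have XK z : z \in X -> z \in K by rewrite !inE => /orP[]/eqP->.
have nX z w : z \in X -> w \notin K -> ~~ e z w.
  by rewrite !inE => /orP[]/eqP->; [apply: nx | apply: ny].
have out z : z \in ~: (u |: (K :\: [set x; y])) -> z \notin X -> z \in ~: K :\ u.
  by rewrite !inE negb_or => /andP[-> nK] zX; move: nK; rewrite zX.
have outK z : z \in ~: K :\ u -> z \notin K by rewrite !inE => /andP[].
have same a b : a \in ~: (u |: (K :\: X)) -> b \in ~: (u |: (K :\: X)) ->
    e a b -> a \in X -> b \in X.
  move=> aB bB ab aX; apply/negPn/negP => bX.
  by have := nX a b aX (outK _ (out _ bB bX)); rewrite ab.
move=> vB pB qB vp vq.
have [vX|vX] := boolP (v \in X); last first.
  by apply: (sm v) => //; apply: out => //; apply: contra vX => bX;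
    [apply: same pB vB _ bX | apply: same qB vB _ bX]; rewrite sym.
have := same v q vB qB vq vX; have := same v p vB pB vp vX.
have := edge_neq vp; have := edge_neq vq; move: vX.
by rewrite !inE => /orP[]/eqP-> /negPf nq /negPf np;
  rewrite !(eq_sym _ x) !(eq_sym _ y) ?nq ?np /= ?orbF
   => /eqP-> /eqP->.
Qed.

End LargeComponent.

Lemma triangle_or_path x y z : e x y -> y != z -> x != z ->
  e x z || e y z -> P3_or_K3 e [set x; y; z].
Proof.
move=> xy yz xz /orP[xz'|yz'].
  by apply: P3_or_K3_cherry; apply/and3P.
rewrite (setUC [set x]); apply: P3_or_K3_cherry; apply/and3P; split=> //.
by rewrite sym.
Qed.

Lemma always_recognition : chordal e -> always (recognition e) (certified e).
Proof.
move=> ch; apply: always_grow;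
  [exact: is_clique0 | exact: greedy0 | by rewrite cards0 |].
move=> K clK grK maxK; cbv zeta; set CC := components e (~: K).
have CCb D x : D \in CC -> x \in D -> x \notin K := @notin_clique K D x.
have pickS := @pick_P3_or_K3 (~: K).
case: ifP => [/forall_inP sm|big].
  rewrite /= /CC cover_components; apply: small_polar_partition => //.
  exact/smallP.
case: ifP => [/exists_inP[C1 C1C /exists_inP[C2 C2C /and3P[neq C13 C23]]]|one].
  split=> [|Ci /andP[CiC Ci3]]; first by exists C1; rewrite C1C.
  split=> [|Cj /and3P[CjC ji Cj3]].
    have [eqi|nei] := eqVneq C1 Ci; last by exists C1; rewrite C1C nei.
    by exists C2; rewrite C2C C23 -eqi eq_sym neq.
  split=> [|S /andP[SCi S3]]; first exact: pickS CiC Ci3.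
  split=> [|U /andP[UCj U3]]; first exact: pickS CjC Cj3.
  apply: obstruction_separated => // s t /(subsetP SCi) sC /(subsetP UCj) tC.
  exact: components_nonadjacent CiC CjC ji sC tC.
move/negbT: big; rewrite negb_forall => /existsP[C0].
rewrite negb_imply -ltnNge => /andP[C0C C03].
split=> [|C /andP[CCC C3]]; first by exists C0; rewrite C0C.
have uniqC D : D \in CC -> 2 < #|D| -> D = C.
  move=> DC D3; apply/eqP/negPn/negP => nDC; move/exists_inP: one; case.
  by exists D => //; apply/exists_inP; exists C => //; rewrite nDC D3.
(* All separations below from a triple in [C] to a single vertex come from [sepC], [sepK] and
   [sepD]. In [sepD] the vertex [w] is outside [K] and adjacent to an [x] without neighbours in [C],
   which puts [w] outside [C]. *)
have sepC S x : S \subset C -> x \notin C -> (forall c, c \in C -> ~~ e x c) ->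
    forall s, s \in S -> (s != x) && ~~ e s x.
  move=> /subsetP sSC xC nx s /sSC sC; rewrite sym nx // andbT.
  by apply: contraNneq xC => <-.
have sepK S x : S \subset C -> x \in K -> (forall c, c \in C -> ~~ e x c) ->
    forall s, s \in S -> (s != x) && ~~ e s x.
  move=> sSC xK; apply: sepC => //; apply: contraL xK; exact: CCb.
have sepD S w x : S \subset C -> w \notin K -> e x w ->
    (forall c, c \in C -> ~~ e x c) -> forall s, s \in S -> (s != w) && ~~ e s w.
  move=> sSC wK xw nx; have wC : w \notin C by apply: contraL xw => /nx.
  apply: sepC => // c cC; apply: contra wC => wc.
  by apply: (component_edge CCC cC); rewrite ?inE // sym.
have disC D s : D \in components e (C :\ s) -> D \subset C.
  by move=> DC; apply: subset_trans (component_sub DC) (subsetDl _ _).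
case: ifP => [/exists_inP[u0 u0C cu0]|/negbT/exists_inPn no1].
  split=> [|u /andP[uC /eqP cu]]; first by exists u0; rewrite u0C.
  split=> [|x /andP[xK ux]].
    have /card_gt0P[x] : 0 < #|K :\: nbh e u| by rewrite card_nonnbrs; nat_lia.
    by rewrite !inE => /andP[ux xK]; exists x; rewrite xK.
  have onlyx := nonnbrs1 cu xK ux.
  have xnC := no_nbr1 ch clK maxK CCC uC cu xK ux.
  split=> [|S /andP[SC S3]]; first exact: pickS CCC C3.
  have inB z : z \notin K -> z \in ~: K by rewrite inE.
  case: ifP => [/card_gt1P[D1 [D2 []]]|no_a].
    rewrite !inE => /andP[D1C /exists_inP[v1 v1D xv1]].
    move=> /andP[D2C /exists_inP[v2 v2D xv2]] neq.
    split=> [|v /andP[vK xv]]; first by exists v1; rewrite (CCb D1).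
    split=> [|w /and3P[wK xw nvw]].
      have [eqv|nev] := eqVneq (pblock CC v) D1.
        exists v2; rewrite (CCb D2) // xv2 (component_pblock D2C) //.
        by rewrite eqv eq_sym neq.
      exists v1; rewrite (CCb D1) // xv1 (component_pblock D1C) //.
      by rewrite eq_sym nev.
    apply: obstruction_separated => //.
      apply: P3_or_K3_cherry; rewrite /cherry xv xw !andbT.
      by apply: contraNneq nvw => ->.
    move=> s t sS; rewrite !inE => /orP[/orP[]|]/eqP->.
    - exact: sepK SC xK xnC _ sS.
    - exact: sepD SC vK xv xnC _ sS.
    - exact: sepD SC wK xw xnC _ sS.
  case: ifP => [/exists_inP[D0 D0C /andP[D02 t0]]|no_b].
    split=> [|D /and3P[DC D2 /exists_inP[z zD xz]]].
      by exists D0; rewrite D0C D02.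
    have xD : x \notin D by apply: contraL xK => /(CCb D x DC).
    split=> [|R /and3P[RD R2 R3]].
      have [z' z'D zxz] := P3_or_K3_nbr (component_connected DC) xD zD xz D2.
      exists [set z; z']; apply/and3P; split.
      - by apply/subsetP => t; rewrite !inE => /orP[]/eqP->.
      - by rewrite cards2; case/and3P: zxz => _ _ /edge_neq ->.
      - have -> : x |: [set z; z'] = [set z; x; z'].
          by rewrite setUA [x |: _]setUC.
        exact: P3_or_K3_cherry.
    have DneqC : D != C by apply: contraL xz => /eqP eqD; apply: xnC; rewrite -eqD.
    apply: obstruction_separated => // s t sS /setU1P[->|tR].
      exact: sepK SC xK xnC _ sS.
    apply: components_nonadjacent CCC DC DneqC _ (subsetP RD _ tR).
    exact: (subsetP SC).
  have [one_w iso_w] := single_outer_nbr (negbT no_a) (negbT no_b).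
  case: ifP => [/exists_inP[D0 D0C D03]|no_c].
    split=> [|D /andP[DC D3]]; first by exists D0; rewrite D0C.
    split=> [|S' /andP[SD' S3']].
      exact: pick_P3_or_K3 DC D3.
    split=> [|y /and3P[yK yx /forall_inP yS]].
      (* The failure of 5a and 5b gives the degree bound: [x] has at most one neighbour outside
         [K]. *)
      have [z zK uz|y [yK uy yS]] := free_vertex clK grK maxK ch CCC C3 uC _ DC SD'.
        rewrite (onlyx z zK uz) (deg_split K); have := card_nbh_clique xK.
        have: #|nbh e x :\: K| <= 1; last by nat_lia.
        apply/card_le1_eqP => a b; rewrite !inE => /andP[aK xa] /andP[bK xb].
        exact: one_w.
      exists y; rewrite yK /=; apply/andP; split; last exact/forall_inP.
      by apply: contraTneq uy => ->.
    have [w wK xw] := outer_nbr grK maxK CCC C3 uC cu onlyx.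
    split=> [|w' /andP[wK' xw']]; first by exists w; rewrite wK.
    have xy : e x y.
      by apply: implyP (forall_inP (forall_inP clK x xK) y yK) _; rewrite eq_sym.
    have SC' := subset_trans SD' (disC _ _ DC).
    apply: obstruction_separated => //.
      rewrite [[set w'; x]]setUC; apply: P3_or_K3_cherry.
      by rewrite /cherry xw' xy !andbT; apply: contraNneq wK' => ->.
    move=> s t sS; rewrite !inE => /orP[/orP[]|]/eqP->.
    - exact: sepD SC' wK' xw' xnC _ sS.
    - exact: sepK SC' xK xnC _ sS.
    - rewrite sym yS // andbT; apply: contraTneq (subsetP SC' _ sS) => ->.
      by apply: contraL yK; apply: CCb.
  apply: small_polar_partition.
    by apply: swap_clique => // y yK uy; rewrite inE (onlyx y).
  have smC D : D \in components e (C :\ u) -> #|D| <= 2.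
    move=> DC; rewrite leqNgt; apply: contraFN no_c => D3.
    by apply/exists_inP; exists D.
  exact (swap1_small CCC uniqC smC xK ux one_w iso_w).
case: ifP => [/exists_inP[u0 u0C cu0]|/negbT/exists_inPn no2].
  split=> [|u /andP[uC /eqP cu]]; first by exists u0; rewrite u0C.
  have nonnbr2 : 1 < #|K :\: nbh e u| by rewrite card_nonnbrs; nat_lia.
  split=> [|x /andP[xK ux]].
    have /card_gt0P[x] : 0 < #|K :\: nbh e u| by nat_lia.
    by rewrite !inE => /andP[ux xK]; exists x; rewrite xK.
  split=> [|y /and3P[yK yx uy]].
    have /card_gt1P[a [b [aX bX ab]]] := nonnbr2.
    move: aX bX; rewrite !inE => /andP[ua aK] /andP[ub bK].
    have [eqa|nea] := eqVneq a x; last by exists a; rewrite aK nea.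
    by exists b; rewrite bK ub -eqa eq_sym ab.
  have onlyxy := nonnbrs2 cu xK ux yK yx uy.
  have xnC := no_nbr2 ch clK maxK CCC C3 uC no1 cu xK ux.
  have ynC := no_nbr2 ch clK maxK CCC C3 uC no1 cu yK uy.
  have xy : e x y.
    by apply: implyP (forall_inP (forall_inP clK x xK) y yK) _; rewrite eq_sym.
  case: ifP => [/existsP[z0 z0P]|/negbT/existsPn no_a].
    split=> [|z /andP[zK xyz]]; first by exists z0.
    split=> [|S /andP[SC S3]]; first exact: pickS CCC C3.
    have neqz k : k \in K -> k != z by move=> kK; apply: contraNneq zK => <-.
    apply: obstruction_separated => //; first by apply: triangle_or_path; rewrite ?neqz.
    move=> s t sS; rewrite !inE => /orP[/orP[]|]/eqP->.
    - exact: sepK SC xK xnC _ sS.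
    - exact: sepK SC yK ynC _ sS.
    - by case/orP: xyz => [xz|yz];
      [exact: sepD SC zK xz xnC _ sS | exact: sepD SC zK yz ynC _ sS].
  have nx z : z \notin K -> ~~ e x z.
    by move=> zK; have := no_a z; rewrite zK negb_or => /andP[].
  have ny z : z \notin K -> ~~ e y z.
    by move=> zK; have := no_a z; rewrite zK negb_or => /andP[].
  case: ifP => [/exists_inP[D0 D0C D03]|no_b].
    split=> [|D /andP[DC D3]]; first by exists D0; rewrite D0C.
    have uD : u \notin D.
      by apply/negP => /(subsetP (component_sub DC)); rewrite !inE eqxx.
    have Du : D :\ u = D.
      by apply/setDidPl; rewrite disjoint_sym disjoints1.
    rewrite Du; split=> [|S /andP[SD S3]]; first exact: pick_P3_or_K3 DC D3.
    split=> [|z /and4P[zK zx zy /forall_inP zS]].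
      have [z zK uz|z [zK uz zS]] := free_vertex clK grK maxK ch CCC C3 uC _ DC SD.
        rewrite (deg_split K); have := card_nbh_clique zK.
        have: #|nbh e z :\: K| = 0; last by nat_lia.
        apply/eqP; rewrite cards_eq0; apply/set0Pn => -[a].
        rewrite !inE => /andP[aK]; apply/negP.
        by case/orP: (onlyxy z zK uz) => /eqP->; [apply: nx | apply: ny].
      exists z; rewrite zK /=; apply/and3P; split; last exact/forall_inP.
        by apply: contraTneq uz => ->.
      by apply: contraTneq uz => ->.
    have SC := subset_trans SD (disC _ _ DC).
    have xz : e x z.
      by apply: implyP (forall_inP (forall_inP clK x xK) z zK) _; rewrite eq_sym.
    apply: obstruction_separated => //.
      by apply: triangle_or_path; rewrite ?xz // eq_sym.
    move=> s t sS; rewrite !inE => /orP[/orP[]|]/eqP->.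
    - exact: sepK SC xK xnC _ sS.
    - exact: sepK SC yK ynC _ sS.
    - rewrite sym zS // andbT; apply: contraTneq (subsetP SC _ sS) => ->.
      by apply: contraL zK; apply: CCb.
  apply: small_polar_partition.
    by apply: swap_clique => // z zK uz; rewrite !inE onlyxy.
  have smC D : D \in components e (C :\ u) -> #|D| <= 2.
    move=> DC; rewrite leqNgt; apply: contraFN no_b => D3.
    by apply/exists_inP; exists D.
  exact (swap2_small CCC uniqC smC xK yK nx ny).
split=> [|S /andP[SC S3]]; first exact: pickS CCC C3.
split=> [|U /and3P[UK U3 /forall_inP UC]].
  have [c0 c0C] := component_nonempty CCC.
  (* Tests 5 and 6 failed and [K] is maximal, so even the best vertex of [C] misses three vertices
     of [K], and these have no neighbours in [C]. *)
  have [u uC umax] := arg_maxnP (fun c => #|nbh e c :&: K|) c0C.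
  have: 2 < #|K :\: nbh e u|.
    rewrite card_nonnbrs; have := nbr_count maxK (CCb _ _ CCC uC).
    by have := no1 u uC; have := no2 u uC; nat_lia.
  case/card_gt2P=> a [b [c [[aX bX cX] [ab bc ca]]]].
  exists [set a; b; c]; have sX z : z \in [set a; b; c] -> z \in K :\: nbh e u.
    by rewrite !inE => /orP[/orP[]|]/eqP->; move: aX bX cX; rewrite !inE.
  apply/and3P; split.
  - by apply/subsetP => z /sX; rewrite inE => /andP[].
  - by rewrite -setUA cardsU1 cards2 !inE negb_or ab bc (eq_sym a c) ca.
  - apply/forall_inP => z /sX; rewrite !inE => /andP[uz zK]; apply/forall_inP => v.
    exact: no_nbr_in_component ch CCC uC umax zK uz.
have clU : P3_or_K3 e U.
  case/card_gt2P: (eq_leq (esym (eqP U3))) => a [b [c [[aU bU cU] [ab bc ca]]]].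
  have -> : U = [set a; b; c].
    apply/esym/eqP; rewrite eqEcard (eqP U3) -setUA cardsU1 cards2 !inE negb_or.
    rewrite ab bc (eq_sym a c) ca; apply/andP; split=> //.
    by apply/subsetP => z; rewrite !inE => /or3P[]/eqP->.
  have adj s t : s \in U -> t \in U -> s != t -> e s t.
    move=> /(subsetP UK) sK /(subsetP UK) tK.
    exact: implyP (forall_inP (forall_inP clK s sK) t tK).
  by apply: P3_or_K3_cherry; rewrite /cherry bc !adj // eq_sym.
apply: obstruction_separated => // s t sS tU.
apply: sepK SC (subsetP UK _ tU) _ _ sS => c cC.
exact: forall_inP (UC t tU) c cC.
Qed.

End Graph.

Theorem recognition_correct (T : finType) (e : rel T) :
  symmetric e -> irreflexive e -> chordal e ->
  never_stuck (recognition e) /\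
  forall h o, runs (recognition e) h o ->
    certified e o /\ (accepting o <-> polar e).
Proof.
move=> sym irr ch; have al := always_recognition sym irr ch.
split=> [|h o ru]; first exact: always_never_stuck al.
have := always_runs al ru; case: o {ru} => [A B|X] /= cert; split=> //.
  by split=> // _; exists A, B.
by split=> // pol; case: (obstruction_not_polar sym irr cert pol).
Qed.

(** * Reasoning about the random access machine *)

Definition setv (s : state) x v := State (update (vars s) x v) (arrays s).
Definition set_array (s : state) a f := State (vars s) (update (arrays s) a f).

(** Total correctness within a time budget. The budget is only an upper bound, so slack can be added
    wherever it simplifies a sum. *)
Definition wp (p : stmt) (s : state) (k : nat) (Q : state -> Prop) : Prop :=
  exists t s', [/\ exec p s t s', t <= k & Q s'].

Fixpoint written_vars (p : stmt) : seq nat :=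
  match p with
  | Assign x _ => [:: x]
  | Seq p1 p2 | If _ p1 p2 => written_vars p1 ++ written_vars p2
  | While _ p1 => written_vars p1
  | _ => [::]
  end.

Fixpoint written_arrays (p : stmt) : seq nat :=
  match p with
  | Put a _ _ => [:: a]
  | Seq p1 p2 | If _ p1 p2 => written_arrays p1 ++ written_arrays p2
  | While _ p1 => written_arrays p1
  | _ => [::]
  end.

Definition frame (xs ys : seq nat) (s s' : state) : Prop :=
  (forall x, x \notin xs -> vars s' x = vars s x) /\
  (forall a, a \notin ys -> arrays s' a = arrays s a).

Lemma update_same X (f : nat -> X) i x : update f i x i = x.
Proof. by rewrite /update eqxx. Qed.

Lemma update_other X (f : nat -> X) i x j : j != i -> update f i x j = f j.
Proof. by rewrite /update => /negPf->. Qed.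

Lemma frame_refl xs ys s : frame xs ys s s.
Proof. by []. Qed.

Lemma frame_trans xs ys s1 s2 s3 :
  frame xs ys s1 s2 -> frame xs ys s2 s3 -> frame xs ys s1 s3.
Proof.
move=> [v12 a12] [v23 a23].
by split=> x xN; [rewrite v23 ?v12 | rewrite a23 ?a12].
Qed.

Lemma frame_sub xs ys xs' ys' s s' :
  {subset xs <= xs'} -> {subset ys <= ys'} -> frame xs ys s s' -> frame xs' ys' s s'.
Proof.
by move=> sx sy [fv fa]; split=> x xN; [apply: fv | apply: fa];
  apply: contra xN; auto.
Qed.

Lemma frame_all xs ys xs' ys' s s' :
  all (mem xs') xs && all (mem ys') ys -> frame xs ys s s' -> frame xs' ys' s s'.
Proof. by case/andP=> /allP sx /allP sy; apply: frame_sub. Qed.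

Lemma frame_setv xs ys s s' x v :
  x \in xs -> frame xs ys s s' -> frame xs ys s (setv s' x v).
Proof.
move=> xx [fv fa]; split=> //= y yx.
by rewrite update_other ?fv //; apply: contraNneq yx => ->.
Qed.

Lemma frame_set_array xs ys s s' a f :
  a \in ys -> frame xs ys s s' -> frame xs ys s (set_array s' a f).
Proof.
move=> aa [fv fa]; split=> //= y yx.
by rewrite update_other ?fa //; apply: contraNneq yx => ->.
Qed.

Lemma exec_frame p s t s' :
  exec p s t s' -> frame (written_vars p) (written_arrays p) s s'.
Proof.
elim=> {p s t s'} //=.
- by move=> s x a; apply: frame_setv (frame_refl _ _ _); rewrite inE.
- by move=> s b i a; apply: frame_set_array (frame_refl _ _ _); rewrite inE.
- move=> p q s1 s2 s3 t1 t2 _ f1 _ f2; apply: frame_trans (_ : frame _ _ s1 s2) _.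
    by apply: frame_sub f1 => x xp; rewrite mem_cat xp.
  by apply: frame_sub f2 => x xp; rewrite mem_cat xp orbT.
- by move=> b p q s s' t; case: (holds s b) => _; apply: frame_sub => x xp;
    rewrite mem_cat xp ?orbT.
- by move=> b p s1 s2 s3 t1 t2 _ _ f1 _; apply: frame_trans.
Qed.

(** What a program leaves unchanged is read off its text, so specifications need only describe what
    it computes. *)
Lemma wp_frame p s k Q : wp p s k Q ->
  wp p s k (fun s' => frame (written_vars p) (written_arrays p) s s' /\ Q s').
Proof.
by case=> t [s' [ex le q]]; exists t, s'; split=> //; split=> //;
  apply: exec_frame ex.
Qed.

Lemma wp_mono p s k k' (Q Q' : state -> Prop) :
  k <= k' -> (forall s', Q s' -> Q' s') -> wp p s k Q -> wp p s k' Q'.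
Proof.
move=> le QQ' [t [s' [ex lt q]]]; exists t, s'; split=> //; last exact: QQ'.
exact: leq_trans le.
Qed.

Lemma wp_le k p s k' Q : k <= k' -> wp p s k Q -> wp p s k' Q.
Proof. by move=> le; apply: wp_mono. Qed.

Lemma wp_seq k1 k2 p q s k Q : k1 + k2 <= k ->
  wp p s k1 (fun s1 => wp q s1 k2 Q) -> wp (Seq p q) s k Q.
Proof.
move=> le [t1 [s1 [ex1 le1 [t2 [s2 [ex2 le2 qs]]]]]].
exists (t1 + t2), s2; split=> //; first exact: ExecSeq ex1 ex2.
by apply: leq_trans le; apply: leq_add.
Qed.

Lemma wp_assign x a s k (Q : state -> Prop) :
  exp_cost a < k -> Q (setv s x (eval s a)) -> wp (Assign x a) s k Q.
Proof. by move=> lt q; do 2!eexists; split; [exact: ExecAssign| |]. Qed.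

Lemma wp_if b p q s k1 k Q : test_cost b + k1 < k ->
  (holds s b -> wp p s k1 Q) -> (~~ holds s b -> wp q s k1 Q) ->
  wp (If b p q) s k Q.
Proof.
move=> le wp1 wp2.
have [t [s' [ex lt qs]]] : wp (if holds s b then p else q) s k1 Q.
  by case: ifP => [/wp1|/negbT/wp2].
by eexists; eexists; split; [exact: ExecIf ex | apply: leq_trans le;
  rewrite ltnS leq_add2l|].
Qed.

Fixpoint loop_free (p : stmt) : bool :=
  match p with
  | Seq p1 p2 | If _ p1 p2 => loop_free p1 && loop_free p2
  | While _ _ => false
  | _ => true
  end.

Fixpoint result (p : stmt) (s : state) : state :=
  match p with
  | Assign x a => setv s x (eval s a)
  | Put a i v =>
      set_array s a (update (arrays s a) (eval s i) (eval s v))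
  | Seq p1 p2 => result p2 (result p1 s)
  | If b p1 p2 => if holds s b then result p1 s else result p2 s
  | _ => s
  end.

(** An upper bound for code without loops, not the exact time: a conditional pays for both
    branches. *)
Fixpoint cost (p : stmt) : nat :=
  match p with
  | Assign _ a => (exp_cost a).+1
  | Put _ i v => (exp_cost i + exp_cost v).+1
  | Seq p1 p2 => cost p1 + cost p2
  | If b p1 p2 => (test_cost b + (cost p1 + cost p2)).+1
  | _ => 1
  end.

Lemma wp_loop_free p s k (Q : state -> Prop) :
  loop_free p -> cost p <= k -> Q (result p s) -> wp p s k Q.
Proof.
move=> lf le q; apply: (@wp_mono p s _ k (eq (result p s))) le _ _ => [_ <- //|].
elim: p s lf {q} => //=.
- by move=> s _; exists 1, s; split=> //; constructor.
- by move=> x a s _; do 2!eexists; split; [exact: ExecAssign| |].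
- by move=> b i a s _; do 2!eexists; split; [exact: ExecPut| |].
- move=> p IHp q IHq s /andP[lp lq]; apply: wp_seq (leqnn _) _.
  by case: (IHp s lp) => t [s1 [ex le1 e1]]; exists t, s1; split=> //; rewrite -e1;
    apply: IHq.
- move=> b p IHp q IHq s /andP[lp lq]; apply: wp_if (leqnn _) _ _ => [|/negPf] ->.
    by apply: wp_mono (leq_addr _ _) _ (IHp s lp).
  by apply: wp_mono (leq_addl _ _) _ (IHq s lq).
Qed.

(* The first argument of the invariant is the time still available. *)
Lemma wp_while b p s k (I : nat -> state -> Prop) :
  I k s ->
  (forall k1 s1, I k1 s1 -> holds s1 b -> exists k2,
     wp p s1 k2 (fun s2 => exists2 k3, k3 + k2 + test_cost b < k1 & I k3 s2)) ->
  wp (While b p) s (k + (test_cost b).+1)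
    (fun s' => ~~ holds s' b /\ exists k', I k' s').
Proof.
move=> + step; elim/ltn_ind: k s => k IH s Iks.
have [hb|nb] := boolP (holds s b); last first.
  exists (test_cost b).+1, s; split; last by split=> //; exists k.
    exact: ExecWhileStop.
  exact: leq_addl.
have [k2 [t [s2 [ex le [k3 lt3 I3]]]]] := step k s Iks hb.
have [|t' [s' [ex' le' Q]]] := IH k3 _ s2 I3; first by lia.
exists (test_cost b + t + t').+1, s'; split=> //; last by lia.
exact: ExecWhileStep ex'.
Qed.

Lemma offsets_nth (L : seq (seq nat)) i :
  i <= size L -> nth 0 (offsets L) i = sumn (take i (shape L)).
Proof.
case: i => [|i] lt; first by rewrite take0.
rewrite /offsets /= nth_scanl ?size_map //.
have foldl_sumn s m : foldl addn m s = m + sumn s.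
  by elim: s m => [|a s IH] m /=; rewrite ?addn0 // IH addnA.
by rewrite foldl_sumn.
Qed.

Lemma flatten_nth (T : Type) (x0 : T) (L : seq (seq T)) i j :
  i < size L -> j < size (nth [::] L i) ->
  nth x0 (flatten L) (sumn (take i (shape L)) + j) = nth x0 (nth [::] L i) j.
Proof.
elim: L i => [|l L IH] [|i] //=; rewrite ltnS => li lj; rewrite nth_cat.
  by rewrite add0n lj.
by rewrite -addnA ltnNge leq_addr /= addKn IH.
Qed.

(** * Loops over all vertices and over one adjacency list *)

Section Loops.
Variables (n : nat) (adj : 'I_n -> seq 'I_n).

Definition adj_lists : seq (seq nat) := [seq [seq val w | w <- adj v] | v <- enum 'I_n].

Definition layout (s : state) : Prop :=
  [/\ vars s 2 = n, arrays s 1 = nth 0 (offsets adj_lists)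
    & arrays s 2 = nth 0 (flatten adj_lists)].

Definition adj_start (u : 'I_n) := sumn (take u (shape adj_lists)).

Lemma size_adj_lists : size adj_lists = n.
Proof. by rewrite size_map size_enum_ord. Qed.

Lemma nth_adj_lists (u : 'I_n) : nth [::] adj_lists u = [seq val w | w <- adj u].
Proof. by rewrite (nth_map u) ?size_enum_ord // nth_ord_enum. Qed.

Lemma adj_start_offset (u : 'I_n) : nth 0 (offsets adj_lists) u = adj_start u.
Proof. by rewrite offsets_nth // size_adj_lists ltnW. Qed.

Lemma adj_end_offset (u : 'I_n) :
  nth 0 (offsets adj_lists) u.+1 = adj_start u + size (adj u).
Proof.
rewrite offsets_nth ?size_adj_lists //.
rewrite (take_nth 0); last by rewrite size_map size_adj_lists.
rewrite sumn_rcons (nth_map [::]) ?size_adj_lists // nth_adj_lists.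
by rewrite size_map.
Qed.

Lemma adj_contents (u : 'I_n) pre w post : adj u = pre ++ w :: post ->
  nth 0 (flatten adj_lists) (adj_start u + size pre) = w.
Proof.
move=> eqa; rewrite flatten_nth ?size_adj_lists ?nth_adj_lists //.
  by rewrite eqa map_cat nth_cat size_map ltnn subnn.
by rewrite size_map eqa size_cat /=; lia.
Qed.

Lemma layout_frame xs ys s s' : 2 \notin xs -> 1 \notin ys -> 2 \notin ys ->
  frame xs ys s s' -> layout s -> layout s'.
Proof.
by move=> n2 n1 n2' [fv fa] [v2 a1 a2]; split; rewrite ?fv ?fa.
Qed.

Definition for_vertices x body :=
  Seq (Assign x (Lit 0))
    (While (IsLt (Var x) (Var 2)) (Seq body (Assign x (Inc (Var x))))).

(** Each round adds 7 to the body: 3 for the test, 3 for the increment, 1 for the loop step. The 6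
    covers the initial assignment and the last, failing test. *)
Lemma wp_for_vertices x body s (I : nat -> state -> Prop) (c : nat -> nat) :
  vars s 2 = n -> x != 2 -> x \notin written_vars body ->
  2 \notin written_vars body ->
  (forall i s1 v, I i s1 -> I i (setv s1 x v)) ->
  I 0 s ->
  (forall (i : 'I_n) s1,
     frame (x :: written_vars body) (written_arrays body) s s1 ->
     vars s1 x = i -> I i s1 -> wp body s1 (c i) (I i.+1)) ->
  wp (for_vertices x body) s (6 + \sum_(i < n) (c i + 7)) (I n).
Proof.
move=> s2 x2 xb b2 Ix I0 step; rewrite /for_vertices.
set W := x :: _ in step; set A := written_arrays body in step.
apply: (wp_seq (k1 := 2) (k2 := \sum_(i < n) (c i + 7) + 4)); first by lia.
apply: wp_assign => //=.
pose J k s1 := exists i, [/\ i <= n, frame W A s s1, vars s1 x = i, I i s1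
  & k = \sum_(i <= j < n) (c j + 7)].
have := @wp_while (IsLt (Var x) (Var 2)) (Seq body (Assign x (Inc (Var x))))
  (setv s x 0) (\sum_(i < n) (c i + 7)) J.
case=> [||t [s' [ex le [nh [k [i [le_in fr xi Ii _]]]]]]].
- exists 0; split=> //=; first by apply: frame_setv (frame_refl _ _ _); apply: mem_head.
  + by rewrite update_same.
  + exact: Ix.
  + by rewrite big_mkord.
- move=> k s1 [i [le_in fr xi Ii ->]] /=; rewrite xi fr.1 ?s2 => [lt|]; last first.
    by rewrite inE negb_or eq_sym x2.
  exists (c i + 3); apply: (wp_seq (k1 := c i) (k2 := 3)) => //.
  have := wp_frame (step (Ordinal lt) s1 fr xi Ii).
  apply: wp_mono => // s2' [fr' I']; apply: wp_assign => //=.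
  have fr2 : frame W A s s2'.
    by apply: frame_trans fr _; apply: frame_sub fr' => // y; rewrite inE orbC => ->.
  exists (\sum_(i.+1 <= j < n) (c j + 7)); last first.
    exists i.+1; split=> //; first by apply: frame_setv fr2; apply: mem_head.
      by rewrite /= update_same fr'.1 ?xi.
    exact: Ix.
  by rewrite [X in _ < X]big_ltn //; lia.
exists t, s'; split=> //.
have -> : n = i; last by [].
by apply/eqP; move: nh; rewrite /= xi fr.1 ?s2 ?inE ?negb_or 1?eq_sym ?x2 //; lia.
Qed.

Definition for_neighbours v body :=
  Seq (Assign 12 (Get 1 (Var v)))
    (Seq (Assign 13 (Get 1 (Inc (Var v))))
      (While (IsLt (Var 12) (Var 13))
        (Seq (Assign 10 (Get 2 (Var 12))) (Seq body (Assign 12 (Inc (Var 12))))))).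

(** The invariant is indexed by the prefix of [adj u] already treated. Each neighbour adds 10: test
    3, loading it into variable 10 another 3, increment 3, loop step 1; reading both ends of the
    list and the last test cost 11. *)
Lemma wp_for_neighbours v (u : 'I_n) body s (I : seq 'I_n -> state -> Prop) c :
  layout s -> vars s v = u -> v != 12 ->
  [&& 12 \notin written_vars body, 13 \notin written_vars body,
    1 \notin written_arrays body & 2 \notin written_arrays body] ->
  (forall l s1 y w, y \in [:: 10; 12; 13] -> I l s1 -> I l (setv s1 y w)) ->
  I [::] s ->
  (forall pre w post s1, adj u = pre ++ w :: post ->
     frame ([:: 10; 12; 13] ++ written_vars body) (written_arrays body) s s1 ->
     vars s1 10 = w -> I pre s1 -> wp body s1 c (I (rcons pre w))) ->
  wp (for_neighbours v body) s (11 + (c + 10) * size (adj u)) (I (adj u)).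
Proof.
move=> [s2 a1 a2] su v12 /and4P[b12 b13 b1 b2] Ix I0 step.
rewrite /for_neighbours; set W := _ ++ _ in step; set A := written_arrays body in step.
apply: (wp_seq (k1 := 3) (k2 := 8 + (c + 10) * size (adj u))); first by lia.
apply: wp_assign => //=; rewrite a1 su adj_start_offset.
apply: (wp_seq (k1 := 4) (k2 := 4 + (c + 10) * size (adj u))); first by lia.
apply: wp_assign => //=; rewrite update_other // a1 su adj_end_offset.
set s0 := setv (setv _ _ _) _ _.
pose J k s1 := exists pre post, [/\ adj u = pre ++ post, frame W A s s1,
  vars s1 12 = adj_start u + size pre /\ vars s1 13 = adj_start u + size (adj u),
  I pre s1 & k = (c + 10) * size post].
have [||t [s' [ex le [nh [k [pre [post [eqa fr [s12 s13] Ip _]]]]]]]] :=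
  @wp_while (IsLt (Var 12) (Var 13))
  (Seq (Assign 10 (Get 2 (Var 12))) (Seq body (Assign 12 (Inc (Var 12)))))
  s0 ((c + 10) * size (adj u)) J.
- exists [::], (adj u); split=> //.
  + by do 2!apply: frame_setv => //; rewrite ?inE ?mem_cat.
  + by rewrite addn0.
  + by apply: (Ix) => //; apply: Ix.
- move=> k s1 [pre [[|w post] [eqa fr [s12 s13] Ip ->]]] /=.
    by rewrite s12 s13 eqa cats0 ltnn.
  move=> _; exists (c + 6); apply: (wp_seq (k1 := 3) (k2 := c + 3)); first by lia.
  apply: wp_assign => //=; rewrite s12 fr.2 // a2 (adj_contents eqa).
  set s3 := setv s1 10 w.
  have fr3 : frame W A s s3 by apply: frame_setv fr; rewrite mem_cat inE.
  have I3 : I pre s3 by apply: Ix.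
  apply: (wp_seq (k1 := c) (k2 := 3)) => //.
  have := wp_frame (step pre w post s3 eqa fr3 erefl I3).
  apply: wp_mono => // s4 [fr4 I4]; apply: wp_assign => //=.
  have s4_12 : vars s4 12 = adj_start u + size pre by rewrite fr4.1.
  have s4_13 : vars s4 13 = adj_start u + size (adj u) by rewrite fr4.1.
  exists ((c + 10) * size post); first by lia.
  exists (rcons pre w), post; split=> //.
  + by rewrite eqa cat_rcons.
  + apply: frame_setv; first by rewrite mem_cat !inE.
    apply: frame_trans fr3 _; apply: frame_sub fr4 => // y yb.
    by rewrite mem_cat yb orbT.
  + by split; rewrite /= ?size_rcons ?addnS /update /= ?s4_12.
  + exact: Ix.
exists t, s'; split=> //; first by move: le => /=; lia.
have post0 : post = [::].
  move: nh; rewrite /= s12 s13 eqa size_cat; case: (post) => //= ? ?; lia.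
by rewrite eqa post0 cats0.
Qed.

End Loops.

Fixpoint exp_vars (a : exp) : seq nat :=
  match a with
  | Lit _ => [::]
  | Var x => [:: x]
  | Get _ a1 | Inc a1 | Dec a1 => exp_vars a1
  end.

Fixpoint exp_arrays (a : exp) : seq nat :=
  match a with
  | Lit _ | Var _ => [::]
  | Get b a1 => b :: exp_arrays a1
  | Inc a1 | Dec a1 => exp_arrays a1
  end.

Fixpoint test_vars (b : test) : seq nat :=
  match b with
  | IsEq a1 a2 | IsLt a1 a2 => exp_vars a1 ++ exp_vars a2
  | Not b1 => test_vars b1
  | And b1 b2 => test_vars b1 ++ test_vars b2
  end.

Fixpoint test_arrays (b : test) : seq nat :=
  match b with
  | IsEq a1 a2 | IsLt a1 a2 => exp_arrays a1 ++ exp_arrays a2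
  | Not b1 => test_arrays b1
  | And b1 b2 => test_arrays b1 ++ test_arrays b2
  end.

Definition agree (X Y : pred nat) (s s' : state) : Prop :=
  (forall x, X x -> vars s' x = vars s x) /\
  (forall a, Y a -> arrays s' a = arrays s a).

Lemma eval_agree X Y s s' a : agree X Y s s' ->
  all X (exp_vars a) -> all Y (exp_arrays a) -> eval s' a = eval s a.
Proof.
move=> [av aa]; elim: a => //= [x|b a IH|a IH|a IH].
- by rewrite andbT => /av.
- by move=> xa /andP[yb ya]; rewrite IH // aa.
- by move=> xa ya; rewrite IH.
- by move=> xa ya; rewrite IH.
Qed.

Lemma holds_agree X Y s s' b : agree X Y s s' ->
  all X (test_vars b) -> all Y (test_arrays b) -> holds s' b = holds s b.
Proof.
move=> ag; elim: b => /= [a1 a2|a1 a2|b IH|b1 IH1 b2 IH2].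
- by rewrite !all_cat => /andP[x1 x2] /andP[y1 y2]; rewrite !(eval_agree ag).
- by rewrite !all_cat => /andP[x1 x2] /andP[y1 y2]; rewrite !(eval_agree ag).
- by move=> x y; rewrite IH.
- by rewrite !all_cat => /andP[x1 x2] /andP[y1 y2]; rewrite IH1 ?IH2.
Qed.

Definition independent (xs ys : seq nat) (b : test) : bool :=
  all (fun x => x \notin xs) (test_vars b) && all (fun a => a \notin ys)
    (test_arrays b).

Lemma holds_frame xs ys s s' b :
  frame xs ys s s' -> independent xs ys b -> holds s' b = holds s b.
Proof. by move=> fr /andP[]; apply: holds_agree. Qed.

(* Variable 10 holds the vertex that a loop tests. *)
Definition test_at (s : state) (b : test) (v : nat) : bool := holds (setv s 10 v) b.

Lemma holds_test_at xs ys s s' b v : frame (10 :: xs) ys s s' ->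
  vars s' 10 = v -> independent xs ys b -> holds s' b = test_at s b v.
Proof.
move=> [fv fa] s10; apply: holds_frame; split=> // x xN /=; rewrite /update.
by case: eqP => [->//|/eqP x10]; rewrite fv // inE negb_or x10.
Qed.

(** * Linear-time passes: search, output, counting neighbours, breadth-first search *)

Section Subroutines.
Variables (n : nat) (adj : 'I_n -> seq 'I_n).

(** The successor lets constant costs be absorbed even when there are no vertices. *)
Definition input_size := (n + \sum_(v < n) size (adj v)).+1.

(** Adjacency lists are accessed through [nth] because the budgets of [wp_for_vertices] are
    functions of natural numbers. The 13 absorbs the overhead 6 and 7 of that loop. *)
Lemma sum_linear c c' k :
  6 + \sum_(v < n) (c + c' * size (nth [::] (adj_lists adj) v) + 7) + k <=
  (c + c' + k + 13) * input_size.
Proof.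
rewrite (eq_bigr (fun v => c + c' * size (adj v) + 7)); last first.
  by move=> v _; rewrite nth_adj_lists size_map.
rewrite big_split /= sum_nat_const card_ord big_split /= sum_nat_const card_ord.
rewrite -big_distrr /= /input_size; set S := \sum_(v < n) _.
have := leq0n (c * S); have := leq0n (c' * n); have := leq0n (k * n).
have := leq0n (k * S); nia.
Qed.

Lemma sum_constant c k :
  6 + \sum_(v < n) (c + 7) + k <= (c + k + 13) * input_size.
Proof.
rewrite sum_nat_const card_ord /input_size; set S := \sum_(v < n) _.
have := leq0n (c * S); have := leq0n (k * n); have := leq0n (k * S); nia.
Qed.

(** Failure is reported by the value [n], which is the number of no vertex. The result passes
    through variable 16, so [b] may read the old value of [x]. *)
Definition find b x :=
  Seq (Assign 16 (Var 2))
    (Seq (for_vertices 10 (If b (Assign 16 (Var 10)) Skip)) (Assign x (Var 16))).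

Lemma wp_find b x s : layout adj s -> independent [:: 16] [::] b ->
  wp (find b x) s ((test_cost b + 25) * input_size) (fun s' =>
    (exists2 v : 'I_n, test_at s b v & vars s' x = v) \/
    (vars s' x = n /\ forall v : 'I_n, ~~ test_at s b v)).
Proof.
move=> lay ind; have [s2 _ _] := lay.
pose I i s1 := (exists2 v : 'I_n, test_at s b v & vars s1 16 = v) \/
  (vars s1 16 = n /\ forall v : 'I_n, v < i -> ~~ test_at s b v).
pose s0 := setv s 16 n.
have main : wp (for_vertices 10 (If b (Assign 16 (Var 10)) Skip)) s0
    (6 + \sum_(i < n) (test_cost b + 4 + 7)) (I n).
  apply: (wp_for_vertices (c := fun=> test_cost b + 4)) => //.
  - by right; split.
  - move=> i s1 fr s10 Ii; have e1 : holds s1 b = test_at s b i.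
      apply: holds_test_at s10 ind; apply: frame_trans (_ : frame _ _ s s0) _.
        by apply: frame_setv (frame_refl _ _ _).
      by apply: frame_sub fr => // y; rewrite !inE.
    apply: wp_loop_free => //=; first by lia.
    rewrite e1; case: ifP => [bi|nbi]; first by left; exists i; rewrite //= s10.
    case: Ii => [?|[sn none]]; [by left | right; split=> // v].
    rewrite ltnS leq_eqVlt => /orP[/eqP/val_inj->|]; last exact: none.
    by rewrite nbi.
apply: (@wp_le (2 + (6 + \sum_(i < n) (test_cost b + 4 + 7) + 2))).
  by have := sum_constant (test_cost b + 4) 4; lia.
apply: wp_seq (leqnn _) _; apply: wp_assign => //=; rewrite s2.
apply: wp_seq (leqnn _) _; apply: wp_mono main => // s1 I1.
apply: wp_assign => //=; case: I1 => [[v bv s16]|[s16 none]].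
  by left; exists v; rewrite //= update_same.
by right; rewrite update_same; split=> // v; apply: none.
Qed.

(* A sequence of vertex sets, in the format of [stores_sets]; variables [c] and
   [l] hold their number and their total size. *)
Definition logged (a b c l : nat) (s : state) (F : seq {set 'I_n}) : Prop :=
  exists L : seq (seq 'I_n), [/\ all uniq L /\ [seq [set v in r] | r <- L] = F,
    vars s c = size L, vars s l = size (flatten L),
    (forall i, i <= size L -> arrays s a i = sumn (take i (shape L)))
    & (forall i, i < size (flatten L) ->
         arrays s b i = nth 0 [seq val v | v <- flatten L] i)].

Lemma logged_stores a b c l s F : logged a b c l s F ->
  vars s c = size F /\ stores_sets s a b F.
Proof.
case=> L [[uL eF] sc sl oL cL]; split; first by rewrite -eF size_map.
exists L; split=> // i; last by rewrite -map_flatten size_map => /cL.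
rewrite size_map => lei; rewrite oL // offsets_nth ?size_map //.
by rewrite /shape -map_comp; under [in RHS]eq_map do rewrite /= size_map.
Qed.

Lemma logged_frame xs ys a b c l s s' F :
  c \notin xs -> l \notin xs -> a \notin ys -> b \notin ys ->
  frame xs ys s s' -> logged a b c l s F -> logged a b c l s' F.
Proof.
move=> nc nl na nb [fv fa] [L [HL sc sl oL cL]]; exists L; split=> //.
- by rewrite fv.
- by rewrite fv.
- by rewrite fa.
- by rewrite fa.
Qed.

Lemma logged_rcons a b c l s s' F (r : seq 'I_n) :
  logged a b c l s F -> uniq r ->
  vars s' c = (vars s c).+1 -> vars s' l = vars s l + size r ->
  (forall i, arrays s' a i =
     if i == (vars s c).+1 then vars s l + size r else arrays s a i) ->
  (forall i, i < vars s l -> arrays s' b i = arrays s b i) ->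
  (forall i, i < size r -> arrays s' b (vars s l + i) = nth 0 [seq val v | v <- r] i) ->
  logged a b c l s' (rcons F [set v in r]).
Proof.
case=> L [[uL <-] sc sl oL cL] ur sc' sl' oa' old new; exists (rcons L r).
have sf : size (flatten (rcons L r)) = size (flatten L) + size r.
  by rewrite flatten_rcons size_cat.
split.
- by rewrite all_rcons ur uL map_rcons.
- by rewrite size_rcons sc' sc.
- by rewrite sf sl' sl.
- move=> i; rewrite size_rcons oa' sc => lei; case: eqP => [->|ni].
    by rewrite /shape map_rcons -cats1 take_oversize ?size_cat ?size_map ?addn1 //
      sumn_cat /= addn0 sl size_flatten.
  by rewrite oL ?/shape ?map_rcons -?cats1 ?takel_cat ?size_map //; lia.
move=> i; rewrite sf flatten_rcons map_cat nth_cat size_map => lti.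
case: ltnP => [lt|ge]; first by rewrite old ?sl // cL.
rewrite -sl in lti ge *; rewrite -[in LHS](subnKC ge).
by apply: new; rewrite ltn_subLR.
Qed.

Definition emit a b c l t :=
  Seq (for_vertices 10
        (If t (Seq (Put b (Var l) (Var 10)) (Assign l (Inc (Var l)))) Skip))
    (Seq (Assign c (Inc (Var c))) (Put a (Var c) (Var l))).

Lemma take_enum_ord (i : 'I_n) : take i.+1 (enum 'I_n) = rcons (take i (enum 'I_n)) i.
Proof. by rewrite (take_nth i) ?size_enum_ord // nth_ord_enum. Qed.

Lemma wp_emit (a b c l : nat) t s F : layout adj s -> independent [:: l] [:: b] t ->
  [&& l != 2, l != 10, c != 10, c != l & a != b] -> logged a b c l s F ->
  wp (emit a b c l t) s ((test_cost t + 30) * input_size)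
    (fun s' => logged a b c l s' (rcons F [set v : 'I_n | test_at s t v])).
Proof.
move=> lay ind /and5P[l2 l10 c10 cl ab] lg; have [s2 _ _] := lay.
rewrite /emit; set body := If _ _ _.
(* The part of the new set written after [i] rounds, in increasing order and hence without
   duplicates. *)
pose r i := [seq v <- take i (enum 'I_n) | test_at s t (val v)].
pose I i s1 := [/\ vars s1 l = vars s l + size (r i),
  forall j, j < vars s l -> arrays s1 b j = arrays s b j
  & forall j, j < size (r i) ->
      arrays s1 b (vars s l + j) = nth 0 [seq val v | v <- r i] j].
have main : wp (for_vertices 10 body) s
    (6 + \sum_(i < n) (test_cost t + 8 + 7)) (I n).
  apply: (wp_for_vertices (c := fun=> test_cost t + 8)) => //.
  - by rewrite /= !inE eq_sym.
  - by rewrite /= !inE eq_sym.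
  - by move=> i s1 v [I1 I2 I3]; split=> //=; rewrite update_other.
  - by split; rewrite /r ?take0 //= addn0.
  move=> i s1 fr s10 [I1 I2 I3].
  have e1 : holds s1 t = test_at s t i.
    by apply: holds_test_at s10 ind; apply: frame_sub fr.
  have rS : r i.+1 = r i ++ (if test_at s t i then [:: i] else [::]).
    by rewrite /r take_enum_ord filter_rcons; case: ifP; rewrite ?cats0 ?cats1.
  apply: wp_loop_free => //=; first by lia.
  rewrite e1 /I rS; case: ifP => [ti|nti]; last by rewrite cats0; split.
  split=> /=; first by rewrite update_same I1 size_cat addn1 addnS.
  - move=> j lt; rewrite /update eqxx; case: eqP => [ej|_]; last exact: I2.
    by move: lt; rewrite ej I1; lia.
  move=> j; rewrite size_cat /= addn1 ltnS /update eqxx I1 s10 eqn_add2l.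
  rewrite map_cat nth_cat size_map; case: eqP => [->|nj] lt.
    by rewrite ltnn subnn.
  have lt' : j < size (r i) by rewrite ltn_neqAle lt andbT; apply/eqP.
  by rewrite lt' I3.
apply: (@wp_le (6 + \sum_(i < n) (test_cost t + 8 + 7) + (3 + 4))).
  by have := sum_constant (test_cost t + 8) 7; lia.
apply: wp_seq (leqnn _) _; apply: wp_mono (wp_frame main) => // s1 [fr [I1 I2 I3]].
have s1c : vars s1 c = vars s c by rewrite fr.1 //= !inE !negb_or c10 cl.
have s1a : arrays s1 a = arrays s a by rewrite fr.2 //= !inE.
apply: wp_loop_free => //=.
have -> : [set v : 'I_n | test_at s t v] = [set v in r n].
  by apply/setP => v; rewrite !inE mem_filter take_oversize ?size_enum_ord //
    mem_enum andbT.
apply: (logged_rcons lg) => //=.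
- by rewrite filter_uniq // take_uniq // enum_uniq.
- by rewrite update_same s1c.
- by rewrite update_other 1?eq_sym // I1.
- move=> i; rewrite update_same (update_same (vars s1)) (@update_other _ (vars
  s1)) 1?eq_sym //.
  by rewrite /update s1a s1c I1 eq_sym.
- by move=> j lt; rewrite update_other 1?eq_sym // I2.
- by move=> j lt; rewrite update_other 1?eq_sym // I3.
Qed.


(** Besides the count [d], two distinct hits are kept; each of them is meaningful only when the
    count is large enough. Two suffice to exhibit a vertex with two neighbours. *)
Definition scan_spec (P : nat -> bool) (l : seq 'I_n) (d m1 m2 : nat) : Prop :=
  [/\ d = count (fun w : 'I_n => P w) l,
      0 < d -> exists2 w : 'I_n, (w \in l) && P w & m1 = w
    & 1 < d -> exists w w' : 'I_n, [/\ (w \in l) && P w, (w' \in l) && P w',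
        w != w', m1 = w & m2 = w']].

Lemma scan_rcons (P : nat -> bool) l (w : 'I_n) d m1 m2 : w \notin l -> P w ->
  scan_spec P l d m1 m2 -> scan_spec P (rcons l w) d.+1 w m1.
Proof.
move=> wl Pw [-> e1 _]; split.
- by rewrite -cats1 count_cat /= Pw addn0 addn1.
- by exists w; rewrite // mem_rcons mem_head.
rewrite ltnS => /e1[w1 /andP[w1l Pw1] ->]; exists w, w1; split=> //.
- by rewrite mem_rcons mem_head.
- by rewrite mem_rcons inE w1l orbT.
- by apply: contraNneq wl => ->.
Qed.

Lemma scan_rcons_skip (P : nat -> bool) l (w : 'I_n) d m1 m2 : ~~ P w ->
  scan_spec P l d m1 m2 -> scan_spec P (rcons l w) d m1 m2.
Proof.
move=> Pw [-> e1 e2]; split.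
- by rewrite -cats1 count_cat /= (negPf Pw) !addn0.
- by case/e1=> x /andP[xl Px] ->; exists x; rewrite // mem_rcons inE xl orbT.
case/e2=> x [y [/andP[xl Px] /andP[yl Py] xy -> ->]].
by exists x, y; split=> //; rewrite mem_rcons inE ?xl ?yl orbT.
Qed.

Definition scan_nbrs b d m1 m2 :=
  for_vertices 11
    (Seq (Put d (Var 11) (Lit 0))
      (for_neighbours 11
        (If b (Seq (Put d (Var 11) (Inc (Get d (Var 11))))
                (Seq (Put m2 (Var 11) (Get m1 (Var 11))) (Put m1 (Var 11) (Var 10))))
           Skip))).

Hypothesis adj_uniq : forall v, uniq (adj v).

Lemma wp_scan_nbrs b (d m1 m2 : nat) s : layout adj s ->
  independent [:: 11; 12; 13] [:: d; m1; m2] b ->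
  [&& d != m1, d != m2, m1 != m2 & all (leq 3) [:: d; m1; m2]] ->
  wp (scan_nbrs b d m1 m2) s ((2 * test_cost b + 65) * input_size) (fun s' =>
    forall v : 'I_n,
      scan_spec (test_at s b) (adj v) (arrays s' d v) (arrays s' m1 v) (arrays s'
        m2 v)).
Proof.
move=> lay ind /and4P[dm1 dm2 m12 /and4P[d3 m13 m23 _]]; have [s2 _ _] := lay.
have nots x : 2 < x -> (1 != x) && (2 != x) by case: x => [|[|[|x]]].
have [/andP[d_1 d_2] /andP[m1_1 m1_2] /andP[m2_1 m2_2]] :=
  And3 (nots d d3) (nots m1 m13) (nots m2 m23).
rewrite /scan_nbrs; set ib := If b _ _; set body := Seq _ _.
pose S s1 (l : 'I_n -> seq 'I_n) v :=
  scan_spec (test_at s b) (l v) (arrays s1 d v) (arrays s1 m1 v) (arrays s1 m2 v).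
pose I i s1 := forall v : 'I_n, v < i -> S s1 adj v.
apply: (@wp_le (6 + \sum_(i < n) (test_cost b + 20 +
   (test_cost b + 30) * size (nth [::] (adj_lists adj) i) + 7))).
  by have := sum_linear (test_cost b + 20) (test_cost b + 30) 0; lia.
apply: wp_mono (leqnn _) (_ : forall s', I n s' -> _) _ => [s' In v|].
  exact: In.
apply: (wp_for_vertices (c := fun i => test_cost b + 20 +
   (test_cost b + 30) * size (nth [::] (adj_lists adj) i))) => //.
move=> i s1 fr s1i I1; rewrite nth_adj_lists size_map.
have lay1 : layout adj s1 by apply: layout_frame fr lay;
  rewrite //= !inE !negb_or ?d_1 ?m1_1 ?m2_1 ?d_2 ?m1_2 ?m2_2.
apply: (@wp_le (3 + (11 + (test_cost b + 17 + 10) * size (adj i)))).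
  rewrite addnA leq_add // ?leq_mul2r; first by lia.
  by rewrite -addnA leq_add2l orbT.
apply: wp_seq (leqnn _) _; apply: wp_loop_free => //=; rewrite s1i.
set s3 := set_array _ _ _.
have fr3 : frame [:: 10; 11; 12; 13] [:: d; m1; m2] s s3.
  apply: frame_set_array; first exact: mem_head.
  by apply: frame_all fr; rewrite /= !inE !eqxx ?orbT.
have lay3 : layout adj s3.
  by apply: layout_frame fr3 lay;
    rewrite //= !inE !negb_or ?d_1 ?m1_1 ?m2_1 ?d_2 ?m1_2 ?m2_2.
pose J (pre : seq 'I_n) s4 :=
  (forall v : 'I_n, v < i -> S s4 adj v) /\ S s4 (fun=> pre) i.
apply: wp_mono (leqnn _) (_ : forall s', J (adj i) s' -> _) _.
  move=> s' [Jlt Ji] v; rewrite ltnS leq_eqVlt => /orP[/eqP/val_inj->|] //.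
  exact: Jlt.
apply: (wp_for_neighbours (I := J)) => //.
- by rewrite /= !inE !negb_or d_1 m1_1 m2_1 d_2 m1_2 m2_2.
- split=> [v lt|]; rewrite /S /= /update eqxx !(eq_sym _ d) !(negPf dm1) !(negPf dm2).
    by rewrite ltn_eqF //; apply: I1.
  by rewrite eqxx; split.
move=> pre w post s4 eqa fr4 s4w [Jlt Ji].
have s4i : vars s4 11 = i by rewrite fr4.1.
have e4 : holds s4 b = test_at s b w.
  apply: holds_test_at s4w ind; apply: frame_trans (_ : frame _ _ s s3) _.
    by apply: frame_sub fr3.
  by apply: frame_all fr4; rewrite /= !inE !eqxx ?orbT.
have wpre : w \notin pre.
  by have := adj_uniq i; rewrite eqa cat_uniq /= => /and3P[_ /norP[]].
apply: wp_loop_free => //=; first by lia.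
rewrite e4; case: ifP => [bw|/negbT nbw] /=; last first.
  by split=> //; apply: scan_rcons_skip.
rewrite s4i s4w; split=> [v lt|]; rewrite /S /= /update !eqxx
  !(eq_sym _ d) !(eq_sym m2 m1) !(negPf dm1) !(negPf dm2) !(negPf m12) ?eqxx.
  by rewrite !ltn_eqF //; apply: Jlt.
exact: scan_rcons wpre bw Ji.
Qed.

(* Array 7 is the queue of the search, between positions 14 and 15. *)
Definition flood b r x :=
  Seq (for_vertices 11 (Put r (Var 11) (Lit 0)))
    (Seq
      (Seq (Put r (Var x) (Lit 1))
        (Seq (Put 7 (Lit 0) (Var x)) (Seq (Assign 14 (Lit 0)) (Assign 15 (Lit 1)))))
      (While (IsLt (Var 14) (Var 15))
        (Seq (Assign 11 (Get 7 (Var 14)))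
          (Seq
            (for_neighbours 11
              (If (And (IsEq (Get r (Var 10)) (Lit 0)) b)
                (Seq (Put r (Var 10) (Lit 1))
                  (Seq (Put 7 (Var 15) (Var 10)) (Assign 15 (Inc (Var 15)))))
                Skip))
            (Assign 14 (Inc (Var 14))))))).

(** Only the vertex entered is tested, never the start. From a vertex of the set described by [P]
    the search therefore covers exactly its component there. *)
Definition search_rel (P : nat -> bool) : rel 'I_n :=
  [rel y z | (z \in adj y) && P (z : 'I_n)].

Lemma wp_flood b r x (u : 'I_n) s : layout adj s -> vars s x = u -> 19 < x ->
  independent [:: 11; 12; 13; 14; 15] [:: r; 7] b -> 7 < r ->
  wp (flood b r x) s ((2 * test_cost b + 150) * input_size) (fun s' =>
    forall v : 'I_n, arrays s' r v = connect (search_rel (test_at s b)) u v).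
Proof.
move=> lay sx x19 ind r7; have [s2 _ _] := lay.
have [r_7 r_1 r_2] : [/\ r != 7, r != 1 & r != 2] by split; lia.
have [x11 x2] : x != 11 /\ x != 2 by split; lia.
rewrite /flood; set ib := If _ _ _; set body := Seq (Assign 11 _) _.
set init := Seq (Put r (Var x) _) _.
pose P := test_at s b; pose f := search_rel P.
pose c := test_cost b.
apply: (@wp_le (6 + \sum_(v < n) (3 + 7) + (10 + (\sum_(v < n) (c + 40 + (c + 30) *
   size (nth [::] (adj_lists adj) v) + 7) + 4)))).
  have := sum_constant 3 0; have := sum_linear (c + 40) (c + 30) 20.
  have := leq0n input_size; rewrite /c; move: (test_cost b) => k.
  by lia.
apply: wp_seq (leqnn _) _.
have clear : wp (for_vertices 11 (Put r (Var 11) (Lit 0))) s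
    (6 + \sum_(v < n) (3 + 7)) (fun s1 => forall v : 'I_n, arrays s1 r v = 0).
  pose I i s1 := forall v : 'I_n, v < i -> arrays s1 r v = 0.
  apply: wp_mono (leqnn _) (_ : forall s1, I n s1 -> _) _ => [s1 In v|].
    exact: In.
  apply: (wp_for_vertices (c := fun=> 3)) => // i s1 _ s1i Ii.
  apply: wp_loop_free => //= v; rewrite ltnS /= update_same /update s1i => le.
  by case: eqP => // /eqP ne; apply: Ii; rewrite ltn_neqAle ne.
apply: wp_mono (leqnn _) _ (wp_frame clear) => s1 [fr1 z1].
apply: wp_seq (leqnn _) _; apply: wp_loop_free => //=.
have s1x : vars s1 x = u by rewrite fr1.1 //= !inE !negb_or x11.
rewrite !s1x; set s3 := setv _ _ _.
pose W := [:: 10; 11; 12; 13; 14; 15]; pose A := [:: r; 7].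
have fr3 : frame W A s s3.
  do 2!apply: frame_setv => //; do 2!(apply: frame_set_array;
    first by rewrite !inE eqxx ?orbT).
  by apply: frame_all fr1; rewrite /= !inE eqxx.
have lay_frame s4 : frame W A s s4 -> layout adj s4.
  by move=> fr; apply: layout_frame fr lay; rewrite // !inE !negb_or eq_sym ?r_1 ?r_2.
(* The queue splits into the vertices already processed, [dn], and those waiting, [td]; array [r]
   marks exactly their union, and all of them are reachable. *)
pose Q s4 dn td := [/\ uniq (dn ++ td), vars s4 15 = size (dn ++ td),
  forall j, j < size (dn ++ td) ->
    arrays s4 7 j = nth 0 [seq val v | v : 'I_n <- dn ++ td] j,
  forall v : 'I_n, arrays s4 r v = (v \in dn ++ td)
  & forall v, v \in dn ++ td -> connect f u v].
(* The time still available: no vertex is processed twice, so the lists of the unprocessed vertices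
   pay for all remaining rounds. *)
pose B (dn : seq 'I_n) := \sum_(v < n | v \notin dn) (c + 40 + (c + 30) *
   size (nth [::] (adj_lists adj) v) + 7).
pose J k s4 := exists dn td, [/\ frame W A s s4 /\ vars s4 14 = size dn, Q s4 dn td,
  u \in dn ++ td, (forall v w, v \in dn -> f v w -> w \in dn ++ td) & k = B dn].
have [||t [s' [ex le [nh [k [dn [td [[fr s14] [un s15 _ mark con] uq cl _]]]]]]]] :=
    @wp_while (IsLt (Var 14) (Var 15)) body s3 (B [::]) J.
- exists [::], [:: u]; split=> //=; last exact: mem_head.
  split=> //=.
  + by case=> // _; rewrite /update /= eq_sym (negPf r_7).
  + move=> v; rewrite /update /= (negPf r_7) eqxx inE.
    by rewrite -val_eqE /=; case: eqP => //; rewrite z1.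
  + by move=> v; rewrite inE => /eqP->; apply: connect0.
- move=> _ s4 [dn [[|v td] [[fr s14] [un s15 queue mark con] uq cl ->]]] /=.
    by rewrite s14 s15 cats0 ltnn.
  move=> _; exists (3 + ((11 + (c + 16 + 10) * size (adj v)) + 3)).
  apply: wp_seq (leqnn _) _; apply: wp_assign => //=.
  have -> : arrays s4 7 (vars s4 14) = v.
    rewrite s14 queue ?size_cat //=; last by lia.
    by rewrite map_cat nth_cat size_map ltnn subnn.
  apply: wp_seq (leqnn _) _; set s5 := setv _ _ _.
  have fr5 : frame W A s s5 by apply: frame_setv.
  have vnd : v \notin dn.
    by move: un; rewrite cat_uniq /= => /and3P[_ /norP[]].
  (* While the list of [v] is read, [v] already counts as processed and [td'] collects the vertices
     it adds to the queue. *)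
  pose K (pre : seq 'I_n) s6 := exists td', Q s6 (rcons dn v) (td ++ td') /\
    forall w, w \in pre -> P w -> w \in rcons dn v ++ (td ++ td').
  have nbrs : wp (for_neighbours 11 ib) s5 (11 + (c + 16 + 10) * size (adj v))
      (K (adj v)).
    apply: (wp_for_neighbours (I := K)) => //.
    + exact: lay_frame.
    + by rewrite /= !inE !negb_or !(eq_sym _ r) r_1 r_2.
    + move=> l s6 y w yW [td' [[q1 q2 q3 q4 q5] cl']]; exists td'; split=> //.
      split=> //=; rewrite update_other //.
      by move: yW; rewrite !inE => /or3P[]/eqP->.
    + by exists [::]; rewrite cats0; split=> //; rewrite /Q cat_rcons.
    move=> pre w post s6 eqa fr6 s6w [td' [[q1 q2 q3 q4 q5] cl']].
    have fr6' : frame W A s s6.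
      apply: frame_trans fr5 _.
      by apply: frame_all fr6; rewrite /= !inE !eqxx ?orbT.
    have e6 : holds s6 b = P w.
      by apply: holds_test_at s6w ind; apply: frame_all fr6';
        rewrite /= !inE !eqxx ?orbT.
    apply: wp_loop_free => //=; first by rewrite /c; lia.
    rewrite s6w e6 q4 eqb0; case: ifP => [/andP[new Pw]|/negbT old]; last first.
      exists td'; split=> // w'; rewrite mem_rcons inE => /predU1P[->|/cl' //].
      by move=> Pw; move: old; rewrite Pw andbT negbK.
    have vw : f v w by rewrite /f /search_rel /= eqa mem_cat mem_head orbT.
    have catE : rcons dn v ++ td ++ rcons td' w = rcons (rcons dn v ++ td ++ td') w.
      by rewrite !rcons_cat.
    exists (rcons td' w); rewrite /Q catE; split; last first.
      move=> w' + Pw'; rewrite !mem_rcons !inE => /predU1P[->|w'pre].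
        by rewrite eqxx.
      by rewrite (cl' w') ?orbT.
    split=> /=; first by rewrite rcons_uniq new.
    + by rewrite update_same q2 size_rcons.
    + move=> j; rewrite size_rcons ltnS q2 /update eqxx map_rcons nth_rcons size_map.
      by case: ltngtP => // lt _; rewrite eq_sym (negPf r_7) q3.
    + move=> w'; rewrite /update /= (negPf r_7) eqxx mem_rcons inE q4 -val_eqE /=.
      by case: eqP.
    + move=> w'; rewrite mem_rcons inE => /predU1P[->|/q5 //].
      by apply: connect_trans (connect1 vw); apply: q5;
        rewrite mem_cat mem_rcons mem_head.
  apply: wp_mono (leqnn _) _ (wp_frame nbrs) => s6 [fr6 [td' [[q1 q2 q3 q4 q5] cl']]].
  have fr6' : frame W A s s6.
    by apply: frame_trans fr5 _; apply: frame_all fr6; rewrite /= !inE !eqxx ?orbT.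
  have s6_14 : vars s6 14 = size dn by rewrite fr6.1 //= update_other.
  apply: wp_assign => //=; exists (B (rcons dn v)).
    rewrite [B dn](bigD1 v) //= nth_adj_lists size_map.
    rewrite (eq_bigl (fun w : 'I_n => w \notin rcons dn v)); last first.
      by move=> w; rewrite mem_rcons inE negb_or andbC.
    rewrite -/(B _) addnC -!addnA; move: (B _) (size _) => B1 z.
    have : (c + (16 + 10)) * z <= (c + 30) * z by rewrite leq_mul2r; apply/orP;
      right; lia.
    move: ((c + 30) * z) ((c + (16 + 10)) * z) => m1 m2; lia.
  exists (rcons dn v), (td ++ td'); split=> //=.
  + by split; [exact: frame_setv | rewrite update_same size_rcons s6_14].
  + have : u \in rcons dn v ++ td by rewrite cat_rcons.
    by move=> uq'; rewrite catA mem_cat uq'.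
  + move=> v' w; rewrite mem_rcons inE => /predU1P[->|v'd] vw.
      by case/andP: (vw); apply: cl'.
    have := cl v' w v'd vw; rewrite -cat_rcons => wd.
    by rewrite catA mem_cat wd.
exists t, s'; split=> //.
have td0 : td = [::].
  by move: nh; rewrite /= s14 s15 size_cat; case: (td) => //= ? ?; lia.
move: mark con uq cl; rewrite td0 cats0 => mark con uq cl v; rewrite mark;
  congr nat_of_bool.
apply/idP/idP; first exact: con.
(* With an empty waiting list the processed vertices are closed under the search relation, so they
   include everything reachable. *)
have closed p y : y \in dn -> path f y p -> last y p \in dn.
  by elim: p y => //= w p IH y yd /andP[/(cl _ _ yd) wd]; apply: IH.
by case/connectP=> p pa ->; apply: closed.
Qed.

(* Programs in terms of whole passes over the graph.  They may read the
   variables 2 and 20, 21, ... and the arrays 10, 11, ...; the others are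
   scratch space of the passes, and variable 10 is the bound variable of a
   test.  [Emit true] appends a set to the record of picks, [Emit false] to the
   certificate. *)
Inductive prog :=
| Set_var of nat & exp
| Find of test & nat
| Emit of bool & test
| Scan of test & nat & nat & nat
| Flood of test & nat & nat
| Then of prog & prog
| Branch of test & prog & prog.

Definition readable_var x := (19 < x) || (x == 2).
Definition readable_array a := 9 < a.

Fixpoint compile (p : prog) : stmt :=
  match p with
  | Set_var x a => Assign x a
  | Find b x => find b x
  | Emit true b => emit 5 6 1 3 b
  | Emit false b => emit 3 4 4 5 b
  | Scan b d m1 m2 => scan_nbrs b d m1 m2
  | Flood b r x => flood b r x
  | Then p1 p2 => Seq (compile p1) (compile p2)
  | Branch b p1 p2 => If b (compile p1) (compile p2)
  end.

(** Costs in units of [input_size]. *)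
Fixpoint prog_cost (p : prog) : nat :=
  match p with
  | Set_var _ a => (exp_cost a).+1
  | Find b _ => test_cost b + 25
  | Emit _ b => test_cost b + 30
  | Scan b _ _ _ => 2 * test_cost b + 65
  | Flood b _ _ => 2 * test_cost b + 150
  | Then p1 p2 => prog_cost p1 + prog_cost p2
  | Branch b p1 p2 => (test_cost b + (prog_cost p1 + prog_cost p2)).+1
  end.

Definition closed_test b :=
  all readable_var (test_vars b) && all readable_array (test_arrays b).
Definition open_test b :=
  all (fun x => readable_var x || (x == 10)) (test_vars b) &&
  all readable_array (test_arrays b).

Fixpoint well_formed (p : prog) : bool :=
  match p with
  | Set_var x a => [&& 19 < x, all readable_var (exp_vars a)
                     & all readable_array (exp_arrays a)]
  | Find b x => (19 < x) && open_test b
  | Emit _ b => open_test b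
  | Scan b d m1 m2 =>
      [&& open_test b, all readable_array [:: d; m1; m2], uniq [:: d; m1; m2]
        & all (fun a => a \notin [:: d; m1; m2]) (test_arrays b)]
  | Flood b r x => [&& open_test b, 9 < r, 19 < x & r \notin test_arrays b]
  | Then p1 p2 => well_formed p1 && well_formed p2
  | Branch b p1 p2 => [&& closed_test b, well_formed p1 & well_formed p2]
  end.

(* The weakest precondition of a program, on states without scratch space. *)
Fixpoint pass_wp (p : prog) (A : state) (h o : seq {set 'I_n})
    (Q : state -> seq {set 'I_n} -> seq {set 'I_n} -> Prop) : Prop :=
  match p with
  | Set_var x a => Q (setv A x (eval A a)) h o
  | Find b x =>
      (forall v : 'I_n, test_at A b v -> Q (setv A x v) h o) /\
      ((forall v : 'I_n, ~~ test_at A b v) -> Q (setv A x n) h o)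
  | Emit true b => Q A (rcons h [set v : 'I_n | test_at A b v]) o
  | Emit false b => Q A h (rcons o [set v : 'I_n | test_at A b v])
  | Scan b d m1 m2 =>
      forall D M1 M2 : nat -> nat,
        (forall v : 'I_n,
           scan_spec (test_at A b) (adj v) (D v) (M1 v) (M2 v)) ->
        Q (set_array (set_array (set_array A d D) m1 M1) m2 M2) h o
  | Flood b r x =>
      exists2 u : 'I_n, vars A x = u & forall R : nat -> nat,
        (forall v : 'I_n, R v = connect (search_rel (test_at A b)) u v) ->
        Q (set_array A r R) h o
  | Then p1 p2 => pass_wp p1 A h o (fun A1 h1 o1 => pass_wp p2 A1 h1 o1 Q)
  | Branch b p1 p2 =>
      if holds A b then pass_wp p1 A h o Q else pass_wp p2 A h o Q
  end.

(** The machine state [s] and the abstract state [A] agree only on what programs may read, so the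
    scratch space of the passes never appears in [pass_wp]. The sets emitted so far are kept as the
    lists [h] and [o]. *)
Definition represents (s A : state) (h o : seq {set 'I_n}) : Prop :=
  [/\ layout adj s, agree readable_var readable_array A s,
      logged 5 6 1 3 s h & logged 3 4 4 5 s o].

Lemma test_at_agree A s b v :
  agree readable_var readable_array A s -> open_test b -> test_at s b v = test_at A b v.
Proof.
move=> [av aa] /andP[]; apply: holds_agree; split=> //= x xr; rewrite /update.
by case: eqP xr => //= _; rewrite orbF => /av.
Qed.

Lemma open_independent xs ys b :
  all (fun x => ~~ readable_var x && (x != 10)) xs ->
  (forall a, a \in test_arrays b -> readable_array a -> a \notin ys) ->
  open_test b -> independent xs ys b.
Proof.
move=> /allP sx sy /andP[/allP tv /allP ta]; apply/andP; split; apply/allP => y yb.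
  by apply/negP => /sx /andP[nr n10]; have := tv y yb; rewrite (negPf nr) (negPf n10).
by apply: sy => //; apply: ta.
Qed.

Lemma independent_scratch xs ys b : all (fun x => ~~ readable_var x && (x != 10)) xs ->
  all (fun a => ~~ readable_array a) ys -> open_test b -> independent xs ys b.
Proof.
move=> sx /allP sy; apply: open_independent => // a _; apply: contraL => /sy.
by [].
Qed.

Lemma represents_frame xs ys s s' A h o : frame xs ys s s' ->
  all (fun x => x \notin [:: 2; 1; 3; 4; 5]) xs ->
  all (fun a => a \notin [:: 1; 2; 3; 4; 5; 6]) ys ->
  represents s A h o ->
  [/\ layout adj s', logged 5 6 1 3 s' h & logged 3 4 4 5 s' o].
Proof.
move=> fr /allP nx /allP ny [lay _ lh lo].
have [nx' ny'] : (forall x, x \in [:: 2; 1; 3; 4; 5] -> x \notin xs) /\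
    (forall a, a \in [:: 1; 2; 3; 4; 5; 6] -> a \notin ys).
  by split=> x xs'; apply: contraL xs'; auto.
split; first by apply: layout_frame fr lay; auto.
- by apply: logged_frame fr lh; auto.
- by apply: logged_frame fr lo; auto.
Qed.

Lemma agree_frame xs ys A A' s s' : agree readable_var readable_array A s ->
  frame xs ys s s' ->
  (forall x, x \in xs -> readable_var x -> vars s' x = vars A' x) ->
  (forall a, a \in ys -> readable_array a -> arrays s' a = arrays A' a) ->
  frame xs ys A A' -> agree readable_var readable_array A' s'.
Proof.
move=> [av aa] [fv fa] hv ha [gv ga]; split=> x xr.
  have [xx|xx] := boolP (x \in xs); first exact: hv.
  by rewrite fv // av // gv.
have [xx|xx] := boolP (x \in ys); first exact: ha.
by rewrite fa // aa // ga.
Qed.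

Lemma unreadable (X : pred nat) xs x (C : Prop) :
  all (fun z => ~~ X z) xs -> x \in xs -> X x -> C.
Proof. by move=> /allP nX /nX /negPf ->. Qed.

Lemma scan_spec_eq P P' l d m1 m2 :
  P =1 P' -> scan_spec P l d m1 m2 -> scan_spec P' l d m1 m2.
Proof.
move=> eqP [-> e1 e2]; split.
- by apply: eq_count => w; rewrite eqP.
- by case/e1=> w; rewrite eqP; exists w.
by case/e2=> w [w']; rewrite !eqP; exists w, w'.
Qed.

(** For a pass that writes variables or arrays, the abstract successor state takes over from the
    machine exactly the values that the pass is meant to produce. *)
Lemma compile_correct p s A h o Q : well_formed p -> represents s A h o ->
  pass_wp p A h o Q ->
  wp (compile p) s (prog_cost p * input_size) (fun s' =>
    exists A' h' o', represents s' A' h' o' /\ Q A' h' o').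
Proof.
elim: p s A h o Q => [x a|b x|k b|b d m1 m2|b r x|p1 IHp p2 IHq|b p1 IHp p2 IHq]
  s A h o Q.
- move=> /and3P[x19 va aa] rep q; have [lay ag _ _] := rep.
  apply: (@wp_le (exp_cost a).+1); first by rewrite leq_pmulr.
  apply: wp_assign => //=; exists (setv A x (eval A a)), h, o; split=> //.
  have fr : frame [:: x] [::] s (setv s x (eval s a)).
    by apply: frame_setv (frame_refl _ _ _); apply: mem_head.
  have [||l1 l2 l3] := represents_frame fr _ _ rep; rewrite //=.
    by rewrite !inE; lia.
  split=> //; apply: (agree_frame ag fr) => //.
    by move=> y; rewrite inE => /eqP-> _; rewrite /= !update_same (eval_agree ag).
  by apply: frame_setv (frame_refl _ _ _); apply: mem_head.
- move=> /andP[x19 ob] rep [q1 q2]; have [lay ag _ _] := rep.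
  have ind : independent [:: 16] [::] b by apply: independent_scratch.
  have := wp_frame (wp_find x lay ind).
  apply: wp_mono => // s' [fr0 res]; exists (setv A x (vars s' x)), h, o; split.
    have fr : frame [:: x; 10; 16] [::] s s'.
      by apply: frame_all fr0; rewrite /= !inE !eqxx ?orbT.
    have [||l1 l2 l3] := represents_frame fr _ _ rep; rewrite //=.
      by rewrite !inE; lia.
    split=> //; apply: (agree_frame ag fr) => //.
      by move=> y; rewrite !inE => /or3P[]/eqP-> // _; rewrite /= update_same.
    by apply: frame_setv (frame_refl _ _ _); apply: mem_head.
  case: res => [[v bv ->]|[-> nb]]; first by apply: q1; rewrite -(test_at_agree _ ag).
  by apply: q2 => v; rewrite -(test_at_agree _ ag).
- move=> ob rep q; have [lay ag lh lo] := rep.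
  have eqset : [set v : 'I_n | test_at s b v] = [set v : 'I_n | test_at A b v].
    by apply/setP => v; rewrite !inE (test_at_agree _ ag).
  case: k ob q => /= ob q.
    have ind : independent [:: 3] [:: 6] b by apply: independent_scratch.
    have := wp_frame (wp_emit lay ind (isT : [&& 3 != 2, 3 != 10, 1 != 10, 1 != 3
      & 5 != 6]) lh).
    apply: wp_mono => // s' [fr res].
    exists A, (rcons h [set v : 'I_n | test_at A b v]), o; split=> //.
    rewrite -eqset; split=> //; first exact: layout_frame fr lay.
      by apply: (agree_frame ag fr) => // y; rewrite !inE; do ?case/orP; move/eqP->.
    exact: logged_frame fr lo.
  have ind : independent [:: 5] [:: 4] b by apply: independent_scratch.
  have := wp_frame (wp_emit lay ind (isT : [&& 5 != 2, 5 != 10, 4 != 10, 4 != 5 &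
    3 != 4]) lo).
  apply: wp_mono => // s' [fr res].
  exists A, h, (rcons o [set v : 'I_n | test_at A b v]); split=> //.
  rewrite -eqset; split=> //; first exact: layout_frame fr lay.
    by apply: (agree_frame ag fr) => // y; rewrite !inE; do ?case/orP; move/eqP->.
  exact: logged_frame fr lh.
- move=> /and4P[ob ua un nb] rep q; have [lay ag _ _] := rep.
  have ind : independent [:: 11; 12; 13] [:: d; m1; m2] b.
    by apply: open_independent => // a /(allP nb).
  move: un ua; rewrite /= !inE negb_or !andbT => /andP[/andP[dm1 dm2] m12]
    /and3P[ud u1 u2].
  have ids : [&& d != m1, d != m2, m1 != m2 & all (leq 3) [:: d; m1; m2]].
    rewrite dm1 dm2 m12 /=; move: ud u1 u2; rewrite /readable_array; lia.
  have := wp_frame (wp_scan_nbrs lay ind ids).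
  apply: wp_mono => // s' [fr res].
  set A' := set_array (set_array (set_array A d (arrays s' d)) m1 (arrays s' m1))
    m2 (arrays s' m2).
  exists A', h, o; split; last first.
    by apply: q => v; apply: scan_spec_eq (res v) => w; apply: test_at_agree.
  have arr a : a \in [:: d; m1; m2] -> arrays s' a = arrays A' a.
    rewrite !inE /A' /= /update => /or3P[]/eqP->;
      by rewrite ?(negPf dm1) ?(negPf dm2) ?(negPf m12) ?eqxx.
  have fr' : frame [:: 10; 11; 12; 13] [:: d; m1; m2] s s'.
    by apply: frame_all fr; rewrite /= !inE !eqxx ?orbT.
  have [||l1 l2 l3] := represents_frame fr' _ _ rep; rewrite //=.
    by rewrite !inE; move: ud u1 u2; rewrite /readable_array; lia.
  split=> //; apply: (agree_frame ag fr') => //.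
  - by move=> y; apply: unreadable.
  - by move=> a ya _; apply: arr.
  - by do 3!(apply: frame_set_array; first by rewrite !inE eqxx ?orbT).
- move=> /and4P[ob r9 x19 nb] rep [u Ax q]; have [lay ag _ _] := rep.
  have ind : independent [:: 11; 12; 13; 14; 15] [:: r; 7] b.
    apply: open_independent => // a ab ua; rewrite !inE negb_or.
    by apply/andP; split; [apply: contraNneq nb => <- | apply: contraTneq ua => ->].
  have sx : vars s x = u by rewrite ag.1 // /readable_var x19.
  have := wp_frame (wp_flood lay sx x19 ind (ltnW (ltnW r9))).
  apply: wp_mono => // s' [fr res]; exists (set_array A r (arrays s' r)), h, o; split.
    have fr' : frame [:: 10; 11; 12; 13; 14; 15] [:: r; 7] s s'.
      by apply: frame_all fr; rewrite /= !inE !eqxx ?orbT.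
    have [||l1 l2 l3] := represents_frame fr' _ _ rep; rewrite //=.
      by rewrite !inE; lia.
    split=> //; apply: (agree_frame ag fr') => //.
    - by move=> y; apply: unreadable.
    - by move=> a; rewrite !inE => /orP[/eqP->|/eqP->//] _; rewrite /= update_same.
    - by apply: frame_set_array (frame_refl _ _ _); rewrite mem_head.
  apply: q => v; rewrite res; congr nat_of_bool; apply: eq_connect => y z /=.
  by rewrite /search_rel /= (test_at_agree _ ag).
- move=> /= /andP[wp1 wp2] rep q; rewrite mulnDl; apply: wp_seq (leqnn _) _.
  apply: wp_mono (leqnn _) _ (IHp _ _ _ _ _ wp1 rep q).
  by move=> s1 [A1 [h1 [o1 [rep1 q1]]]]; apply: IHq rep1 q1.
move=> /= /and3P[/andP[cv ca] wp1 wp2] rep q; have [_ ag _ _] := rep.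
apply: (wp_if (k1 := (prog_cost p1 + prog_cost p2) * input_size)).
  rewrite -!addSn [in leqRHS]mulnDl leq_add2r.
  by rewrite leq_pmulr.
all: rewrite (holds_agree ag) // => hb.
  by rewrite hb in q; apply: wp_mono (IHp _ _ _ _ _ wp1 rep q);
    rewrite // leq_mul2r leq_addr orbT.
rewrite (negPf hb) in q; apply: wp_mono (IHq _ _ _ _ _ wp2 rep q) => //.
by rewrite leq_mul2r leq_addl orbT.
Qed.

End Subroutines.

(** * The recognition program *)

Section Reach.
Variable T : finType.
Implicit Types (h : seq {set T}) (p : algo T).

(* [p'] is what remains of [p] after the picks [h]. *)
Definition reach p h p' : Prop :=
  (forall h' o, runs p' h' o -> runs p (h ++ h') o) /\
  (forall Q, always p Q -> always p' Q).

Lemma reach_refl p : reach p [::] p.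
Proof. by []. Qed.

Lemma reachV p h P k v : reach p h (ChooseV P k) -> P v ->
  reach p (rcons h [set v]) (k v).
Proof.
move=> [ru al] Pv; split=> [h' o kv|Q /al[_]]; last exact.
by rewrite cat_rcons; apply: ru; apply: RunV.
Qed.

Lemma reachS p h P k S : reach p h (ChooseS P k) -> P S ->
  reach p (rcons h S) (k S).
Proof.
move=> [ru al] PS; split=> [h' o kv|Q /al[_]]; last exact.
by rewrite cat_rcons; apply: ru; apply: RunS.
Qed.

Lemma reach_return p h o : reach p h (Return o) -> runs p h o.
Proof. by case=> ru _; rewrite -[h]cats0; apply: ru; apply: RunReturn. Qed.

(** Correctness of the algorithm becomes a source of witnesses: a search of the program for an
    admissible pick cannot fail. *)
Lemma reach_pickV p h P k Q : reach p h (ChooseV P k) -> always p Q -> exists v, P v.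
Proof. by case=> _ al /al[]. Qed.

Lemma reach_pickS p h P k Q : reach p h (ChooseS P k) -> always p Q -> exists S, P S.
Proof. by case=> _ al /al[]. Qed.

End Reach.

(** * The greedy clique in a single scan of the vertex list *)

Section Growth.
Variables (n : nat) (e : rel 'I_n) (vs : seq 'I_n) (adj : 'I_n -> seq 'I_n).
Hypotheses (sym : symmetric e) (irr : irreflexive e).
Hypotheses (vs_ok : vertex_list e vs) (adj_ok : adjacency_lists e adj).

(* Array 10 marks the clique, array 11 counts the neighbours in it, variable 20
   holds its order; variable 16 is the vertex under consideration. *)
Definition grow_program :=
  for_vertices 11
    (Seq (Assign 16 (Get 0 (Var 11)))
      (If (IsEq (Get 11 (Var 16)) (Var 20))
        (Seq
          (Seq (Put 10 (Var 16) (Lit 1))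
            (Seq (Put 6 (Var 3) (Var 16))
              (Seq (Assign 3 (Inc (Var 3)))
                (Seq (Assign 1 (Inc (Var 1)))
                  (Seq (Put 5 (Var 1) (Var 3)) (Assign 20 (Inc (Var 20))))))))
          (for_neighbours 16 (Put 11 (Var 10) (Inc (Get 11 (Var 10))))))
        Skip)).

Lemma size_vs : size vs = n.
Proof.
have [un all_v _] := vs_ok.
have eqvs : vs =i enum 'I_n by move=> v; rewrite all_v mem_enum.
by rewrite (perm_size (uniq_perm un (enum_uniq _) eqvs)) size_enum_ord.
Qed.

Lemma sum_over_vs : \sum_(i < n) nth 0 [seq size (adj v) | v <- vs] i =
  \sum_(v < n) size (adj v).
Proof.
have [un all_v _] := vs_ok.
have eqvs : vs =i enum 'I_n by move=> v; rewrite all_v mem_enum.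
rewrite -(big_mkord xpredT (nth 0 [seq size (adj v) | v <- vs])) -{1}size_vs.
rewrite -(size_map (fun v => size (adj v)) vs) -(big_nth 0 xpredT id) big_map.
by rewrite (perm_big _ (uniq_perm un (enum_uniq _) eqvs)) big_enum.
Qed.

Lemma adj_mem u v : (v \in adj u) = e u v.
Proof. by have [_ -> _] := adj_ok u; rewrite inE. Qed.

Lemma adj_uniq u : uniq (adj u).
Proof. by have [] := adj_ok u. Qed.

Lemma candidate_count (K : {set 'I_n}) v : v \notin K ->
  candidate e K v = (#|nbh e v :&: K| == #|K|).
Proof.
move=> vK; rewrite /candidate vK /=; apply/idP/eqP => [/setIidPr -> //|eqc].
apply/setIidPr/eqP; rewrite eqEcard subsetIr eqc; exact: leqnn.
Qed.

Lemma count_setU1 (K : {set 'I_n}) u v : u \notin K ->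
  #|nbh e v :&: (u |: K)| = #|nbh e v :&: K| + e u v.
Proof.
move=> uK; rewrite setIUr; have [uv|nuv] := boolP (e u v).
  have -> : nbh e v :&: [set u] = [set u].
    by apply/setIidPr; rewrite sub1set inE sym.
  by rewrite cardsU1 inE (negPf uK) andbF addnC.
have -> : nbh e v :&: [set u] = set0.
  apply/setP => w; rewrite !inE; case: (w =P u) => [->|]; rewrite ?andbF //.
  by rewrite sym (negPf nuv).
by rewrite set0U addn0.
Qed.

(* Scanning the vertices by non-increasing degree meets, as the first
   candidate, one of maximum degree: earlier vertices stay non-candidates. *)
Lemma wp_grow s (k : {set 'I_n} -> algo 'I_n) : layout adj s ->
  arrays s 0 = nth 0 [seq val v | v <- vs] ->
  (forall v : 'I_n, arrays s 10 v = 0) -> (forall v : 'I_n, arrays s 11 v = 0) ->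
  vars s 20 = 0 -> logged 5 6 1 3 s ([::] : seq {set 'I_n}) ->
  wp grow_program s (80 * input_size adj) (fun s' => exists K h,
    [/\ is_clique e K /\ greedy e K, forall v, ~~ candidate e K v,
      [/\ forall v : 'I_n, arrays s' 10 v = (v \in K),
        forall v : 'I_n, arrays s' 11 v = #|nbh e v :&: K| & vars s' 20 = #|K|],
      logged 5 6 1 3 s' h & reach (grow_clique e #|'I_n| set0 k) h (k K)]).
Proof.
move=> lay arr0 z10 z11 z20 lg; have [s2 _ _] := lay.
have [un all_v srt] := vs_ok.
have x0 (i : 'I_n) : i < size vs by rewrite size_vs.
pose D i := nth 0 [seq size (adj v) | v <- vs] i.
pose I i s1 := exists K h, [/\ [/\ is_clique e K, greedy e K &
      forall v, v \in K -> v \in take i vs],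
    forall v, v \in take i vs -> ~~ candidate e K v,
    [/\ forall v : 'I_n, arrays s1 10 v = (v \in K),
        forall v : 'I_n, arrays s1 11 v = #|nbh e v :&: K| & vars s1 20 = #|K|],
    logged 5 6 1 3 s1 h
  & reach (grow_clique e #|'I_n| set0 k) h (grow_clique e (n - #|K|) K k)].
apply: (@wp_le (6 + \sum_(i < n) (40 + 15 * D i + 7))).
  rewrite big_split /= big_split /= !sum_nat_const card_ord -big_distrr /=.
  rewrite sum_over_vs /input_size; lia.
apply: wp_mono (leqnn _) (_ : forall s1, I n s1 -> _) _.
  (* After the scan no candidate is left, so the loop of the algorithm stops at once, whatever fuel
     remains. *)
  move=> s1 [K [h [[clK grK _] noc [a10 a11 v20] lh re]]]; exists K, h.
  have maxK v : ~~ candidate e K v by apply: noc; rewrite take_oversize ?size_vs.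
  split=> //; move: re; case: (n - #|K|) => //= f.
  by case: existsP => // -[v]; rewrite (negPf (maxK v)).
apply: (wp_for_vertices (c := fun i => 40 + 15 * D i)) => //.
- exists set0, [::]; split=> //.
  + by split; [exact: is_clique0 | exact: greedy0 | move=> v; rewrite inE].
  + by move=> v; rewrite take0.
  + by split=> [v|v|]; rewrite /= ?inE ?setI0 ?cards0 ?z10 ?z11.
  by rewrite cards0 subn0 card_ord; apply: reach_refl.
move=> i s1 fr s1i [K [h [[clK grK Kt] noc [a10 a11 v20] lh re]]].
pose u := nth i vs i.
have uD : D i = size (adj u) by rewrite /D (nth_map i).
have u0 : nth 0 [seq val v | v <- vs] i = u by rewrite (nth_map i).
have tS : take i.+1 vs = rcons (take i vs) u by rewrite (take_nth i).
have ut : u \notin take i vs.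
  by move: (take_uniq i.+1 un); rewrite tS rcons_uniq => /andP[].
have uK : u \notin K by apply: contra ut; apply: Kt.
have cand := candidate_count uK.
have s1a0 : arrays s1 0 = arrays s 0 by rewrite fr.2.
apply: (wp_seq (k1 := 3) (k2 := 37 + 15 * D i)); first by lia.
apply: wp_assign => //=; rewrite s1a0 arr0 s1i u0.
apply: (wp_if (k1 := 32 + 15 * D i)) => //=; last first.
  rewrite update_same /update /= a11 v20 -cand => ncu.
  apply: wp_loop_free => //=; exists K, h; split=> //.
  - by split=> // v /Kt vt; rewrite tS mem_rcons inE vt orbT.
  - by move=> v; rewrite tS mem_rcons inE => /predU1P[->//|/noc].
rewrite update_same /update /= a11 v20 -cand => cu.
(* Scanned vertices are no candidates, so [w] occurs in the rest of the list, which starts with [u]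
   and has non-increasing degrees. *)
have best w : candidate e K w -> deg e w <= deg e u.
  move=> cw; have: w \in drop i vs.
    have := all_v w; rewrite -{1}(cat_take_drop i vs) mem_cat.
    by case/orP=> // /noc; rewrite cw.
  rewrite (drop_nth i) // inE => /predU1P[->//|wd].
  have /= := drop_sorted i srt; rewrite (drop_nth i) //= path_sortedE.
    by case/andP=> /allP/(_ w wd).
  by move=> a b c /= ba cb; apply: leq_trans cb ba.
apply: (wp_seq (k1 := 18) (k2 := 11 + 15 * D i)); first by lia.
apply: wp_loop_free => //=; rewrite /update /=.
set s3 := setv _ _ _.
have lay1 : layout adj s1 by apply: layout_frame fr lay.
have lay3 : layout adj s3 by [].
pose N pre s4 := forall v : 'I_n,
  arrays s4 11 v = #|nbh e v :&: K| + (v \in (pre : seq 'I_n)).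
have nbrs : wp (for_neighbours 16 (Put 11 (Var 10) (Inc (Get 11 (Var 10))))) s3
    (11 + (5 + 10) * size (adj u)) (N (adj u)).
  apply: (wp_for_neighbours (I := N)) => //.
    by move=> v; rewrite /= /update /= a11 addn0.
  move=> pre w post s4 eqa _ s4w N4; apply: wp_loop_free => //= v.
  have wpre : w \notin pre.
    by have := adj_uniq u; rewrite eqa cat_uniq /= => /and3P[_ /norP[]].
  rewrite /= /update /= s4w mem_rcons inE N4 val_eqE; case: eqP => [->|_].
    by rewrite (negPf wpre) addn0 addn1.
  by rewrite N4.
rewrite uD; apply: wp_mono (leqnn _) _ (wp_frame nbrs) => s4 [fr4 N4].
have KK : #|u |: K| = #|K|.+1 by rewrite cardsU1 uK.
exists (u |: K), (rcons h [set u]); split.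
- split; first by apply: is_cliqueU1 => //; case/andP: cu.
    exact: greedyU1.
  move=> v /setU1P[->|/Kt vt]; rewrite tS mem_rcons inE ?eqxx //.
  by rewrite vt orbT.
- move=> v; rewrite tS mem_rcons inE => /predU1P[->|/noc ncv].
    by rewrite /candidate setU11.
  apply: contra ncv => /andP[vK sK]; apply/andP; split.
    by apply: contra vK => ?; apply: setU1r.
  by apply: subset_trans sK; apply: subsetUr.
- split=> [v|v|].
  + rewrite fr4.2 //= /update /= !inE -val_eqE /= a10; case: eqP => //=.
  + by rewrite N4 count_setU1 // adj_mem sym.
  + by rewrite fr4.1 //= KK v20.
- have -> : [set u] = [set v in [:: u]] by apply/setP => v; rewrite !inE.
  apply: (logged_rcons lh) => //=.
  + by rewrite fr4.1.
  + by rewrite fr4.1 //= addn1.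
  + by move=> j; rewrite fr4.2 //= /update /= addn1.
  + by move=> j lt; rewrite fr4.2 //= /update /= ltn_eqF.
  + by case=> // _; rewrite fr4.2 //= /update /= addn0 eqxx.
(* The algorithm still has fuel for this round, so the pick of [u] can be matched. *)
have lt : #|K| < n.
  rewrite -[n in _ < n](card_ord n) -cardsT; apply: proper_card.
  by apply/properP; split; [apply: subsetT | exists u; rewrite ?inE].
move: re; have -> : n - #|K| = (n - #|u |: K|).+1 by rewrite KK; lia.
rewrite /=; case: existsP => [_|[]]; last by exists u.
move/reachV; apply; rewrite cu; apply/forallP => w; apply/implyP; exact: best.
Qed.

End Growth.

(** * The algorithm written as a sequence of passes *)

Local Notation cand := (Var 10) (only parsing).
Local Notation var_a := 21 (only parsing).
Local Notation var_b := 22 (only parsing).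
Local Notation var_u := 23 (only parsing).
Local Notation var_x := 24 (only parsing).
Local Notation var_v := 25 (only parsing).
Local Notation var_w := 26 (only parsing).
Local Notation var_y := 27 (only parsing).
Local Notation var_d := 28 (only parsing).
Local Notation var_z := 29 (only parsing).
Local Notation verdict := 30 (only parsing).

Definition marked a := Not (IsEq (Get a cand) (Lit 0)).
Definition unmarked a := IsEq (Get a cand) (Lit 0).
Definition equals a := IsEq cand a.
Definition differs a := Not (IsEq cand a).
Definition either b1 b2 := Not (And (Not b1) (Not b2)).
Definition one_of a1 a2 a3 := either (equals a1) (either (equals a2) (equals a3)).
Definition cherry_at x m1 m2 := one_of (Var x) (Get m1 (Var x)) (Get m2 (Var x)).
(** Variable 2 holds the number of vertices, which is the value [Find] returns on failure. *)
Definition find_or b x p q := Then (Find b x) (Branch (IsEq (Var x) (Var 2)) q p).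
Local Notation "p >> q" := (Then p q) (at level 60, right associativity).
Local Notation pick := (Emit true) (only parsing).
Definition reject b := Emit false b >> Set_var verdict (Lit 0).
Definition accept b :=
  Emit false b >> Emit false (Not b) >> Set_var verdict (Lit 1).

(* Arrays 12-14 describe the neighbours outside the clique, array 15 marks the
   component [C] (array 16 a second large component).  A component with at least
   three vertices is found through a vertex with two neighbours in it. *)
Definition step3 :=
  Flood (unmarked 10) 16 var_b >>
  pick (marked 15) >> pick (marked 16) >>
  pick (cherry_at var_a 13 14) >> pick (cherry_at var_b 13 14) >>
  reject (either (cherry_at var_a 13 14) (cherry_at var_b 13 14)).

Definition in_C_minus_u := And (marked 15) (differs (Var var_u)).

Definition step5a :=
  pick (equals (Var var_v)) >> pick (equals (Var var_w)) >>
  reject (either (cherry_at var_a 13 14)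
            (one_of (Var var_x) (Var var_v) (Var var_w))).

(** The component picked has exactly two vertices, [v] and its neighbour, so it coincides with the
    two-vertex set picked next and is recorded twice. *)
Definition step5b :=
  pick (either (equals (Var var_v)) (equals (Get 13 (Var var_v)))) >>
  pick (either (equals (Var var_v)) (equals (Get 13 (Var var_v)))) >>
  reject (either (cherry_at var_a 13 14)
            (one_of (Var var_x) (Var var_v) (Get 13 (Var var_v)))).

Definition step5c :=
  Flood in_C_minus_u 29 var_d >>
  pick (marked 29) >> pick (cherry_at var_d 27 28) >>
  Scan (cherry_at var_d 27 28) 30 31 32 >>
  Find (And (marked 10) (And (differs (Var var_x)) (unmarked 30))) var_y >>
  pick (equals (Var var_y)) >> pick (equals (Var var_v)) >>
  reject (either (cherry_at var_d 27 28)
            (one_of (Var var_v) (Var var_x) (Var var_y))).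

(** Tests 5a and 5b are decided without listing components. The vertex [x] has no neighbour in [C],
    so the components it touches have at most two vertices. Fix an outer neighbour [v] of [x]:
    another outer neighbour non-adjacent to [v] lies in a different component, which is 5a. If there
    is none, only the component of [v] is touched, and 5b asks whether [v] has a neighbour outside
    the clique. *)
Definition step5 :=
  pick (equals (Var var_u)) >>
  Scan (equals (Var var_u)) 17 18 19 >>
  Find (And (marked 10) (unmarked 17)) var_x >>
  pick (equals (Var var_x)) >> pick (cherry_at var_a 13 14) >>
  Set_var var_v (Get 13 (Var var_x)) >>
  Scan (equals (Var var_x)) 20 21 22 >>
  Scan (equals (Var var_v)) 23 24 25 >>
  find_or (And (And (unmarked 10) (marked 20))
             (And (differs (Var var_v)) (unmarked 23))) var_w
    step5a
    (Branch (IsLt (Lit 0) (Get 12 (Var var_v)))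
      step5b
      (Scan in_C_minus_u 26 27 28 >>
       find_or (And in_C_minus_u (IsLt (Lit 1) (Get 26 cand))) var_d
         step5c
         (accept (either (equals (Var var_u))
                    (And (marked 10) (differs (Var var_x))))))).

Definition step6a_reject :=
  pick (equals (Var var_z)) >> pick (cherry_at var_a 13 14) >>
  reject (either (cherry_at var_a 13 14)
            (one_of (Var var_x) (Var var_y) (Var var_z))).

Definition step6a :=
  Branch (IsLt (Lit 0) (Get 12 (Var var_x)))
    (Set_var var_z (Get 13 (Var var_x))) (Set_var var_z (Get 13 (Var var_y))) >>
  step6a_reject.

Definition step6b :=
  Flood in_C_minus_u 29 var_d >>
  pick (marked 29) >> pick (cherry_at var_d 27 28) >>
  Scan (cherry_at var_d 27 28) 30 31 32 >>
  Find (And (marked 10) (And (differs (Var var_x))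
          (And (differs (Var var_y)) (unmarked 30)))) var_z >>
  pick (equals (Var var_z)) >>
  reject (either (cherry_at var_d 27 28)
            (one_of (Var var_x) (Var var_y) (Var var_z))).

Definition step6 :=
  pick (equals (Var var_u)) >>
  Scan (equals (Var var_u)) 17 18 19 >>
  Find (And (marked 10) (unmarked 17)) var_x >>
  pick (equals (Var var_x)) >>
  Find (And (marked 10) (And (differs (Var var_x)) (unmarked 17))) var_y >>
  pick (equals (Var var_y)) >>
  Branch (either (IsLt (Lit 0) (Get 12 (Var var_x)))
                 (IsLt (Lit 0) (Get 12 (Var var_y))))
    step6a
    (Scan in_C_minus_u 26 27 28 >>
     find_or (And in_C_minus_u (IsLt (Lit 1) (Get 26 cand))) var_d
       step6b
       (accept (either (equals (Var var_u))
          (And (marked 10)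
            (And (differs (Var var_x)) (differs (Var var_y))))))).

Definition step7 :=
  pick (cherry_at var_a 13 14) >>
  Scan (marked 15) 17 18 19 >>
  Find (And (marked 10) (unmarked 17)) 31 >>
  Find (And (marked 10) (And (differs (Var 31)) (unmarked 17))) 32 >>
  Find (And (marked 10) (And (differs (Var 31))
          (And (differs (Var 32)) (unmarked 17)))) 33 >>
  pick (one_of (Var 31) (Var 32) (Var 33)) >>
  reject (either (cherry_at var_a 13 14) (one_of (Var 31) (Var 32) (Var 33))).

Definition main_program :=
  Scan (unmarked 10) 12 13 14 >>
  find_or (And (unmarked 10) (IsLt (Lit 1) (Get 12 cand))) var_a
    (Flood (unmarked 10) 15 var_a >>
     find_or (And (And (unmarked 10) (unmarked 15)) (IsLt (Lit 1) (Get 12 cand))) var_b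
       step3
       (pick (marked 15) >>
        find_or (And (marked 15) (IsEq (Inc (Get 11 cand)) (Var 20))) var_u
          step5
          (find_or (And (marked 15) (IsEq (Inc (Inc (Get 11 cand))) (Var 20))) var_u
            step6
            step7)))
    (accept (marked 10)).

Lemma main_well_formed : well_formed main_program.
Proof. by []. Qed.

Lemma test_either A b1 b2 v :
  test_at A (either b1 b2) v = test_at A b1 v || test_at A b2 v.
Proof. by rewrite /test_at /= negb_and !negbK. Qed.

Lemma holds_either A b1 b2 : holds A (either b1 b2) = holds A b1 || holds A b2.
Proof. by rewrite /= negb_and !negbK. Qed.

Lemma test_and A b1 b2 v :
  test_at A (And b1 b2) v = test_at A b1 v && test_at A b2 v.
Proof. by []. Qed.

Lemma test_not A b v : test_at A (Not b) v = ~~ test_at A b v.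
Proof. by []. Qed.

Lemma test_marked A a v : test_at A (marked a) v = (arrays A a v != 0).
Proof. by []. Qed.

Lemma test_unmarked A a v : test_at A (unmarked a) v = (arrays A a v == 0).
Proof. by []. Qed.

Lemma test_equals n A a (v w : 'I_n) :
  eval (setv A 10 v) a = w -> test_at A (equals a) v = (v == w).
Proof. by rewrite /test_at /= => ->. Qed.

Lemma test_differs n A a (v w : 'I_n) :
  eval (setv A 10 v) a = w -> test_at A (differs a) v = (v != w).
Proof. by rewrite /test_at /= => ->. Qed.

Lemma test_one_of n A a1 a2 a3 (v p q r : 'I_n) :
  eval (setv A 10 v) a1 = p -> eval (setv A 10 v) a2 = q ->
  eval (setv A 10 v) a3 = r ->
  test_at A (one_of a1 a2 a3) v = (v \in [set p; q; r]).
Proof.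
move=> e1 e2 e3; rewrite /one_of !test_either (test_equals e1) (test_equals e2).
by rewrite (test_equals e3) !inE orbA.
Qed.

Lemma test_marked_in A a v (P : bool) : arrays A a v = P -> test_at A (marked a) v = P.
Proof. by rewrite test_marked => ->; case: P. Qed.

Lemma test_unmarked_in A a v (P : bool) : arrays A a v = P -> test_at A (unmarked
  a) v = ~~ P.
Proof. by rewrite test_unmarked => ->; case: P. Qed.

Lemma test_cherry_at n A (x : nat) m1 m2 (v a p q : 'I_n) : x != 10 ->
  vars A x = a -> arrays A m1 a = p -> arrays A m2 a = q ->
  test_at A (cherry_at x m1 m2) v = (v \in [set a; p; q]).
Proof.
move=> x10 ax ap aq.
by apply: test_one_of; rewrite /= update_other // ax.
Qed.

Lemma test_union n A b1 b2 (v : 'I_n) (S S' : {set 'I_n}) :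
  test_at A b1 v = (v \in S) -> test_at A b2 v = (v \in S') ->
  test_at A (either b1 b2) v = (v \in S :|: S').
Proof. by rewrite test_either in_setU => -> ->. Qed.

(** * Proof rules for the passes in terms of the graph *)

Section Passes.
Variables (n : nat) (e : rel 'I_n) (adj : 'I_n -> seq 'I_n).
Hypothesis adj_ok : adjacency_lists e adj.
Implicit Types (A : state) (h o : seq {set 'I_n}) (P : pred 'I_n).
Implicit Types Q : state -> seq {set 'I_n} -> seq {set 'I_n} -> Prop.

Lemma then_find P b x p A h o Q :
  (forall v : 'I_n, test_at A b v = P v) -> (exists v, P v) ->
  (forall v, P v -> pass_wp adj p (setv A x v) h o Q) ->
  pass_wp adj (Find b x >> p) A h o Q.
Proof.
move=> bP [v0 Pv0] ok; split=> [v|none]; first by rewrite bP; apply: ok.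
by have := none v0; rewrite bP Pv0.
Qed.

Lemma then_find_or P b (x : nat) p q A h o Q : vars A 2 = n -> x != 2 ->
  (forall v : 'I_n, test_at A b v = P v) ->
  (forall v, P v -> pass_wp adj p (setv A x v) h o Q) ->
  ((forall v, ~~ P v) -> pass_wp adj q (setv A x n) h o Q) ->
  pass_wp adj (find_or b x p q) A h o Q.
Proof.
move=> A2 x2 bP found none; split=> [v|nP] /=.
  rewrite bP update_same update_other ?A2 1?eq_sym // => /found.
  by rewrite gtn_eqF.
rewrite update_same update_other ?A2 1?eq_sym // eqxx; apply: none => v.
by rewrite -bP.
Qed.

Lemma then_pick (S : {set 'I_n}) b p A h o Q :
  (forall v : 'I_n, test_at A b v = (v \in S)) ->
  pass_wp adj p A (rcons h S) o Q -> pass_wp adj (Emit true b >> p) A h o Q.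
Proof.
move=> bS; congr pass_wp; congr rcons.
by apply/setP => v; rewrite !inE bS.
Qed.

Lemma then_emit (S : {set 'I_n}) b p A h o Q :
  (forall v : 'I_n, test_at A b v = (v \in S)) ->
  pass_wp adj p A h (rcons o S) Q -> pass_wp adj (Emit false b >> p) A h o Q.
Proof.
move=> bS; congr pass_wp; congr rcons.
by apply/setP => v; rewrite !inE bS.
Qed.

Definition scanned P (D M1 M2 : nat -> nat) : Prop := forall v : 'I_n,
  [/\ D v = #|[set w in nbh e v | P w]|,
      0 < D v -> exists2 w : 'I_n, e v w && P w & M1 v = w
    & 1 < D v -> exists w w' : 'I_n,
        [/\ cherry e v w w', P w, P w', M1 v = w & M2 v = w']].

Lemma then_scan P b d m1 m2 p A h o Q :
  (forall v : 'I_n, test_at A b v = P v) ->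
  (forall D M1 M2, scanned P D M1 M2 ->
     pass_wp adj p (set_array (set_array (set_array A d D) m1 M1) m2 M2) h o Q) ->
  pass_wp adj (Scan b d m1 m2 >> p) A h o Q.
Proof.
move=> bP ok D M1 M2 sc; apply: ok => v; have [eD e1 e2] := sc v.
have mem w : (w \in adj v) = e v w := adj_mem adj_ok v w.
split.
- rewrite eD -size_filter -(card_uniqP (filter_uniq _ (adj_uniq adj_ok v))).
  by apply: eq_card => w; rewrite !inE mem_filter bP mem andbC.
- by case/e1=> w /andP[]; rewrite mem bP => vw Pw ->; exists w; rewrite ?vw.
case/e2=> w [w' []]; rewrite !mem !bP => /andP[vw Pw] /andP[vw' Pw'] neq -> ->.
by exists w, w'; split=> //; apply/and3P.
Qed.

Lemma then_set (w : nat) x a p A h o Q :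
  eval A a = w -> pass_wp adj p (setv A x w) h o Q ->
  pass_wp adj (Set_var x a >> p) A h o Q.
Proof. by move=> <-. Qed.

(** Counting neighbours equal to [u] produces the row of the adjacency matrix at [u], after which
    adjacency to [u] is a single array lookup. *)
Lemma scanned_pred1 u D M1 M2 (v : 'I_n) : scanned (pred1 u) D M1 M2 -> D v = e v u.
Proof.
move=> sc; have [-> _ _] := sc v; case: (boolP (e v u)) => vu /=.
  apply/eqP/cards1P; exists u; apply/setP => w; rewrite !inE.
  by apply/andP/eqP => [[_ /eqP]|->].
apply/eqP; rewrite cards_eq0; apply/eqP/setP => w; rewrite !inE.
by case: eqP => [->|]; rewrite ?andbF // (negPf vu).
Qed.

Lemma scanned_cherry P D M1 M2 v p q : scanned P D M1 M2 ->
  cherry e v p q -> P p -> P q -> 1 < D v.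
Proof.
move=> sc /and3P[pq vp vq] Pp Pq; have [-> _ _] := sc v.
by apply/card_gt1P; exists p, q; rewrite !inE vp vq Pp Pq.
Qed.

Lemma scanned_gt0 P D M1 M2 (v : 'I_n) : scanned P D M1 M2 ->
  (0 < D v) = [exists w, e v w && P w].
Proof.
move=> sc; have [-> _ _] := sc v; apply/card_gt0P/existsP => -[w].
  by rewrite !inE; exists w.
by move=> vw; exists w; rewrite !inE.
Qed.

Lemma scanned_eq0 (S : {set 'I_n}) D M1 M2 (v : 'I_n) : scanned (mem S) D M1 M2 ->
  (D v == 0) = [forall s in S, ~~ e v s].
Proof.
move=> sc; rewrite eqn0Ngt (scanned_gt0 v sc) negb_exists.
by apply: eq_forallb => w; rewrite negb_and implybE orbC.
Qed.

Lemma branch (P : bool) b p q A h o Q : holds A b = P ->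
  (P -> pass_wp adj p A h o Q) -> (~~ P -> pass_wp adj q A h o Q) ->
  pass_wp adj (Branch b p q) A h o Q.
Proof. by rewrite /= => ->; case: P => [ok _|_ ok]; apply: ok. Qed.

Lemma then_branch (P : bool) b p q r A h o Q : holds A b = P ->
  (P -> pass_wp adj (p >> r) A h o Q) -> (~~ P -> pass_wp adj (q >> r) A h o Q) ->
  pass_wp adj (Branch b p q >> r) A h o Q.
Proof. by rewrite /= => ->; case: P => [ok _|_ ok]; apply: ok. Qed.

Lemma connected_pair (D : {set 'I_n}) v w : connected_set e D -> #|D| <= 2 ->
  v \in D -> w \in D -> v != w -> e v w.
Proof.
move=> conD D2 vD wD vw; apply/negPn/negP => nvw.
have eqD : [set v; w] = D.
  apply/eqP; rewrite eqEcard cards2 vw D2 andbT.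
  by apply/subsetP => z; rewrite !inE => /orP[]/eqP->.
have: D \subset [set v].
  apply: (connected_closed conD vD); rewrite ?set11 // => y z.
  rewrite -{2}eqD !inE => /eqP-> _ /orP[]/eqP-> //; by rewrite (negPf nvw).
by move/subsetP/(_ w wD); rewrite inE eq_sym (negPf vw).
Qed.

Lemma then_flood (B : {set 'I_n}) b r x (u : 'I_n) p A h o Q :
  symmetric e -> vars A x = u -> u \in B ->
  (forall v : 'I_n, test_at A b v = (v \in B)) ->
  (forall R : nat -> nat,
     (forall v : 'I_n, R v = (v \in pblock (components e B) u)) ->
     pass_wp adj p (set_array A r R) h o Q) ->
  pass_wp adj (Flood b r x >> p) A h o Q.
Proof.
move=> sym Ax uB bB ok; exists u => // R eR; apply: ok => v; rewrite eR.
congr nat_of_bool; have [DC uD] := pblock_component sym uB.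
apply/idP/idP => [/connectP[s pa ->]|vD].
  elim: s u uD pa {Ax uB eR DC} (DC) => //= w s IH u uD /andP[] + pa DC.
  rewrite /search_rel /= (adj_mem adj_ok) bB => /andP[uw wB].
  have wD := component_edge sym DC uD wB uw.
  rewrite -(component_pblock sym DC wD); have [DC' wD'] := pblock_component sym wB.
  exact: IH.
have vB := subsetP (component_sub sym DC) _ vD.
move: vD; rewrite mem_component //; apply: connect_sub => y z /and3P[yB zB yz].
by apply: connect1; rewrite /search_rel /= (adj_mem adj_ok) yz bB.
Qed.

Lemma scanned_small (B : {set 'I_n}) D M1 M2 : symmetric e ->
  scanned (mem B) D M1 M2 -> (forall v, v \in B -> D v <= 1) -> small e B.
Proof.
move=> sym sc D1 v p q vB pB qB vp vq; have [eD _ _] := sc v.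
have := D1 v vB; rewrite eD => /card_le1_eqP; apply; by rewrite !inE ?vp ?vq.
Qed.

End Passes.

Section Conditionals.
Variables (n : nat) (adj : 'I_n -> seq 'I_n).
Implicit Types (r c : algo 'I_n) (hr h o : seq {set 'I_n}) (p : prog).

(** These four rules advance the algorithm by one branch or pick while the statement about the
    program stays the same, so both can be stepped through in parallel. *)
Lemma reach_true r hr (b : bool) (c1 c2 : algo _) p A h o Q :
  reach r hr (if b then c1 else c2) -> b ->
  (reach r hr c1 -> pass_wp adj p A h o Q) -> pass_wp adj p A h o Q.
Proof. by case: b => // R _; apply. Qed.

Lemma reach_false r hr (b : bool) (c1 c2 : algo _) p A h o Q :
  reach r hr (if b then c1 else c2) -> ~~ b ->
  (reach r hr c2 -> pass_wp adj p A h o Q) -> pass_wp adj p A h o Q.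
Proof. by case: b => // R _; apply. Qed.

Lemma reach_doV v r hr P k p A h o Q : reach r hr (ChooseV P k) -> P v ->
  (reach r (rcons hr [set v]) (k v) -> pass_wp adj p A h o Q) ->
  pass_wp adj p A h o Q.
Proof. by move=> R Pv; apply; apply: reachV R Pv. Qed.

Lemma reach_doS S r hr P k p A h o Q : reach r hr (ChooseS P k) -> P S ->
  (reach r (rcons hr S) (k S) -> pass_wp adj p A h o Q) ->
  pass_wp adj p A h o Q.
Proof. by move=> R PS; apply; apply: reachS R PS. Qed.

End Conditionals.

(** The continuation is extracted from the body of [recognition] itself, which avoids a second copy
    of the algorithm. *)
Definition after_growth (T : finType) (e : rel T) : {set T} -> algo T :=
  ltac:(let t := eval unfold recognition in (recognition e) in
        match t with grow_clique _ _ _ ?k => exact k end).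

(** * The program follows a run of the algorithm *)

Section Main.
Variables (n : nat) (e : rel 'I_n) (adj : 'I_n -> seq 'I_n).
Hypotheses (sym : symmetric e) (irr : irreflexive e) (ch : chordal e).
Hypothesis adj_ok : adjacency_lists e adj.
Implicit Types (A : state) (h o : seq {set 'I_n}) (K C D S X : {set 'I_n}).

Definition finished A h o : Prop := exists oc : outcome 'I_n,
  [/\ runs (recognition e) h oc, vars A verdict = accepting oc & o = outcome_sets oc].

Lemma reject_correct X b A h : (forall v : 'I_n, test_at A b v = (v \in X)) ->
  reach (recognition e) h (Return (Reject X)) ->
  pass_wp adj (reject b) A h [::] finished.
Proof.
move=> bX R; apply: (then_emit (S := X)) => //.
by exists (Reject X); split=> //; apply: reach_return.
Qed.

Lemma accept_correct K b A h : (forall v : 'I_n, test_at A b v = (v \in K)) ->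
  reach (recognition e) h (Return (Accept K (~: K))) ->
  pass_wp adj (accept b) A h [::] finished.
Proof.
move=> bK R; apply: (then_emit (S := K)) => //.
apply: (then_emit (S := ~: K)) => [v|]; first by rewrite test_not bK inE.
by exists (Accept K (~: K)); split=> //; apply: reach_return.
Qed.

Lemma cherry_subset v p q C :
  v \in C -> p \in C -> q \in C -> [set v; p; q] \subset C.
Proof.
move=> vC pC qC; apply/subsetP => w; rewrite !inE.
by case/orP=> [/orP[]|] /eqP->.
Qed.

(* What the program knows when it has found the component [C]: [K] with the
   counts of neighbours in and outside it, and a connected triple in [C]. *)
Definition knows K (D M1 M2 : nat -> nat) C (a p q : 'I_n) A : Prop :=
  [/\ [/\ vars A 2 = n, vars A 20 = #|K|,
        forall v : 'I_n, arrays A 10 v = (v \in K)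
      & forall v : 'I_n, arrays A 11 v = #|nbh e v :&: K|],
    [/\ forall v : 'I_n, arrays A 12 v = D v,
        forall v : 'I_n, arrays A 13 v = M1 v,
        forall v : 'I_n, arrays A 14 v = M2 v
      & forall v : 'I_n, arrays A 15 v = (v \in C)]
  & [/\ vars A var_a = a, arrays A 13 a = p & arrays A 14 a = q]].

Lemma main_correct A h K :
  vars A 2 = n -> vars A 20 = #|K| ->
  (forall v : 'I_n, arrays A 10 v = (v \in K)) ->
  (forall v : 'I_n, arrays A 11 v = #|nbh e v :&: K|) ->
  is_clique e K -> greedy e K -> (forall v, ~~ candidate e K v) ->
  reach (recognition e) h (after_growth e K) ->
  pass_wp adj main_program A h [::] finished.
Proof.
move=> A2 A20 a10 a11 clK grK maxK R.
have al := always_recognition sym irr ch.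
pose B := ~: K; set CC := components e B.
have inB v : (v \in B) = (v \notin K) by rewrite inE.
apply: (then_scan adj_ok (P := mem B)) => [v|D M1 M2 sc].
  by rewrite test_unmarked a10 eqb0 /= inB.
set A1 := set_array _ _ _.
have {A2}A2 : vars A1 2 = n by [].
have {A20}A20 : vars A1 20 = #|K| by [].
have {a10}a10 (v : 'I_n) : arrays A1 10 v = (v \in K) by rewrite -a10.
have {a11}a11 (v : 'I_n) : arrays A1 11 v = #|nbh e v :&: K| by rewrite -a11.
have a12 (v : 'I_n) : arrays A1 12 v = D v by [].
have a13 (v : 'I_n) : arrays A1 13 v = M1 v by [].
have a14 (v : 'I_n) : arrays A1 14 v = M2 v by [].
clearbody A1; clear A.
rewrite /after_growth /= -/B -/CC in R.
apply: (then_find_or (P := fun v : 'I_n => (v \in B) && (1 < D v))) => //.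
- by move=> v; rewrite test_and test_unmarked a10 eqb0 inB /test_at /= a12.
- move=> a /andP[aB Da].
  have [_ _ /(_ Da)[p [q [apq pB qB Mp Mq]]]] := sc a.
  have [ap aq] : e a p /\ e a q by case/and3P: apq.
  have [CCC aC] := pblock_component sym aB; set C := pblock _ _ in CCC aC.
  have pC : p \in C := component_edge sym CCC aC pB ap.
  have qC : q \in C := component_edge sym CCC aC qB aq.
  have C3 := cherry_connected_card irr aC pC qC apq.
  have S3 := P3_or_K3_cherry sym irr apq.
  set S := [set a; p; q] in S3; have SC : S \subset C := cherry_subset aC pC qC.
  apply: (reach_false R) => [|{}R].
    rewrite negb_forall; apply/existsP; exists C.
    by rewrite negb_imply CCC -ltnNge.
  apply: (then_flood (B := B) (u := a) adj_ok sym) => // [v|F a15].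
    by rewrite test_unmarked a10 eqb0 inB.
  set A2' := set_array _ _ _.
  have {A2 A20 a10 a11 a12 a13 a14 a15}E : knows K D M1 M2 C a p q A2'.
    split; split=> //; first by rewrite -Mp -a13.
    by rewrite -Mq -a14.
  clearbody A2'; clear A1.
  have [[A2 A20 a10 a11] [a12 a13 a14 a15] [Aa Ap Aq]] := E.
  apply: (then_find_or (P := fun v : 'I_n => [&& v \in B, v \notin C & 1 < D v])) => //.
  + move=> v; rewrite 2!test_and !test_unmarked a10 a15 !eqb0 inB -andbA.
    by rewrite /test_at /= a12.
  + move=> b /and3P[bB bC Db].
    have [_ _ /(_ Db)[p' [q' [bpq pB' qB' Mp' Mq']]]] := sc b.
    have [bp bq] : e b p' /\ e b q' by case/and3P: bpq.
    have [CCC' bC'] := pblock_component sym bB; set C' := pblock _ _ in CCC' bC'.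
    have pC' : p' \in C' := component_edge sym CCC' bC' pB' bp.
    have qC' : q' \in C' := component_edge sym CCC' bC' qB' bq.
    have C3' := cherry_connected_card irr bC' pC' qC' bpq.
    have S3' := P3_or_K3_cherry sym irr bpq.
    have SC' := cherry_subset bC' pC' qC'.
    have neq : C' != C by apply: contraNneq bC => <-.
    apply: (reach_true R) => [|{}R].
      apply/exists_inP; exists C' => //; apply/exists_inP; exists C => //.
      exact/and3P.
    apply: (then_flood (B := B) (u := b) adj_ok sym) => // [v|F' a16].
      by rewrite test_unmarked a10 eqb0 inB.
    apply: (then_pick (S := C)) => [v|]; first by apply: test_marked_in; apply: a15.
    apply: (reach_doS (S := C) R) => [|{}R]; first by rewrite CCC.
    apply: (then_pick (S := C')) => [v|]; first by apply: test_marked_in; apply: a16.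
    apply: (reach_doS (S := C') R) => [|{}R]; first exact/and3P.
    pose S' := [set b; p'; q'].
    have testS (A0 : state) : knows K D M1 M2 C a p q A0 ->
        forall v : 'I_n, test_at A0 (cherry_at var_a 13 14) v = (v \in S).
      by move=> [_ _ [Aa' Ap' Aq']] v; apply: test_cherry_at.
    set A3 := set_array _ _ _.
    have E3 : knows K D M1 M2 C a p q A3 by exact: E.
    have testS' (v : 'I_n) : test_at A3 (cherry_at var_b 13 14) v = (v \in S').
      by apply: test_cherry_at; rewrite // -1?Mp' -1?Mq'; [apply: a13 | apply: a14].
    apply: (then_pick (S := S)) => [v|]; first exact: testS E3 v.
    apply: (reach_doS (S := S) R) => [|{}R]; first exact/andP.
    apply: (then_pick (S := S')) => [v|]; first exact: testS'.
    apply: (reach_doS (S := S') R) => [|{}R]; first exact/andP.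
    apply: reject_correct R => v.
    by apply: test_union; [apply: testS | apply: testS'].
  + move=> none.
    set A4 := setv _ _ _; have {}E : knows K D M1 M2 C a p q A4 by exact: E.
    clearbody A4; clear A2 A20 a10 a11 a12 a13 a14 a15 Aa Ap Aq A2' F.
    (* A second large component would contain a vertex with two outer neighbours, and the search
       outside [C] found none. *)
    have uniqC D0 : D0 \in CC -> 2 < #|D0| -> D0 = C.
      move=> D0C /(connected_cherry sym irr (component_connected sym D0C)).
      case=> v [p' [q' [vD pD qD vpq]]].
      have sD := subsetP (component_sub sym D0C).
      have := none v; rewrite (sD v vD) (scanned_cherry sc vpq) ?andbT; try exact: sD.
      move/negPn => vC; rewrite -(component_pblock sym D0C vD).
      exact: component_pblock vC.
    have [[A2 A20 a10 a11] [a12 a13 a14 a15] [Aa Ap Aq]] := E.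
    apply: (reach_false R) => [|{}R].
      apply/exists_inP => -[D1 D1C /exists_inP[D2 D2C /and3P[/eqP neq D13 D23]]].
      by apply: neq; rewrite (uniqC D1) // (uniqC D2).
    apply: (then_pick (S := C)) => [v|]; first by apply: test_marked_in; apply: a15.
    apply: (reach_doS (S := C) R) => [|{}R]; first by rewrite CCC.
    apply: (then_find_or
      (P := fun v : 'I_n => (v \in C) && (#|nbh e v :&: K|.+1 == #|K|))) => //.
    * move=> v; rewrite test_and -A20 -a11; congr andb.
      by apply: test_marked_in; apply: a15.
    * move=> u /andP[uC /eqP cu].
      apply: (reach_true R) => [|{}R]; first by apply/exists_inP; exists u; rewrite ?cu.
      apply: (then_pick (S := [set u])) => [v|].
        by rewrite (@test_equals _ _ _ v u) ?inE.
      apply: (reach_doV (v := u) R) => [|{}R]; first by rewrite uC cu eqxx.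
      apply: (then_scan adj_ok (P := pred1 u)) => [v|U U1 U2 scu].
        by rewrite (@test_equals _ _ _ v u).
      have [x0 x0P] := reach_pickV R al.
      apply: (then_find (P := fun v : 'I_n => (v \in K) && ~~ e u v)) => [v||x
        /andP[xK ux]].
      - rewrite test_and; congr andb; first by apply: test_marked_in; apply: a10.
        by apply: test_unmarked_in; rewrite sym; apply: scanned_pred1 scu.
      - by exists x0.
      apply: (then_pick (S := [set x])) => [v|].
        by rewrite (@test_equals _ _ _ v x) ?inE.
      apply: (reach_doV (v := x) R) => [|{}R]; first by rewrite xK ux.
      apply: (then_pick (S := S)) => [v|]; first exact: test_cherry_at Aa Ap Aq.
      apply: (reach_doS (S := S) R) => [|{}R]; first by rewrite SC S3.
      have onlyx := nonnbrs1 cu xK ux.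
      have xnC := no_nbr1 sym irr ch clK maxK CCC uC cu xK ux.
      (* This makes the entry of array 13 at [x] an actual outer neighbour [v], before it is known
         which of the cases 5a to 5d applies. *)
      have [w0 w0K xw0] := outer_nbr sym irr grK maxK CCC C3 uC cu onlyx.
      have Dx : 0 < D x.
        by rewrite (scanned_gt0 x sc); apply/existsP; exists w0; rewrite xw0 /= inB.
      have [_ /(_ Dx)[v /andP[xv vB'] Mv] _] := sc x; have vB : v \in B := vB'.
      have vK : v \notin K by rewrite -inB.
      apply: (then_set (w := v)); first by rewrite -Mv -a13.
      apply: (then_scan adj_ok (P := pred1 x)) => [w|X X1 X2 scx].
        by rewrite (@test_equals _ _ _ w x).
      apply: (then_scan adj_ok (P := pred1 v)) => [w|V V1 V2 scv].
        by rewrite (@test_equals _ _ _ w v).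
      have touched w : w \in B -> e x w ->
          (pblock CC w \in CC) * (w \in pblock CC w) * (#|pblock CC w| <= 2).
        move=> wB xw; have [DC wD] := pblock_component sym wB; split=> //.
        rewrite leqNgt; apply/negP => /(uniqC _ DC) eqC.
        by rewrite eqC in wD; have := xnC w wD; rewrite xw.
      have [[vDC vD] D2] := touched v vB xv.
      apply: (then_find_or
        (P := fun w : 'I_n => [&& w \in B, e x w, w != v & ~~ e v w])) => //.
      - move=> w; rewrite 3!test_and -andbA inB.
        congr [&& _, _, _ & _].
        + by apply: test_unmarked_in; apply: a10.
        + by apply: test_marked_in; rewrite sym; apply: scanned_pred1 scx.
        by apply: test_unmarked_in; rewrite sym; apply: scanned_pred1 scv.
      - move=> w /and4P[wB xw wv nvw].
        have [[wDC wD] _] := touched w wB xw.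
        have neq : pblock CC w != pblock CC v.
          apply: contra nvw => /eqP eqD; 
          apply: connected_pair (component_connected sym vDC) D2 vD _ _.
            by rewrite -eqD.
          by rewrite eq_sym.
        apply: (reach_true R) => [|{}R].
          apply/card_gt1P; exists (pblock CC w), (pblock CC v); rewrite !inE wDC vDC.
          by split=> //; apply/exists_inP; [exists w | exists v].
        apply: (then_pick (S := [set v])) => [t|].
          by rewrite (@test_equals _ _ _ t v) ?inE.
        apply: (reach_doV (v := v) R) => [|{}R]; first by rewrite vK xv.
        apply: (then_pick (S := [set w])) => [t|].
          by rewrite (@test_equals _ _ _ t w) ?inE.
        apply: (reach_doV (v := w) R) => [|{}R]; first by rewrite -inB wB xw neq.
        apply: reject_correct R => t; apply: test_union; last exact: test_one_of.
        exact: test_cherry_at Aa Ap Aq.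
      move=> no_w; have nbr_x t : t \in B -> e x t -> t != v -> e v t.
        by move=> tB xt tv; have := no_w t; rewrite tB xt tv /= negbK.
      apply: (reach_false R) => [|{}R].
        (* All outer neighbours of [x] are [v] or adjacent to [v], so every component touched by [x]
           is the one of [v]. *)
        apply/negP => /card_gt1P[D3 [D4 []]]; rewrite !inE.
        have touch_v D5 : D5 \in CC -> touches e x D5 -> D5 = pblock CC v.
          move=> D5C /exists_inP[t tD xt].
          have tB := subsetP (component_sub sym D5C) _ tD.
          have [etv|tv] := eqVneq t v;
            first by rewrite -(component_pblock sym D5C tD) etv.
          rewrite -(component_pblock sym D5C tD); apply: component_pblock => //.
          exact: component_edge vDC vD tB (nbr_x t tB xt tv).
        move=> /andP[D3C t3] /andP[D4C t4] /eqP; apply.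
        by rewrite (touch_v D3) // (touch_v D4).
      apply: (branch (P := 0 < D v)) => [|Dv|]; first by rewrite -a12.
        have [_ /(_ Dv)[z /andP[vz zB'] Mz] _] := sc v; have zB : z \in B := zB'.
        have zD := component_edge sym vDC vD zB vz.
        have eqD : pblock CC v = [set v; z].
          apply/esym/eqP; rewrite eqEcard cards2 (edge_neq irr vz) D2 andbT.
          by apply/subsetP => t; rewrite !inE => /orP[]/eqP->.
        have D2' : 2 <= #|pblock CC v| by rewrite eqD cards2 (edge_neq irr vz).
        apply: (reach_true R) => [|{}R].
          apply/exists_inP; exists (pblock CC v) => //; rewrite D2'.
          by apply/exists_inP; exists v.
        have xz : x != z by apply: contraTneq xK => ->; rewrite -inB.
        have eval_z A0 (t : 'I_n) : vars A0 var_v = v -> arrays A0 13 v = z ->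
            eval (setv A0 10 t) (Get 13 (Var var_v)) = z.
          by move=> e1 e2; rewrite -[LHS]/(arrays A0 13 (vars A0 var_v)) e1.
        have testD A0 : vars A0 var_v = v -> arrays A0 13 v = z ->
            forall t : 'I_n, test_at A0 (either (equals (Var var_v))
              (equals (Get 13 (Var var_v)))) t = (t \in pblock CC v).
          move=> e1 e2 t; rewrite test_either (@test_equals _ _ _ t v) //.
          by rewrite (@test_equals _ _ _ t z) ?eval_z // eqD !inE.
        have a13v : M1 v = z := Mz; rewrite -a13 in a13v.
        apply: (then_pick (S := pblock CC v)) => [t|]; first exact: testD.
        apply: (reach_doS (S := pblock CC v) R) => [|{}R].
          by rewrite vDC D2'; apply/exists_inP; exists v.
        apply: (then_pick (S := pblock CC v)) => [t|]; first exact: testD.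
        apply: (reach_doS (S := pblock CC v) R) => [|{}R].
          rewrite subxx eqD cards2 (edge_neq irr vz) /= setUA [x |: _]setUC.
          by apply: P3_or_K3_cherry; rewrite // /cherry xz sym xv vz.
        apply: reject_correct R => t; apply: test_union.
          exact: test_cherry_at Aa Ap Aq.
        by rewrite eqD setUA; apply: test_one_of => //; apply: eval_z.
      rewrite -eqn0Ngt => /eqP Dv; have nvB t : t \in B -> ~~ e v t.
        move=> tB; apply/negP => vt; have := scanned_gt0 v sc; rewrite Dv.
        by move/esym/existsP; apply; exists t; rewrite vt.
      apply: (reach_false R) => [|{}R].
        (* Now [v] is isolated outside the clique and is the only outer neighbour of [x], whereas a
           touched component of order two would give [v] a neighbour. *)
        apply/exists_inP => -[D5 D5C /andP[D52 /exists_inP[t tD xt]]].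
        have tB := subsetP (component_sub sym D5C) _ tD.
        have etv : t = v.
          by apply/eqP/negPn/negP => tv; have := nvB t tB; rewrite nbr_x.
        have xD5 : x \notin D5.
          apply: contraL xK => /(subsetP (component_sub sym D5C)).
          by rewrite -inB.
        have [z zD /and3P[_ _]] :=
          P3_or_K3_nbr sym (component_connected sym D5C) xD5 tD xt D52.
        by rewrite etv => vz;
          have := nvB z (subsetP (component_sub sym D5C) _ zD); rewrite vz.
      apply: (then_scan adj_ok (P := mem (C :\ u))) => [t|W W1 W2 scW].
        rewrite test_and (@test_differs _ _ _ t u) //= in_setD1 andbC; congr andb.
        by apply: test_marked_in; apply: a15.
      apply: (then_find_or (P := fun t : 'I_n => (t \in C :\ u) && (1 < W t))) => //.
      - move=> t; rewrite 2!test_and (@test_differs _ _ _ t u) // in_setD1.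
        rewrite [(t != u) && _]andbC; congr (_ && _ && _).
        by apply: test_marked_in; apply: a15.
      - move=> d /andP[dCu Wd].
        have [_ _ /(_ Wd)[p1 [q1 [dpq pCu qCu Wp Wq]]]] := scW d.
        have [dp dq] : e d p1 /\ e d q1 by case/and3P: dpq.
        have [DC dD] := pblock_component sym dCu; set D5 := pblock _ _ in DC dD.
        have pD : p1 \in D5 := component_edge sym DC dD pCu dp.
        have qD : q1 \in D5 := component_edge sym DC dD qCu dq.
        have D53 := cherry_connected_card irr dD pD qD dpq.
        pose S' := [set d; p1; q1].
        apply: (reach_true R) => [|{}R]; first by apply/exists_inP; exists D5.
        apply: (then_flood (B := C :\ u) (u := d) adj_ok sym) => // [t|F5 a29].
          rewrite test_and (@test_differs _ _ _ t u) // in_setD1 andbC; congr andb.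
          by apply: test_marked_in; apply: a15.
        apply: (then_pick (S := D5)) => [t|].
          by apply: test_marked_in; apply: a29.
        apply: (reach_doS (S := D5) R) => [|{}R]; first by rewrite DC.
        apply: (then_pick (S := S')) => [t|]; first exact: test_cherry_at.
        apply: (reach_doS (S := S') R) => [|{}R].
          by rewrite cherry_subset // P3_or_K3_cherry.
        apply: (then_scan adj_ok (P := mem S')) => [t|Y Y1 Y2 scY].
          exact: test_cherry_at.
        (* The free vertex of the correctness proof is obtained here only through the existence of
           an admissible pick. *)
        have [y0 y0P] := reach_pickV R al.
        apply: (then_find (P := fun y : 'I_n => [&& y \in K, y != x &
          [forall s in S', ~~ e y s]])) => [t||y yP].
        + rewrite 2!test_and (@test_differs _ _ _ t x) //; congr [&& _, _ & _].
            by apply: test_marked_in; apply: a10.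
          by rewrite -(scanned_eq0 t scY).
        + by exists y0.
        apply: (then_pick (S := [set y])) => [t|].
          by rewrite (@test_equals _ _ _ t y) ?inE.
        apply: (reach_doV (v := y) R) => [|{}R]; first exact: yP.
        apply: (then_pick (S := [set v])) => [t|].
          by rewrite (@test_equals _ _ _ t v) ?inE.
        apply: (reach_doV (v := v) R) => [|{}R]; first by rewrite vK xv.
        apply: reject_correct R => t; apply: test_union; last exact: test_one_of.
        exact: test_cherry_at.
      move=> no_d; apply: (reach_false R) => [|{}R].
        apply/exists_inP => -[D5 D5C]; apply/negP; rewrite -leqNgt.
        apply: (smallP sym irr _).1 D5C; apply: (scanned_small sym scW) => t tC.
        by rewrite leqNgt; have := no_d t; rewrite tC.
      apply: accept_correct R => t; rewrite test_either test_and.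
      rewrite (@test_equals _ _ _ t u) // (@test_differs _ _ _ t x) // in_setU1
        in_setD1.
      rewrite [(t != x) && _]andbC; congr (_ || (_ && _)).
      by apply: test_marked_in; apply: a10.
    move=> no1; apply: (reach_false R) => [|{}R].
      by apply/exists_inPn => v vC; have := no1 v; rewrite vC.
    apply: (then_find_or
      (P := fun v : 'I_n => (v \in C) && (#|nbh e v :&: K|.+2 == #|K|))) => //.
    * move=> v; rewrite test_and -A20 -a11; congr andb.
      by apply: test_marked_in; apply: a15.
    * move=> u /andP[uC /eqP cu].
      apply: (reach_true R) => [|{}R]; first by apply/exists_inP; exists u; rewrite ?cu.
      apply: (then_pick (S := [set u])) => [v|].
        by rewrite (@test_equals _ _ _ v u) ?inE.
      apply: (reach_doV (v := u) R) => [|{}R]; first by rewrite uC cu eqxx.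
      apply: (then_scan adj_ok (P := pred1 u)) => [v|U U1 U2 scu].
        by rewrite (@test_equals _ _ _ v u).
      have [x0 x0P] := reach_pickV R al.
      apply: (then_find (P := fun v : 'I_n => (v \in K) && ~~ e u v)) => [v||x
        /andP[xK ux]].
      - rewrite test_and; congr andb; first by apply: test_marked_in; apply: a10.
        by apply: test_unmarked_in; rewrite sym; apply: scanned_pred1 scu.
      - by exists x0.
      apply: (then_pick (S := [set x])) => [v|].
        by rewrite (@test_equals _ _ _ v x) ?inE.
      apply: (reach_doV (v := x) R) => [|{}R]; first by rewrite xK ux.
      have [y0 y0P] := reach_pickV R al.
      apply: (then_find (P := fun v : 'I_n => [&& v \in K, v != x & ~~ e u v]))
        => [v||y yP].
      - rewrite 2!test_and (@test_differs _ _ _ v x) //; congr [&& _, _ & _].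
          by apply: test_marked_in; apply: a10.
        by apply: test_unmarked_in; rewrite sym; apply: scanned_pred1 scu.
      - by exists y0.
      apply: (then_pick (S := [set y])) => [v|].
        by rewrite (@test_equals _ _ _ v y) ?inE.
      apply: (reach_doV (v := y) R) => [|{}R]; first exact: yP.
      apply: (branch (P := (0 < D x) || (0 < D y))).
      - by rewrite holds_either -!a12.
      - move=> Dxy.
        have rest A0 (z : 'I_n) : vars A0 var_z = z -> vars A0 var_x = x ->
            vars A0 var_y = y -> knows K D M1 M2 C a p q A0 ->
            z \notin K -> e x z || e y z ->
            pass_wp adj step6a_reject A0
              (rcons (rcons (rcons (rcons h C) [set u]) [set x]) [set y]) [::] finished.
          move=> ez ex ey [_ _ [Aa' Ap' Aq']] zK xyz.
          apply: (reach_true R) => [|{}R].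
            by apply/existsP; exists z; rewrite zK.
          apply: (then_pick (S := [set z])) => [t|].
            by rewrite (@test_equals _ _ _ t z) ?inE.
          apply: (reach_doV (v := z) R) => [|{}R]; first by rewrite zK.
          apply: (then_pick (S := S)) => [t|]; first exact: test_cherry_at.
          apply: (reach_doS (S := S) R) => [|{}R]; first by rewrite SC S3.
          apply: reject_correct R => t; apply: test_union; last exact: test_one_of.
          exact: test_cherry_at.
        have sample (v : 'I_n) : 0 < D v -> exists2 z : 'I_n, (z \notin K) && e v
          z & M1 v = z.
          move=> Dv; have [_ /(_ Dv)[z /andP[vz zB] Mz] _] := sc v.
          by exists z => //; rewrite vz andbT -inB.
        apply: (then_branch (P := 0 < D x)) => [|Dx|nDx]; first by rewrite -a12.
          have [z /andP[zK xz] Mz] := sample x Dx.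
          apply: (then_set (w := z)); first by rewrite -Mz -a13.
          by apply: (rest _ z); rewrite ?xz.
        have Dy : 0 < D y by move: Dxy; rewrite (negPf nDx).
        have [z /andP[zK yz] Mz] := sample y Dy.
        apply: (then_set (w := z)); first by rewrite -Mz -a13.
        by apply: (rest _ z); rewrite ?yz ?orbT.
      rewrite negb_or -!eqn0Ngt => /andP[/eqP Dx /eqP Dy].
      have nbr0 (v z : 'I_n) : D v = 0 -> z \notin K -> ~~ e v z.
        move=> Dv zK; apply/negP => vz; have := scanned_gt0 v sc; rewrite Dv.
        by move/esym/existsP; apply; exists z; rewrite vz /= inB.
      apply: (reach_false R) => [|{}R].
        by apply/existsPn => z; rewrite negb_and negb_or -implybE; apply/implyP => zK;
          rewrite !nbr0.
      apply: (then_scan adj_ok (P := mem (C :\ u))) => [t|W W1 W2 scW].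
        rewrite test_and (@test_differs _ _ _ t u) //= in_setD1 andbC; congr andb.
        by apply: test_marked_in; apply: a15.
      apply: (then_find_or (P := fun t : 'I_n => (t \in C :\ u) && (1 < W t))) => //.
      - move=> t; rewrite 2!test_and (@test_differs _ _ _ t u) // in_setD1.
        rewrite [(t != u) && _]andbC; congr (_ && _ && _).
        by apply: test_marked_in; apply: a15.
      - move=> d /andP[dCu Wd].
        have [_ _ /(_ Wd)[p1 [q1 [dpq pCu qCu Wp Wq]]]] := scW d.
        have [dp dq] : e d p1 /\ e d q1 by case/and3P: dpq.
        have [DC dD] := pblock_component sym dCu; set D5 := pblock _ _ in DC dD.
        have pD : p1 \in D5 := component_edge sym DC dD pCu dp.
        have qD : q1 \in D5 := component_edge sym DC dD qCu dq.
        have D53 := cherry_connected_card irr dD pD qD dpq.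
        pose S' := [set d; p1; q1].
        have uS' : u \notin S'.
          apply/negP => /(subsetP (cherry_subset dD pD qD)).
          by move/(subsetP (component_sub sym DC)); rewrite !inE eqxx.
        apply: (reach_true R) => [|{}R]; first by apply/exists_inP; exists D5.
        apply: (then_flood (B := C :\ u) (u := d) adj_ok sym) => // [t|F5 a29].
          rewrite test_and (@test_differs _ _ _ t u) // in_setD1 andbC; congr andb.
          by apply: test_marked_in; apply: a15.
        apply: (then_pick (S := D5)) => [t|].
          by apply: test_marked_in; apply: a29.
        apply: (reach_doS (S := D5) R) => [|{}R]; first by rewrite DC.
        apply: (then_pick (S := S')) => [t|]; first exact: test_cherry_at.
        apply: (reach_doS (S := S') R) => [|{}R].
          by rewrite subsetD1 cherry_subset // uS' P3_or_K3_cherry.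
        apply: (then_scan adj_ok (P := mem S')) => [t|Y Y1 Y2 scY].
          exact: test_cherry_at.
        have [z0 z0P] := reach_pickV R al.
        apply: (then_find (P := fun z : 'I_n => [&& z \in K, z != x, z != y &
          [forall s in S', ~~ e z s]])) => [t||z zP].
        + rewrite 3!test_and (@test_differs _ _ _ t x) // (@test_differs _ _ _ t y) //.
          congr [&& _, _, _ & _]; first by apply: test_marked_in; apply: a10.
          by rewrite -(scanned_eq0 t scY).
        + by exists z0.
        apply: (then_pick (S := [set z])) => [t|].
          by rewrite (@test_equals _ _ _ t z) ?inE.
        apply: (reach_doV (v := z) R) => [|{}R]; first exact: zP.
        apply: reject_correct R => t; apply: test_union; last exact: test_one_of.
        exact: test_cherry_at.
      move=> no_d; apply: (reach_false R) => [|{}R].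
        apply/exists_inP => -[D5 D5C]; apply/negP; rewrite -leqNgt.
        apply: (smallP sym irr _).1 D5C; apply: (scanned_small sym scW) => t tC.
        by rewrite leqNgt; have := no_d t; rewrite tC.
      apply: accept_correct R => t; rewrite test_either 2!test_and.
      rewrite (@test_equals _ _ _ t u) // (@test_differs _ _ _ t x) //.
      rewrite (@test_differs _ _ _ t y) // in_setU1 in_setD !inE negb_or.
      rewrite [_ && (t \in K)]andbC; congr (_ || (_ && _)).
      by apply: test_marked_in; apply: a10.
    move=> no2; apply: (reach_false R) => [|{}R].
      by apply/exists_inPn => v vC; have := no2 v; rewrite vC.
    apply: (then_pick (S := S)) => [v|]; first exact: test_cherry_at Aa Ap Aq.
    apply: (reach_doS (S := S) R) => [|{}R]; first by rewrite SC S3.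
    apply: (then_scan adj_ok (P := mem C)) => [v|U U1 U2 scU].
      by apply: test_marked_in; apply: a15.
    (* The program does not look for [U0] itself: its existence ensures that three successive
       searches for distinct vertices of [K] without neighbours in [C] succeed. *)
    have [U0 /and3P[UK U3 Unon]] := reach_pickS R al.
    pose free (t : 'I_n) := (t \in K) && [forall v in C, ~~ e t v].
    have U0free t : t \in U0 -> free t.
      by move=> tU; rewrite /free (subsetP UK) // (forall_inP Unon).
    have [t1 [t2 [t3 [[tU1 tU2 tU3] [t12 t23 t31]]]]] := card_gt2P (eq_leq (esym
      (eqP U3))).
    apply: (then_find (P := free)) => [v||r1 r1P].
    * rewrite test_and /free -(scanned_eq0 v scU); congr andb.
      by apply: test_marked_in; apply: a10.
    * by exists t1; apply: U0free.
    apply: (then_find (P := fun v => (v != r1) && free v)) => [v||r2 /andP[r21 r2P]].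
    * rewrite 2!test_and (@test_differs _ _ _ v r1) // /free -(scanned_eq0 v scU)
      andbCA.
      by congr (_ && (_ && _)); apply: test_marked_in; apply: a10.
    * have [eq1|ne1] := eqVneq t1 r1; last by exists t1; rewrite ne1 U0free.
      by exists t2; rewrite U0free // -eq1 eq_sym t12.
    apply: (then_find (P := fun v => [&& v != r1, v != r2 & free v]))
      => [v||r3 /and3P[r31 r32 r3P]].
    * rewrite 3!test_and (@test_differs _ _ _ v r1) // (@test_differs _ _ _ v r2) //.
      rewrite /free -(scanned_eq0 v scU) [(v != r2) && _ in RHS]andbCA andbCA.
      by congr (_ && (_ && (_ && _))); apply: test_marked_in; apply: a10.
    * have: 0 < #|U0 :\: [set r1; r2]|.
        rewrite -(ltn_add2l #|U0 :&: [set r1; r2]|) addn0 cardsID (eqP U3) ltnS.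
        apply: leq_trans (subset_leq_card (subsetIr _ _)) _.
        by rewrite cards2; case: (r1 != r2).
      case/card_gt0P=> t; rewrite !inE negb_or => /andP[/andP[tr1 tr2] tU].
      by exists t; rewrite tr1 tr2 U0free.
    apply: (then_pick (S := [set r1; r2; r3])) => [v|]; first exact: test_one_of.
    apply: (reach_doS (S := [set r1; r2; r3]) R) => [|{}R].
      have [[r1K /forall_inP r1C] [r2K r2C] [r3K r3C]] :=
        And3 (andP r1P) (andP r2P) (andP r3P).
      apply/and3P; split; first exact: cherry_subset.
        by rewrite -setUA cardsU1 cards2 !inE negb_or !(eq_sym r1) r21 r31
          (eq_sym r2) r32.
      by apply/forall_inP => t; rewrite !inE => /orP[/orP[]|] /eqP->;
        first exact/forall_inP.
    apply: reject_correct R => t; apply: test_union; last exact: test_one_of.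
    exact: test_cherry_at Aa Ap Aq.
move=> none; have sm : small e B.
  apply: (scanned_small sym sc) => v vB; rewrite leqNgt.
  by have := none v; rewrite vB.
apply: (reach_true R) => [|{}R].
  by apply/forall_inP; apply/smallP.
rewrite /CC cover_components // in R.
by apply: accept_correct R => v; rewrite test_not test_unmarked /= a10 eqb0 negbK.
Qed.

End Main.

(** The ordered adjacent pairs are split by which entry is smaller; on each half, forgetting the
    order is injective into the edges. *)
Lemma sum_degrees n (e : rel 'I_n) (adj : 'I_n -> seq 'I_n) :
  irreflexive e -> symmetric e -> adjacency_lists e adj ->
  \sum_(v < n) size (adj v) <= 2 * #|edges e|.
Proof.
move=> irr sym adj_ok; pose E := [set q : 'I_n * 'I_n | e q.1 q.2].
have -> : \sum_(v < n) size (adj v) = #|E|.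
  rewrite (eq_bigr (fun v => \sum_(w | e v w) 1)) => [|v _]; last first.
    rewrite sum1_card -(card_uniqP (adj_uniq adj_ok v)).
    by apply: eq_card => w; rewrite (adj_mem adj_ok).
  by rewrite pair_big_dep -sum1_card /=; apply: eq_bigl => q; rewrite !inE.
have half (F : {set 'I_n * 'I_n}) : F \subset E ->
    (forall v w, (v, w) \in F -> (w, v) \in F -> False) -> #|F| <= #|edges e|.
  move=> /subsetP FE asym; rewrite -(card_in_imset (f := fun q => [set q.1; q.2])).
    apply/subset_leq_card/subsetP => _ /imsetP[q qF ->].
    by apply: imset_f; have := FE q qF; rewrite !inE.
  move=> [a b] [c d] abF cdF /= eqs.
  have : a \in [set c; d] by rewrite -eqs !inE eqxx.
  have : b \in [set c; d] by rewrite -eqs !inE eqxx orbT.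
  have := FE _ abF; rewrite !inE /= => ab.
  case/orP=> /eqP eb /orP[]/eqP ea; rewrite ea eb // in ab abF *.
  - by rewrite irr in ab.
  - by case: (asym c d cdF abF).
  - by rewrite irr in ab.
rewrite -(cardsID [set q : 'I_n * 'I_n | q.1 < q.2] E) mul2n -addnn.
apply: leq_add; apply: half; rewrite ?subsetIl ?subsetDl //.
  by move=> v w; rewrite !inE /= => /andP[_ vw] /andP[_]; rewrite ltnNge ltnW.
move=> v w; rewrite !inE /= -!leqNgt => /andP[wv vw] /andP[vw' _].
have eqvw : v = w by apply/val_inj/eqP; rewrite eqn_leq vw' wv.
by rewrite eqvw irr in vw.
Qed.

Definition full_program : stmt :=
  Seq (Assign 2 (Var 0))
    (Seq grow_program (Seq (compile main_program) (Assign 0 (Var verdict)))).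

Lemma full_program_correct n (e : rel 'I_n) (vs : seq 'I_n) (adj : 'I_n -> seq 'I_n) :
  symmetric e -> irreflexive e -> chordal e ->
  vertex_list e vs -> adjacency_lists e adj ->
  wp full_program (input_state vs adj) ((84 + prog_cost main_program) * input_size adj)
    (fun s => exists h o, runs (recognition e) h o /\ output_state s h o).
Proof.
move=> sym irr ch vs_ok adj_ok; set N := input_size adj.
have logged0 a b c l s : vars s c = 0 -> vars s l = 0 -> arrays s a 0 = 0 ->
    logged a b c l s ([::] : seq {set 'I_n}).
  by move=> sc sl sa; exists [::]; split=> //; case.
apply: (@wp_le (2 + (80 * N + (prog_cost main_program * N + 2)))).
  by move: (prog_cost _) => k; rewrite mulnDl /N /input_size; nat_lia.
apply: wp_seq (leqnn _) _; apply: wp_assign => //=; rewrite update_same.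
set s0 := setv _ _ _.
have lay0 : layout adj s0 by [].
have [lh0 lo0] : logged 5 6 1 3 s0 ([::] : seq {set 'I_n}) /\
    logged 3 4 4 5 s0 ([::] : seq {set 'I_n}) by split; apply: logged0.
have := wp_grow sym vs_ok adj_ok (after_growth e) lay0 erefl
  (fun=> erefl) (fun=> erefl) erefl lh0.
move/wp_frame=> grown; apply: wp_seq (leqnn _) _.
apply: wp_mono (leqnn _) _ grown => s1 [fr [K [h [[clK grK] maxK [a10 a11 v20] lh
  re]]]].
have lay1 : layout adj s1 by apply: layout_frame fr lay0.
have rep1 : represents adj s1 s1 h [::].
  by split=> //; apply: logged_frame fr lo0.
have n1 : vars s1 2 = n by case: lay1.
have := main_correct sym irr ch adj_ok n1 v20 a10 a11 clK grK maxK re.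
move/(compile_correct (adj_uniq adj_ok) main_well_formed rep1) => done.
apply: wp_seq (leqnn _) _; apply: wp_mono (leqnn _) _ done.
move=> s2 [A [h' [o' [[_ ag lh' lo'] [oc [ru ver eqo]]]]]].
apply: wp_assign => //; exists h', oc; split=> //.
have [size_h st_h] := logged_stores lh'; have [_ st_o] := logged_stores lo'.
split=> //=; last by rewrite -eqo.
by rewrite update_same ag.1.
Qed.

(* First part: on a chordal graph, every execution of the algorithm reaches a
   return, and what it returns is a valid certificate of the right answer.
   Second part: one program carries the algorithm out in time O(n + m), for
   every numbering of the vertices and all degree-ordered input lists; the
   added 1 only matters for the graph without vertices. *)
Theorem theorem5p4 :
  (forall (T : finType) (e : rel T),
     symmetric e -> irreflexive e -> chordal e ->
     never_stuck (recognition e) /\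
     forall (h : seq {set T}) (o : outcome T), runs (recognition e) h o ->
       certified e o /\ (accepting o <-> polar e)) /\
  exists (p : stmt) (c : nat),
    forall (n : nat) (e : rel 'I_n) (vs : seq 'I_n) (adj : 'I_n -> seq 'I_n),
      symmetric e -> irreflexive e -> chordal e ->
      vertex_list e vs -> adjacency_lists e adj ->
      exists (t : nat) (s : state) (h : seq {set 'I_n}) (o : outcome 'I_n),
        [/\ exec p (input_state vs adj) t s,
            t <= c * (n + #|edges e|).+1,
            runs (recognition e) h o
          & output_state s h o].
Proof.
split=> [T e sym irr ch|]; first exact: recognition_correct.
exists full_program, (2 * (84 + prog_cost main_program)) => n e vs adj sym irr ch vs_ok adj_ok.
have [t [s [ex le [h [o [ru out]]]]]] := full_program_correct sym irr ch vs_ok adj_ok.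
exists t, s, h, o; split=> //; apply: leq_trans le _.
(* The adjacency lists have total length at most twice the number of edges, which accounts for the
   factor 2 in the constant. *)
rewrite [2 * _]mulnC -mulnA leq_mul2l; apply/orP; right.
have := sum_degrees irr sym adj_ok; rewrite /input_size.
by move: (\sum_(_ < _) _) #|edges e| => a b; nat_lia.
Qed.
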